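(* Let $\mathcal{F}$ be a non-empty set of finite undirected graphs. Then the almost-sure theory of $\mathrm{Forb}(\mathcal{F})$ equals the first-order theory of the generic $(k_{\mathcal{F}}-1)$-partite graph.
   Context: For a set $\mathcal{F}$ of finite undirected graphs, $\mathrm{Forb}(\mathcal{F})$ denotes the class of all finite undirected graphs $G$ such that no $F \in \mathcal{F}$ has a homomorphism to $G$. For non-empty $\mathcal{F}$, $k_{\mathcal{F}} := \min_{G \in \mathcal{F}} \chi(G)$, where $\chi(G)$ is the chromatic number (smallest $n$ with $G \to K_n$). The almost-sure theory of a class $\mathcal{C}$ is the set of first-order sentences whose probability of holding in a uniformly random member of $\mathcal{C}$ with vertex set $\{1,\dots,n\}$ tends to $1$. The generic $k$-partite graph is $U_{K_k}$: the countable model of the ($\omega$-categorical) model companion of the theory $\{\neg\phi \mid \phi \text{ primitive positive and } K_k \models \neg\phi\}$; a countable graph embeds into $U_{K_k}$ iff it maps homomorphically to $K_k$. *)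

(* Defs.v *)
From mathcomp Require Import all_boot all_algebra.
From mathcomp Require Import boolp.
Set Implicit Arguments. Unset Strict Implicit. Unset Printing Implicit Defensive.
Import GRing.Theory Num.Theory.

Inductive fo_form : Type :=
| FTrue : fo_form
| FFalse : fo_form
| FEq : nat -> nat -> fo_form
| FEdge : nat -> nat -> fo_form
| FNot : fo_form -> fo_form
| FAnd : fo_form -> fo_form -> fo_form
| FOr : fo_form -> fo_form -> fo_form
| FImp : fo_form -> fo_form -> fo_form
| FEx : nat -> fo_form -> fo_form
| FAll : nat -> fo_form -> fo_form.

Fixpoint fv (f : fo_form) : seq nat :=
  match f with
  | FTrue | FFalse => [::]
  | FEq i j | FEdge i j => [:: i; j]
  | FNot g => fv g
  | FAnd g h | FOr g h | FImp g h => fv g ++ fv h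
  | FEx i g | FAll i g => filter (fun j => j != i) (fv g)
  end.

Definition sentence (f : fo_form) : Prop := fv f = [::].

Definition upd (T : Type) (a : nat -> T) (i : nat) (x : T) : nat -> T :=
  fun j => if j == i then x else a j.

Fixpoint sat (T : Type) (E : T -> T -> Prop) (a : nat -> T) (f : fo_form) : Prop :=
  match f with
  | FTrue => True
  | FFalse => False
  | FEq i j => a i = a j
  | FEdge i j => E (a i) (a j)
  | FNot g => ~ sat E a g
  | FAnd g h => sat E a g /\ sat E a h
  | FOr g h => sat E a g \/ sat E a h
  | FImp g h => sat E a g -> sat E a h
  | FEx i g => exists x : T, sat E (upd a i x) g
  | FAll i g => forall x : T, sat E (upd a i x) g
  end.

Definition holds (T : Type) (E : T -> T -> Prop) (f : fo_form) : Prop :=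
  forall a : nat -> T, sat E a f.

Fixpoint is_pp (f : fo_form) : Prop :=
  match f with
  | FTrue | FEq _ _ | FEdge _ _ => True
  | FAnd g h => is_pp g /\ is_pp h
  | FEx _ g => is_pp g
  | _ => False
  end.

Fixpoint is_qf (f : fo_form) : Prop :=
  match f with
  | FEx _ _ | FAll _ _ => False
  | FNot g => is_qf g
  | FAnd g h | FOr g h | FImp g h => is_qf g /\ is_qf h
  | _ => True
  end.

Fixpoint is_existential (f : fo_form) : Prop :=
  match f with
  | FEx _ g => is_existential g
  | g => is_qf g
  end.

Record finite_graph := FiniteGraph {
  fg_n : nat;
  fg_adj : rel 'I_fg_n;
  fg_sym : symmetric fg_adj;
  fg_irr : irreflexive fg_adj }.

Definition hom_to_K (G : finite_graph) (m : nat) : Prop :=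
  exists f : 'I_(fg_n G) -> 'I_m, forall x y, fg_adj x y -> f x != f y.

Lemma hom_to_K_self G : exists m, hom_to_K G m.
Proof.
exists (fg_n G), id => x y Hxy; apply/eqP => Exy.
by move: Hxy; rewrite Exy (@fg_irr G).
Qed.

Definition chi (G : finite_graph) : nat :=
  ex_minn (P := fun m => `[< hom_to_K G m >])
    (let: ex_intro m Hm := hom_to_K_self G in ex_intro _ m (asboolT Hm)).

Definition is_kF (F : finite_graph -> Prop) (k : nat) : Prop :=
  (exists G, F G /\ chi G = k) /\ (forall G, F G -> k <= chi G).

Definition lgraph (n : nat) := {ffun 'I_n * 'I_n -> bool}.

Definition is_lgraph n (g : lgraph n) : Prop :=
  (forall x, g (x, x) = false) /\ (forall x y, g (x, y) = g (y, x)).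

Definition ladj n (g : lgraph n) : 'I_n -> 'I_n -> Prop := fun x y => g (x, y).

Definition hom_fl (H : finite_graph) n (g : lgraph n) : Prop :=
  exists f : 'I_(fg_n H) -> 'I_n, forall x y, fg_adj x y -> g (f x, f y).

Definition in_Forb (F : finite_graph -> Prop) n (g : lgraph n) : Prop :=
  is_lgraph g /\ forall H, F H -> ~ hom_fl H g.

Definition count_Forb (F : finite_graph -> Prop) (n : nat) : nat :=
  #|[set g : lgraph n | `[< in_Forb F g >] ]|.

Definition count_Forb_sat (F : finite_graph -> Prop) (phi : fo_form) (n : nat) : nat :=
  #|[set g : lgraph n | `[< in_Forb F g /\ holds (@ladj n g) phi >] ]|.

Local Open Scope ring_scope.
Definition prob_Forb (F : finite_graph -> Prop) (phi : fo_form) (n : nat) : rat :=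
  (count_Forb_sat F phi n)%:R / (count_Forb F n)%:R.

Definition almost_sure (F : finite_graph -> Prop) (phi : fo_form) : Prop :=
  forall eps : rat, 0 < eps ->
    exists N : nat, forall n : nat, (N <= n)%N -> 1 - eps < prob_Forb F phi n.
Local Close Scope ring_scope.

Definition K_E (k : nat) : 'I_k -> 'I_k -> Prop := fun i j => i != j.

Definition models_Tk (k : nat) (T : Type) (E : T -> T -> Prop) : Prop :=
  forall phi, sentence phi -> is_pp phi -> ~ holds (@K_E k) phi -> ~ holds E phi.

Definition is_graph (T : Type) (E : T -> T -> Prop) : Prop :=
  forall x y, E x y -> E y x.

Definition embedding (T V : Type) (E : T -> T -> Prop) (E' : V -> V -> Prop)
  (f : T -> V) : Prop :=
  (forall x y, f x = f y -> x = y) /\ (forall x y, E x y <-> E' (f x) (f y)).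

Definition ec_Tk (k : nat) (T : Type) (E : T -> T -> Prop) : Prop :=
  forall (V : Type) (E' : V -> V -> Prop) (f : T -> V),
    is_graph E' -> models_Tk k E' -> embedding E E' f ->
    forall (phi : fo_form) (a : nat -> T), is_existential phi ->
      sat E' (fun i => f (a i)) phi -> sat E a phi.

Definition countable_type (T : Type) : Prop :=
  exists g : T -> nat, forall x y, g x = g y -> x = y.

(* countable models of the model companion of T_k
   = countable existentially closed graph models of T_k *)
Definition generic_partite (k : nat) (T : Type) (E : T -> T -> Prop) : Prop :=
  countable_type T /\ is_graph E /\ models_Tk k E /\ ec_Tk k E.

(* Main.v *)
Require Import Defs.
From mathcomp Require Import all_boot all_algebra.
From mathcomp Require Import boolp.
From mathcomp Require Import order zify.
From mathcomp Require classical_sets filter.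
From Stdlib Require PeanoNat.
Set Implicit Arguments. Unset Strict Implicit. Unset Printing Implicit Defensive.

(**
  Put r = k - 1.  Every r-colorable graph lies in Forb(F), and a member of
  chromatic number k maps to K_k, so every graph of Forb(F) is K_{r+1}-free.
  It therefore suffices that almost every K_{r+1}-free graph is r-colorable and
  has the extension property of the generic r-partite graph (Kolaitis, Proemel
  and Rothschild); an Ehrenfeucht-Fraisse game then finishes the proof.

  Adding one vertex multiplies the number of r-colorable graphs by at least
  2^(n - n/r).  Hence a class of K_{r+1}-free graphs is negligible as soon as
  each member is obtained from a K_{r+1}-free graph on t fewer vertices in
  2^(t(1-1/r)n - epsilon n) ways, t constant.  Five such classes are
  discarded.  Every other graph contains a complete r-partite graph W with
  large constant parts such that the sets T_i of vertices with many neighbours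
  in all parts of W but the i-th have size about n/r, are almost independent,
  and look random to every vertex; coloring a vertex by the T_i in which it
  has few neighbours then yields the extension property.
*)

(** * Counting subsets *)

(** Neither class of graphs is ever counted. Only the growth under adding vertices is compared, in
    bits, so constant factors may be lost everywhere. Deleting a whole blow-up can save any wanted
    multiple of n bits, and its parts may then be listed naively; deleting a single vertex saves
    only a small fraction of n, and every parameter must then be a set of small proportion, cheap by
    the entropy bound.

    The coloring meets a circularity. A vertex looks random only once it is sparse to some T_i, but
    that sparseness is obtained by building a K_r in its neighbourhood, which already needs
    randomness. The vertices of T_i break the circle: they are sparse to T_i from the start, and the
    clique is built from them, at a finer scale than the one used for arbitrary vertices. This is
    why skewed vertices are discarded at two scales.

    On the logical side a model of T_k carries no coloring. It is recovered by compactness, is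
    unique up to a permutation of the colors once the extension property holds, and enters the
    positions of the game. *)

(* Both entropy bounds below compare the number of small subsets X of A with this
   sum, in which each of them has a large weight. *)
Lemma sum_powerset_expn (V : finType) (A : {set V}) M :
  \sum_(X in powerset A) M ^ (#|A| - #|X|) = M.+1 ^ #|A|.
Proof.
rewrite -(addn1 M) expnDn.
rewrite (partition_big (fun X : {set V} => inord #|X| : 'I_(#|A|.+1)) predT) //=.
apply: eq_bigr => i _; rewrite exp1n muln1 -(cards_draws A i) -sum_nat_const.
have P X : (X \in powerset A) && (inord #|X| == i :> 'I_(#|A|.+1)) =
           (X \in [set B : {set V} | B \subset A & #|B| == i]).
  rewrite inE powersetE; case: (boolP (X \subset A)) => //= sXA.
  by rewrite -val_eqE /= inordK // ltnS subset_leq_card.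
rewrite (eq_bigl _ _ P); apply: eq_bigr => X; rewrite inE => /andP[_ /eqP->] //.
Qed.

Lemma leq_root_expn x a q : 0 < q -> x ^ q <= 2 ^ a -> x <= 2 ^ (a %/ q).+1.
Proof.
move=> q0 H; rewrite -(leq_exp2r _ _ q0) -expnM.
apply: leq_trans H _; rewrite leq_exp2l //.
by move: (ltn_ceil a q0); lia.
Qed.

(** The mean value bound for the power [p.+1] on an interval of length one, in subtraction-free
    form. *)
Lemma bernoulli_expn N p : N.+1 ^ p.+1 <= N ^ p.+1 + p.+1 * N.+1 ^ p.
Proof.
elim: p => [|p IH]; first by rewrite !expn1 expn0; lia.
have le : N ^ p.+1 <= N.+1 ^ p.+1 by rewrite leq_exp2r.
have -> : N.+1 ^ p.+2 = N * N.+1 ^ p.+1 + N.+1 ^ p.+1 by rewrite expnS; lia.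
have -> : N ^ p.+2 = N * N ^ p.+1 by rewrite expnS.
have : N * N.+1 ^ p.+1 <= N * N ^ p.+1 + p.+1 * (N * N.+1 ^ p).
  by rewrite mulnCA -mulnDr leq_mul2l IH orbT.
have -> : N.+1 ^ p.+1 = N * N.+1 ^ p + N.+1 ^ p by rewrite expnS; lia.
lia.
Qed.

(** With m = 2(p+1) this says (1 - 1/m)^m >= 1/4. At exponent m/2 the bound [bernoulli_expn] already
    gives 1/2, since its error term is half of the left side; squaring finishes. *)
Lemma expn_succ_le4 p : p.+1.*2 ^ p.+1.*2 <= 4 * p.+1.*2.-1 ^ p.+1.*2.
Proof.
have : p.+1.*2 ^ p.+1 <= 2 * p.+1.*2.-1 ^ p.+1.
  have := bernoulli_expn p.+1.*2.-1 p.
  have -> : p.+1.*2.-1.+1 = p.+1.*2 by lia.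
  by rewrite [p.+1.*2 ^ p.+1]expnS; lia.
move=> H; rewrite -(addnn p.+1) !expnD -[4]/(2 * 2) addnn mulnACA.
exact: leq_mul.
Qed.

(** An entropy bound without logarithms: sets of proportion 1/h cost at most 1/q bit per element as
    soon as h is large. The bound is in terms of [k] rather than [#|A|], so that it also applies to
    a set known only to be smaller than the whole graph. *)
Lemma card_small_subsets q : 0 < q -> exists h0, forall h, h0 <= h ->
  forall (V : finType) (A : {set V}) k, #|A| <= k ->
  #|[set X in powerset A | h * #|X| <= k]| <= 2 ^ (k %/ q).+1.
Proof.
case: q => // q _.
(* Here [M.+1] is [6 * q.+1]: even, as [expn_succ_le4] requires, and large enough for the final
   comparison of exponents. *)
pose M := q.+1.*2.-1 + q.+1.*2.-1.+1.*2.
have [p Mp] : exists p, M.+1 = p.+1.*2 /\ 3 * q.+1 <= M.+1.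
  by exists (M.+1./2.-1); rewrite /M; lia.
case: Mp => Mp qM.
exists (M.+1 * M) => h0 leh V A k Ak.
pose S := [set X in powerset A | M.+1 * M * #|X| <= k].
apply: (@leq_trans #|S|).
  apply/subset_leq_card/subsetP => X; rewrite !inE => /andP[-> /=].
  by apply: leq_trans; rewrite leq_mul2r leh orbT.
pose h := M.+1 * M.
have M0 : 0 < M by rewrite /M; lia.
have step X : X \in S -> M ^ (#|A| * h) <= M ^ k * (M ^ (#|A| - #|X|)) ^ h.
  rewrite inE => /andP[_ hX]; rewrite -expnM -expnD leq_pexp2l //.
  by rewrite mulnBl; move: hX; rewrite -/h; lia.
have [->|/set0Pn[X0 X0S]] := eqVneq S set0; first by rewrite cards0.
have h_gt0 : 0 < h by rewrite muln_gt0 M0.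
(* Raising everything to the power [h] replaces the division in the size bound k/h. *)
have main : #|S| ^ h * M ^ (#|A| * h) <= M ^ k * M.+1 ^ (#|A| * h).
  have [X XS Xmin] : exists2 X, X \in S & forall Y, Y \in S ->
      M ^ (#|A| - #|X|) <= M ^ (#|A| - #|Y|).
    by case: (arg_minnP (fun X : {set V} => M ^ (#|A| - #|X|)) X0S) => X; exists X.
  have le1 : #|S| * M ^ (#|A| - #|X|) <= M.+1 ^ #|A|.
    rewrite -(sum_powerset_expn A M) -sum_nat_const.
    rewrite [leqRHS](big_setID S) /= (setIidPr _); last first.
      by apply/subsetP => Y; rewrite inE => /andP[].
    by apply: leq_trans (leq_addr _ _); apply: leq_sum.
  apply: (@leq_trans (#|S| ^ h * (M ^ k * (M ^ (#|A| - #|X|)) ^ h))).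
    by rewrite leq_mul2l step // orbT.
  by rewrite mulnCA -expnMn leq_mul2l expnM leq_exp2r // le1 orbT.
(* As h = (M+1)M, the ratio (1+1/M) appears with exponent (M+1) times M|A|, and each block of M+1
   factors costs at most 4. *)
have e4 : M.+1 ^ (#|A| * h) <= 2 ^ (2 * M * k) * M ^ (#|A| * h).
  have -> : #|A| * h = M.+1 * (M * #|A|) by rewrite /h; lia.
  rewrite 2!expnM [M ^ (_ * _)]expnM.
  have := expn_succ_le4 p; rewrite -Mp /= => H4.
  apply: (@leq_trans ((4 * M ^ M.+1) ^ (M * #|A|))).
    rewrite -expnM; case: (M * #|A|) => [|z] //; by rewrite leq_exp2r.
  rewrite expnMn leq_mul2r; apply/orP; right.
  by rewrite -[4]/(2 ^ 2) -!expnM leq_exp2l //; nia.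
have fin : #|S| ^ h <= 2 ^ (3 * M * k).
  have p0 : 0 < M ^ (#|A| * h) by rewrite expn_gt0 M0.
  rewrite -(leq_pmul2r p0); apply: leq_trans main _.
  apply: leq_trans (leq_mul (leqnn _) e4) _.
  rewrite mulnA leq_mul2r; apply/orP; right.
  have -> : 3 * M * k = M * k + 2 * M * k by lia.
  rewrite expnD leq_mul2r; apply/orP; right.
  by rewrite expnM; case: (k) => [|z] //; rewrite leq_exp2r // ltnW // ltn_expl.
apply: leq_root_expn => //.
have h3 : (#|S| ^ q.+1) ^ (3 * M) <= (2 ^ k) ^ (3 * M).
  rewrite -!expnM (mulnC k); apply: leq_trans fin.
  by rewrite leq_pexp2l // ?card_gt0; [apply/set0Pn; exists X0 | rewrite /h; nia].
by move: h3; rewrite leq_exp2r //; lia.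
Qed.

(** Weight 2 in [sum_powerset_expn] gives |Q|^8 2^(6a) <= 6561^a, and 6561 <= 2^13 leaves 2^(7a).
    What matters is that 7/8 is below 1: a trace of this kind saves an eighth of its bits. *)
Lemma card_quarter_subsets (V : finType) (S : {set V}) :
  #|[set X in powerset S | 4 * #|X| < #|S|]| <= 2 ^ (7 * #|S| %/ 8).+1.
Proof.
set a := #|S|; pose Q := [set X in powerset S | 4 * #|X| < a]; rewrite -/Q.
apply: leq_root_expn => //.
have [->|/set0Pn[X0 X0S]] := eqVneq Q set0; first by rewrite cards0.
have main : #|Q| ^ 4 * 2 ^ (3 * a) <= 81 ^ a.
  have [X XS Xmin] : exists2 X, X \in Q & forall Y, Y \in Q ->
      2 ^ (a - #|X|) <= 2 ^ (a - #|Y|).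
    by case: (arg_minnP (fun X : {set V} => 2 ^ (a - #|X|)) X0S) => X; exists X.
  have le1 : #|Q| * 2 ^ (a - #|X|) <= 3 ^ a.
    rewrite -(sum_powerset_expn S 2) -sum_nat_const.
    rewrite [leqRHS](big_setID Q) /= (setIidPr _); last first.
      by apply/subsetP => Y; rewrite inE => /andP[].
    by apply: leq_trans (leq_addr _ _); apply: leq_sum.
  have -> : 81 ^ a = (3 ^ a) ^ 4 by rewrite -expnM mulnC expnM.
  apply: (@leq_trans ((#|Q| * 2 ^ (a - #|X|)) ^ 4)); last by rewrite leq_exp2r.
  rewrite expnMn leq_mul2l -expnM leq_exp2l //; apply/orP; right.
  by move: XS; rewrite inE => /andP[_]; rewrite -/a; lia.
have p0 : 0 < 2 ^ (6 * a) by rewrite expn_gt0.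
rewrite -(leq_pmul2r p0) -expnD.
have -> : 7 * a + 6 * a = 13 * a by lia.
apply: (@leq_trans ((81 ^ a) ^ 2)).
  apply: (@leq_trans ((#|Q| ^ 4 * 2 ^ (3 * a)) ^ 2)); last by rewrite leq_exp2r.
  by rewrite expnMn -!expnM; have -> : 3 * a * 2 = 6 * a by lia.
rewrite -expnM mulnC !expnM; case: (a) => [|z]; first by rewrite !expn0.
by rewrite leq_exp2r //; lia.
Qed.

(** A set is determined by its traces on [T], on [S] and on the rest. A single constraint is the
    case where [S] is empty and [G] is [[set set0]]. *)
Lemma card_subset_split (V : finType) (B T S : {set V}) (F G : {set {set V}}) :
  T \subset B -> S \subset B -> [disjoint T & S] ->
  #|[set N in powerset B | (N :&: T \in F) && (N :&: S \in G)]|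
    <= #|F| * #|G| * 2 ^ (#|B| - #|T| - #|S|).
Proof.
move=> sT sS dTS.
pose f (N : {set V}) := ((N :&: T, N :&: S), N :\: (T :|: S)).
have -> : #|B| - #|T| - #|S| = #|B :\: (T :|: S)|.
  have := cardsID (T :|: S) B; rewrite (setIidPr _) ?subUset ?sT //.
  by rewrite cardsU (disjoint_setI0 dTS) cards0; lia.
rewrite -card_powerset -!cardsX.
have inj : injective f.
  move=> N N' [e1 e2 e3]; apply/setP => x; move/setP: e1 => /(_ x).
  move/setP: e2 => /(_ x); move/setP: e3 => /(_ x); rewrite !inE.
  by case: (x \in T); case: (x \in S); rewrite /= ?andbT.
rewrite -(card_imset _ inj); apply/subset_leq_card/subsetP => y /imsetP[N].
rewrite !inE => /andP[sN /andP[HF HG]] -> /=; rewrite HF HG /=.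
by apply: setSD.
Qed.

(** * Colorable and clique-free graphs *)

Notation graph_on V := {ffun V * V -> bool}.

Definition sgraph (V : finType) (g : graph_on V) :=
  [forall x, ~~ g (x, x)] && [forall x, forall y, g (x, y) == g (y, x)].
(** All graphs of the induction live on one ambient type [V], and [A] is the actual vertex set;
    deleting vertices thus shrinks [A] without changing the type. *)
Definition supp (V : finType) (A : {set V}) (g : graph_on V) :=
  [forall x, forall y, g (x, y) ==> (x \in A) && (y \in A)].
Definition nb (V : finType) (g : graph_on V) x := [set y | g (x, y)].
Definition clique (V : finType) (g : graph_on V) (K : {set V}) :=
  [forall x in K, forall y in K, (x != y) ==> g (x, y)].
Definition kfree r (V : finType) (g : graph_on V) :=
  [forall K : {set V}, (#|K| == r.+1) ==> ~~ clique g K].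
Definition coloring r (V : finType) (g : graph_on V) (f : {ffun V -> 'I_r}) :=
  [forall x, forall y, g (x, y) ==> (f x != f y)].
Definition free_graphs r (V : finType) (A : {set V}) :=
  [set g : graph_on V | [&& sgraph g, supp A g & kfree r g]].
Definition col_graphs r (V : finType) (A : {set V}) :=
  [set g : graph_on V | [&& sgraph g, supp A g & [exists f, @coloring r V g f]]].
Definition del_vertices (V : finType) (g : graph_on V) (D : {set V}) : graph_on V :=
  [ffun p => [&& g p, p.1 \notin D & p.2 \notin D]].

Lemma in_nb (V : finType) (g : graph_on V) x y : (y \in nb g x) = g (x, y).
Proof. by rewrite inE. Qed.

Lemma sgraphP (V : finType) (g : graph_on V) :
  reflect ((forall x, g (x, x) = false) /\ forall x y, g (x, y) = g (y, x)) (sgraph g).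
Proof.
apply: (iffP andP) => [[/forallP H1 /forallP H2]|[H1 H2]]; split.
- by move=> x; apply/negbTE.
- by move=> x y; move: (H2 x) => /forallP/(_ y)/eqP.
- by apply/forallP => x; rewrite H1.
- by apply/forallP => x; apply/forallP => y; rewrite H2.
Qed.

Lemma suppP (V : finType) (A : {set V}) (g : graph_on V) :
  reflect (forall x y, g (x, y) -> x \in A /\ y \in A) (supp A g).
Proof.
apply: (iffP forallP) => [H x y gxy|H x].
  by move: (H x) => /forallP/(_ y); rewrite gxy => /andP.
by apply/forallP => y; apply/implyP => /H[-> ->].
Qed.

Lemma coloringP r (V : finType) (g : graph_on V) (f : {ffun V -> 'I_r}) :
  reflect (forall x y, g (x, y) -> f x != f y) (coloring g f).
Proof.
apply: (iffP forallP) => [H x y gxy|H x].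
  by move: (H x) => /forallP/(_ y); rewrite gxy.
by apply/forallP => y; apply/implyP => /H.
Qed.

Lemma cliqueP (V : finType) (g : graph_on V) (K : {set V}) :
  reflect {in K &, forall x y, x != y -> g (x, y)} (clique g K).
Proof.
apply: (iffP forall_inP) => [H x y xK yK xy|H x xK].
  by move: (H x xK) => /forall_inP/(_ y yK)/implyP; apply.
by apply/forall_inP => y yK; apply/implyP; apply: H.
Qed.

Lemma sgraph_del_vertices (V : finType) (g : graph_on V) D : sgraph g -> sgraph (del_vertices g D).
Proof.
move=> /sgraphP[H1 H2]; apply/sgraphP; split=> [x|x y]; rewrite !ffunE /=.
  by rewrite H1.
by rewrite H2; congr (_ && _); rewrite andbC.
Qed.

Lemma supp_del_vertices (V : finType) (g : graph_on V) A D : supp A g -> supp (A :\: D) (del_vertices g D).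
Proof.
move=> /suppP H; apply/suppP => x y; rewrite ffunE /= => /and3P[/H[xA yA] xD yD].
by rewrite !inE xD yD xA yA.
Qed.

Lemma card_clique_kfree r (V : finType) (g : graph_on V) K : kfree r g -> clique g K -> #|K| <= r.
Proof.
move=> /forallP H cK; rewrite leqNgt; apply/negP => ltK.
have [K' sK cK'] : exists2 K' : {set V}, K' \subset K & #|K'| = r.+1.
  have : 0 < 'C(#|K|, r.+1) by rewrite bin_gt0.
  rewrite -cards_draws card_gt0 => /set0Pn[K']; rewrite inE => /andP[? /eqP].
  by exists K'.
move: (H K'); rewrite cK' eqxx /=; case/negP; apply/cliqueP => x y xK yK.
by move/cliqueP: cK; apply; apply: (subsetP sK).
Qed.

Lemma free_graphs_del r (V : finType) (g : graph_on V) A D :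
  g \in free_graphs r A -> del_vertices g D \in free_graphs r (A :\: D).
Proof.
rewrite !inE => /and3P[sg pg /forallP kg]; rewrite sgraph_del_vertices // supp_del_vertices //=.
apply/forallP => K; apply/implyP => cK; apply/negP => /cliqueP clK.
move: (kg K); rewrite cK /=; case/negP; apply/cliqueP => x y xK yK xy.
by move: (clK x y xK yK xy); rewrite ffunE => /andP[].
Qed.

Lemma clique_imset (V J : finType) (g : graph_on V) (I : {set J}) (w : J -> V) :
  sgraph g -> {in I &, forall i j, i != j -> g (w i, w j)} ->
  clique g (w @: I) /\ #|w @: I| = #|I|.
Proof.
move=> /sgraphP[irr _] H; split.
  apply/cliqueP => _ _ /imsetP[i iI ->] /imsetP[j jI ->] wij; apply: H => //.
  by apply: contraNneq wij => ->.
apply: card_in_imset => i j iI jI wij; apply/eqP/negP => /negP ij.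
by move: (H i j iI jI ij); rewrite wij irr.
Qed.

Lemma clique_setU1 (V : finType) (g : graph_on V) (K : {set V}) x :
  sgraph g -> clique g K -> {in K, forall y, g (x, y)} ->
  clique g (x |: K) /\ #|x |: K| = #|K|.+1.
Proof.
move=> /sgraphP[irr sy] /cliqueP cK H; split.
  apply/cliqueP => y z; rewrite !inE => /orP[/eqP->|yK] /orP[/eqP->|zK] yz.
  - by rewrite eqxx in yz.
  - exact: H.
  - by rewrite sy; apply: H.
  - exact: cK.
rewrite cardsU1; case: (boolP (x \in K)) => // xK.
by move: (H x xK); rewrite irr.
Qed.

(** * Counting graphs by deleting and restoring vertices *)

Lemma card_fibers (T S : finType) (X : {set T}) (Y : {set S}) (f : T -> S) :
  {in X, forall x, f x \in Y} ->
  #|X| = \sum_(y in Y) #|[set x in X | f x == y]|.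
Proof.
move=> H; rewrite -sum1_card (partition_big f (mem Y)) //=.
by apply: eq_bigr => y _; rewrite -sum1_card; apply: eq_bigl => x; rewrite !inE.
Qed.

Definition add_vertex (V : finType) (h : graph_on V) v (N : {set V}) : graph_on V :=
  [ffun p => [|| h p, (p.1 == v) && (p.2 \in N) | (p.2 == v) && (p.1 \in N)]].

(** The smallest color class on [A :\ v] has at most a 1/r share; [v] may take its color and be
    joined to any subset of the other classes. *)
Lemma col_graphs_growth1 r (V : finType) (A : {set V}) v : 0 < r -> v \in A ->
  #|col_graphs r (A :\ v)| * 2 ^ (#|A :\ v| - #|A :\ v| %/ r) <= #|col_graphs r A|.
Proof.
move=> r0 vA; have subA : {subset A :\ v <= A} by apply/subsetP; apply: subsetDl.
have Hdel : {in [set g in col_graphs r A | del_vertices g [set v] \in col_graphs r (A :\ v)],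
    forall g, del_vertices g [set v] \in col_graphs r (A :\ v)} by move=> g; rewrite inE => /andP[].
apply: (@leq_trans #|[set g in col_graphs r A | del_vertices g [set v] \in col_graphs r (A :\ v)]|);
  last first.
  by apply/subset_leq_card/subsetP => g; rewrite inE => /andP[].
rewrite (card_fibers Hdel) -sum_nat_const; apply: leq_sum => h hco.
move: (hco); rewrite inE => /and3P[/sgraphP[irr sy] /suppP sh /existsP[f /coloringP Hf]].
have [i Hi] : exists i, #|[set x in A :\ v | f x == i]| <= #|A :\ v| %/ r.
  apply/existsP; apply: contraT; rewrite negb_exists => /forallP Hn.
  have : \sum_(i < r) (#|A :\ v| %/ r).+1 <= \sum_(i < r) #|[set x in A :\ v | f x == i]|.
    by apply: leq_sum => i _; rewrite ltnNge Hn.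
  rewrite sum_nat_const card_ord.
  have -> : \sum_(i < r) #|[set x in A :\ v | f x == i]| = #|A :\ v|.
    rewrite (@card_fibers _ _ (A :\ v) [set: 'I_r] f); last by move=> x; rewrite inE.
    by apply: eq_big => [i|//]; rewrite inE.
  by move: (ltn_ceil #|A :\ v| r0); rewrite mulnC => /leq_trans H /H; rewrite ltnn.
pose B := [set x in A :\ v | f x != i].
have cB : #|A :\ v| - #|A :\ v| %/ r <= #|B|.
  have -> : B = (A :\ v) :\: [set x in A :\ v | f x == i].
    by apply/setP => x; rewrite !inE; case: (x != v); case: (x \in A); rewrite ?andbF ?andbT.
  rewrite [leqRHS]cardsD (setIidPr _); first by apply: leq_sub2l.
  by apply/subsetP => x; rewrite inE => /andP[].
apply: (@leq_trans (2 ^ #|B|)); first by rewrite leq_exp2l.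
rewrite -card_powerset.
have hv x : h (x, v) = false.
  by apply/negP => /sh[_]; rewrite !inE eqxx.
have hv' x : h (v, x) = false by rewrite sy hv.
have inj : {in powerset B &, injective (add_vertex h v)}.
  move=> N N'; rewrite !powersetE => /subsetP sN /subsetP sN' e.
  have nv x : x \in B -> (x == v) = false by rewrite !inE => /andP[/andP[/negbTE]].
  have K (M : {set V}) : {subset M <= B} -> forall x, (x \in M) = add_vertex h v M (v, x).
    move=> sM x; rewrite ffunE /= hv' eqxx /=; case: (boolP (x \in M)) => //= xM.
    by case: (boolP (v \in M)) => [/sM/nv|]; rewrite ?eqxx ?andbF.
  by apply/setP => x; rewrite (K N) // (K N') // e.
rewrite -(card_in_imset inj); apply/subset_leq_card/subsetP => g /imsetP[N].
rewrite powersetE => /subsetP sN ->.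
have E : del_vertices (add_vertex h v N) [set v] = h.
  apply/ffunP => -[x y]; rewrite !ffunE /= !inE.
  have [->|xv] /= := eqVneq x v; first by rewrite andbF hv'.
  have [->|yv] /= := eqVneq y v; first by rewrite andbF hv.
  by rewrite !orbF andbT.
rewrite inE E eqxx andbT inE E hco andbT inE; apply/and3P; split.
- apply/sgraphP; split=> [x|x y]; rewrite !ffunE /=.
    rewrite irr /= orbb; apply/negP => /andP[/eqP-> /sN].
    by rewrite !inE eqxx.
  by rewrite sy; congr (_ || _); rewrite orbC.
- apply/suppP => x y; rewrite ffunE /= => /or3P[/sh[/subA-> /subA->] //| |].
    by case/andP=> /eqP-> /sN; rewrite vA !inE => /andP[/andP[_ ->]].
  by case/andP=> /eqP-> /sN; rewrite vA !inE => /andP[/andP[_ ->]].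
- apply/existsP; exists [ffun x => if x == v then i else f x].
  apply/coloringP => x y; rewrite !ffunE /= => /or3P[hxy| |].
  + have [xv|xv] := eqVneq x v; first by rewrite xv hv' in hxy.
    have [yv|yv] := eqVneq y v; first by rewrite yv hv in hxy.
    exact: Hf.
  + case/andP=> -> /sN; rewrite !inE => /andP[/andP[/negbTE-> _]].
    by rewrite eq_sym.
  + by case/andP=> -> /sN; rewrite !inE => /andP[/andP[/negbTE-> _]].
Qed.

Lemma leq_subdiv r a b : a <= b -> a - a %/ r <= b - b %/ r.
Proof.
case: r => [|r]; first by rewrite !divn0 !subn0.
elim: b => [|b IH]; first by rewrite leqn0 => /eqP->.
rewrite leq_eqVlt => /orP[/eqP-> //|]; rewrite ltnS => /IH /leq_trans; apply.
have : b.+1 %/ r.+1 <= (b %/ r.+1).+1.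
  by rewrite -ltnS ltn_divLR // ; have := ltn_ceil b (ltn0Sn r); lia.
have := leq_div b r.+1; lia.
Qed.

(** The vertices of [D] are restored one at a time. By [leq_subdiv] each of them gains at least as
    much as the first one restored. *)
Lemma col_graphs_growth r (V : finType) (A D : {set V}) : 0 < r -> D \subset A ->
  #|col_graphs r (A :\: D)| * 2 ^ (#|D| * (#|A :\: D| - #|A :\: D| %/ r)) <= #|col_graphs r A|.
Proof.
move=> r0; move: {2}#|D| (erefl #|D|) => t; elim: t A D => [|t IH] A D.
  by move=> /eqP; rewrite cards_eq0 => /eqP -> _; rewrite setD0 cards0 mul0n muln1.
move=> cD sD; have /set0Pn[v vD] : D != set0 by rewrite -card_gt0 cD.
have vA := subsetP sD v vD.
have e : A :\: D = (A :\ v) :\: (D :\ v).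
  apply/setP => x; rewrite !inE; have [->|] //= := eqVneq x v.
  by rewrite vD.
have cDv : #|D :\ v| = t by move: cD; rewrite (cardsD1 v) vD => -[].
have sDv : D :\ v \subset A :\ v by apply: setSD.
have := IH _ _ cDv sDv; rewrite -e cDv => IH1.
apply: leq_trans (col_graphs_growth1 r0 vA); rewrite cD mulSn expnD mulnCA mulnC.
apply: leq_mul => //; rewrite leq_exp2l //.
by apply: leq_subdiv; rewrite e; apply: subset_leq_card; apply: subsetDl.
Qed.

Lemma card_free_graphs_fibers r (V : finType) (A D : {set V}) (X : {set graph_on V}) M :
  X \subset free_graphs r A ->
  (forall h, h \in free_graphs r (A :\: D) -> #|[set g in X | del_vertices g D == h]| <= M) ->
  #|X| <= #|free_graphs r (A :\: D)| * M.
Proof.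
move=> /subsetP sX H; rewrite (@card_fibers _ _ X (free_graphs r (A :\: D)) (fun g => del_vertices g D)).
  by rewrite -sum_nat_const; apply: leq_sum.
by move=> g /sX; apply: free_graphs_del.
Qed.

(** The factors are the choices of the edges inside [D], of the set of vertices whose trace on [D]
    lies in [BB], and of the traces themselves: cheap for at least [q] vertices, at most [a] choices
    for the others. *)
Lemma card_extensions r (V : finType) (A D : {set V}) (X : {set graph_on V})
    (AA BB : {set {set V}}) q a b :
  D \subset A -> #|AA| <= a -> #|BB| <= b -> b <= a ->
  X \subset free_graphs r A ->
  (forall g, g \in X -> {in A :\: D, forall x, nb g x :&: D \in AA}) ->
  (forall g, g \in X -> q <= #|[set x in A :\: D | nb g x :&: D \in BB]|) ->
  #|X| <= #|free_graphs r (A :\: D)| *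
     (2 ^ (#|D| * #|D|) * 2 ^ #|A| * (a ^ (#|A :\: D| - q) * b ^ q)).
Proof.
move=> sD cA cB ba sX HA HB; apply: (card_free_graphs_fibers (D := D)) => // h hfr.
pose Y g := [set x in A :\: D | nb g x :&: D \in BB].
set X' := [set g in X | _].
have HY : {in X', forall g, Y g \in [set Z in powerset (A :\: D) | q <= #|Z|]}.
  move=> g; rewrite inE => /andP[gX _]; rewrite inE powersetE HB // andbT.
  by apply/subsetP => x; rewrite inE => /andP[].
rewrite (card_fibers HY).
apply: (@leq_trans (\sum_(Z in powerset A) (2 ^ (#|D| * #|D|) * (a ^ (#|A :\: D| - q) * b ^ q)))); last first.
  by rewrite sum_nat_const card_powerset mulnCA mulnA.
apply: (@leq_trans (\sum_(Z in [set Z in powerset (A :\: D) | q <= #|Z|])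
   (2 ^ (#|D| * #|D|) * (a ^ (#|A :\: D| - q) * b ^ q)))); last first.
  rewrite 2!sum_nat_const leq_mul2r; apply/orP; right; apply: subset_leq_card.
  apply/subsetP => Z; rewrite inE !powersetE => /andP[sZ _].
  by apply: subset_trans sZ (subsetDl _ _).
apply: leq_sum => Z; rewrite inE powersetE => /andP[sZ qZ].
(* Inside a fibre the graph is determined by the traces on [D]. The value [set0] outside [A] makes
   the function range over a product whose factors there are singletons. *)
pose F (g : graph_on V) := [ffun x => if x \in A then nb g x :&: D else set0].
pose Fam x : {set {set V}} := if x \in D then powerset D else if x \in Z then BB
   else if x \in A then AA else [set set0].
have inj : {in [set g in X' | Y g == Z] &, injective F}.
  move=> g g'; rewrite !inE => /andP[/andP[gX /eqP dg] _] /andP[/andP[gX' /eqP dg'] _] e.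
  have := subsetP sX _ gX; rewrite inE => /and3P[/sgraphP[irr sy] /suppP sg _].
  have := subsetP sX _ gX'; rewrite inE => /and3P[/sgraphP[irr' sy'] /suppP sg' _].
  have K x y : y \in D -> g (x, y) = g' (x, y).
    move=> yD; case: (boolP (x \in A)) => xA.
      by move/ffunP/(_ x): e; rewrite !ffunE xA => /setP/(_ y); rewrite !inE yD !andbT.
    transitivity false; first by apply/negP => /sg[]; rewrite (negbTE xA).
    by apply/esym/negP => /sg'[]; rewrite (negbTE xA).
  apply/ffunP => -[x y]; case: (boolP (y \in D)) => yD; first exact: K.
  case: (boolP (x \in D)) => xD; first by rewrite sy sy' K.
  have := dg; rewrite -dg' => /ffunP/(_ (x, y)).
  by rewrite !ffunE /= xD yD !andbT.
rewrite -(card_in_imset inj).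
apply: (@leq_trans #|family Fam|).
  apply/subset_leq_card/subsetP => f /imsetP[g]; rewrite !inE => /andP[/andP[gX _] /eqP gY] ->.
  apply/familyP => x; rewrite ffunE /Fam.
  case: (boolP (x \in D)) => xD; first by rewrite (subsetP sD) // powersetE subsetIr.
  case: (boolP (x \in Z)) => xZ.
    move: (xZ); rewrite -gY inE => /andP[]; rewrite inE xD /= => ->.
    by [].
  case: (boolP (x \in A)) => xA; last by rewrite inE.
  by apply: HA => //; rewrite inE xD.
rewrite card_family foldrE big_image /=.
rewrite (bigID (mem D)) /=; apply: leq_mul.
  apply: (@leq_trans (\prod_(x in D) 2 ^ #|D|)); last by rewrite prod_nat_const expnM.
  by apply: leq_prod => x xD; rewrite /Fam xD card_powerset.
rewrite (bigID (mem Z)) /= mulnC.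
have eZ : #|Z| <= #|A :\: D| by apply: subset_leq_card.
apply: (@leq_trans (a ^ (#|A :\: D| - #|Z|) * b ^ #|Z|)).
  apply: leq_mul.
    have -> : #|A :\: D| - #|Z| = #|(A :\: D) :\: Z|.
      by rewrite [RHS]cardsD (setIidPr sZ).
    rewrite -prod_nat_const (bigID (mem A)) /= -[leqRHS]muln1; apply: leq_mul.
      rewrite (eq_bigl (mem ((A :\: D) :\: Z))); last first.
        by move=> x; rewrite !inE; case: (x \in D); case: (x \in Z); rewrite ?andbF ?andbT.
      apply: leq_prod => x; rewrite !inE => /and3P[xZ xD xA].
      by rewrite /Fam (negbTE xZ) (negbTE xD) xA.
    rewrite big1 // => x /andP[/andP[xD xZ] xA].
    by rewrite /Fam !ifN ?cards1.
  rewrite -prod_nat_const (eq_bigl (mem Z)); last first.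
    move=> x /=; case: (boolP (x \in Z)); rewrite ?andbF ?andbT // => xZ.
    by move: (subsetP sZ x xZ); rewrite inE => /andP[].
  apply: leq_prod => x xZ; move: (subsetP sZ x xZ); rewrite inE => /andP[xD xA].
  by rewrite /Fam (negbTE xD) (_ : x \in Z = true).
(* The exact set [Z] may have more than [q] elements; since [b <= a], this only lowers the
   product. *)
have -> : #|A :\: D| - q = (#|A :\: D| - #|Z|) + (#|Z| - q) by lia.
have -> : b ^ #|Z| = b ^ (#|Z| - q) * b ^ q by rewrite -expnD subnK.
rewrite expnD -mulnA leq_mul2l; apply/orP; right.
rewrite leq_mul2r; apply/orP; right.
by case: (#|Z| - q) => [|z] //; rewrite leq_exp2r.
Qed.

(** The admissible neighbourhoods may depend on the graph without [v], which is constant on each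
    fibre of the deletion. *)
Lemma card_vertex_extensions r (V : finType) (A : {set V}) v (X : {set graph_on V})
    (NN : graph_on V -> {set {set V}}) M :
  v \in A -> X \subset free_graphs r A ->
  (forall g, g \in X -> nb g v \in NN (del_vertices g [set v])) ->
  (forall h, #|NN h| <= M) ->
  #|X| <= #|free_graphs r (A :\ v)| * M.
Proof.
move=> vA sX HN HM; apply: card_free_graphs_fibers => // h _.
have inj : {in [set g in X | del_vertices g [set v] == h] &, injective (fun g => nb g v)}.
  move=> g g'; rewrite !inE => /andP[gX /eqP dg] /andP[gX' /eqP dg'] /setP e.
  have := subsetP sX _ gX; rewrite inE => /and3P[/sgraphP[_ sy] _ _].
  have := subsetP sX _ gX'; rewrite inE => /and3P[/sgraphP[_ sy'] _ _].
  apply/ffunP => -[x y].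
  have [->|xv] := eqVneq x v; first by move: (e y); rewrite !inE.
  have [->|yv] := eqVneq y v; first by rewrite sy sy'; move: (e x); rewrite !inE.
  have := dg; rewrite -dg' => /ffunP/(_ (x, y)).
  by rewrite !ffunE /= !inE xv yv !andbT.
rewrite -(card_in_imset inj); apply: leq_trans (HM h).
apply/subset_leq_card/subsetP => N /imsetP[g]; rewrite inE => /andP[gX /eqP <-] ->.
exact: HN.
Qed.

(* [C] stands for the ratio between K_{r+1}-free and r-colorable graphs, which is
   bounded only at the very end, by induction on the size of [A]; [n0] must
   therefore not depend on it. *)
Definition small r (B : forall V : finType, {set V} -> {set graph_on V}) : Prop :=
  forall L, exists n0, forall (V : finType) (A : {set V}) C, n0 <= #|A| ->
    (forall A' : {set V}, A' \proper A -> #|free_graphs r A'| <= C * #|col_graphs r A'|) ->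
    #|B V A| * L <= C * #|col_graphs r A|.

Lemma small_sub r n1 (B B' : forall V : finType, {set V} -> {set graph_on V}) :
  (forall V (A : {set V}), n1 <= #|A| -> B V A \subset B' V A) -> small r B' -> small r B.
Proof.
move=> sB sm L; have [n0 H] := sm L; exists (maxn n0 n1) => V A C.
rewrite geq_max => /andP[nA n1A] IH.
by apply: leq_trans (H V A C nA IH); rewrite leq_mul2r subset_leq_card ?orbT // sB.
Qed.

Lemma smallU r (B B' : forall V : finType, {set V} -> {set graph_on V}) :
  small r B -> small r B' -> small r (fun V A => B V A :|: B' V A).
Proof.
move=> s1 s2 L; have [n1 H1] := s1 (2 * L); have [n2 H2] := s2 (2 * L).
exists (maxn n1 n2) => V A C; rewrite geq_max => /andP[l1 l2] IH.
have := H1 V A C l1 IH; have := H2 V A C l2 IH.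
have : #|B V A :|: B' V A| <= #|B V A| + #|B' V A| by rewrite cardsU leq_subr.
move: #|_ :|: _| #|B V A| #|B' V A| (C * _) => x y z w; nia.
Qed.

Lemma small_bigU r m (B : 'I_m -> forall V : finType, {set V} -> {set graph_on V}) :
  (forall i, small r (B i)) -> small r (fun V A => \bigcup_(i < m) B i V A).
Proof.
elim: m B => [|m IH] B H.
  by move=> L; exists 0 => V A C _ _; rewrite big_ord0 cards0.
apply: (small_sub (n1 := 0) (B' := fun V A => (\bigcup_(i < m) B (widen_ord (leqnSn m) i) V A)
    :|: B ord_max V A)).
  by move=> V A _; rewrite big_ord_recr.
by apply: smallU => //; apply: IH.
Qed.

(** A saving that is exponential in the number of vertices beats every constant [L]; the constant
    factor [2 ^ b] is absorbed by taking the graph large. *)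
Lemma small_exp r (B : forall V : finType, {set V} -> {set graph_on V}) n0 k b :
  (forall (V : finType) (A : {set V}) C, n0 <= #|A| ->
    (forall A' : {set V}, A' \proper A -> #|free_graphs r A'| <= C * #|col_graphs r A'|) ->
    #|B V A| * 2 ^ (#|A| %/ k.+1) <= 2 ^ b * (C * #|col_graphs r A|)) ->
  small r B.
Proof.
move=> H L; exists (maxn n0 ((b + L) * k.+1)) => V A C.
rewrite geq_max => /andP[l1 l2] IH.
have := H V A C l1 IH.
have : 2 ^ b * L <= 2 ^ (#|A| %/ k.+1).
  apply: (@leq_trans (2 ^ (b + L))).
    by rewrite expnD leq_mul2l ltnW ?orbT // ltn_expl.
  by rewrite leq_exp2l // leq_divRL.
move=> le1 le2; have p : 0 < 2 ^ b by rewrite expn_gt0.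
rewrite -(leq_pmul2l p); apply: leq_trans le2.
by rewrite mulnCA leq_mul2l le1 orbT.
Qed.

(** * Classes of graphs with few members *)

Lemma ex_subset_card (V : finType) (A : {set V}) s : s <= #|A| ->
  exists2 B : {set V}, B \subset A & #|B| = s.
Proof.
rewrite -bin_gt0 -cards_draws card_gt0 => /set0Pn[B]; rewrite inE => /andP[? /eqP].
by exists B.
Qed.

(** A union bound: [p] bits describe the parameter, so a saving of [p + w] bits for each parameter
    leaves [w]. *)
Lemma card_param_bound (T S : finType) (B : {set T}) (P : {set S}) (X : S -> {set T}) p w M :
  (forall g, g \in B -> exists2 x, x \in P & g \in X x) ->
  #|P| <= 2 ^ p -> (forall x, x \in P -> #|X x| * 2 ^ (p + w) <= M) ->
  #|B| * 2 ^ w <= M.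
Proof.
move=> HB HP HX.
have leB : #|B| <= \sum_(x in P) #|X x|.
  apply: (@leq_trans #|\bigcup_(x in P) X x|).
    by apply/subset_leq_card/subsetP => g /HB[x xP gX]; apply/bigcupP; exists x.
  elim/big_ind2 : _ => [|x1 m1 x2 m2 H1 H2|//]; first by rewrite cards0.
  by rewrite cardsU; apply: leq_trans (leq_subr _ _) (leq_add H1 H2).
have p0 : 0 < 2 ^ p by rewrite expn_gt0.
rewrite -(leq_pmul2l p0).
apply: (@leq_trans (\sum_(x in P) (#|X x| * 2 ^ (p + w)))).
  by rewrite -big_distrl /= expnD mulnCA leq_mul2r leB orbT.
apply: (@leq_trans (\sum_(x in P) M)); first exact: leq_sum.
by rewrite sum_nat_const leq_mul2r HP orbT.
Qed.

(** The balance sheet of every class. Restoring [D] in the class costs [e] bits, restoring it in an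
    r-colorable graph brings at least the bits of [col_graphs_growth], and the hypothesis on [A']
    compares what remains; [w] is the profit and [b] collects constants. *)
Lemma removal_bound r (V : finType) (A D : {set V}) (X : {set graph_on V}) C e w b :
  0 < r -> D \subset A -> D != set0 ->
  (forall A' : {set V}, A' \proper A -> #|free_graphs r A'| <= C * #|col_graphs r A'|) ->
  #|X| <= #|free_graphs r (A :\: D)| * 2 ^ e ->
  e + w <= b + #|D| * (#|A :\: D| - #|A :\: D| %/ r) ->
  #|X| * 2 ^ w <= 2 ^ b * (C * #|col_graphs r A|).
Proof.
move=> r0 sD D0 IH HX He.
have pr : A :\: D \proper A.
  by rewrite properEcard subsetDl /= [X in X < _]cardsD (setIidPr sD) ltn_subrL !card_gt0 D0 /=;
     apply: contraNneq D0 => A0; rewrite -subset0 -A0.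
apply: (@leq_trans (C * #|col_graphs r (A :\: D)| * 2 ^ (e + w))).
  by rewrite expnD mulnA leq_mul2r (leq_trans HX) ?orbT // leq_mul2r IH ?orbT.
apply: (@leq_trans (C * #|col_graphs r (A :\: D)| * 2 ^ (b + #|D| * (#|A :\: D| - #|A :\: D| %/ r)))).
  by rewrite leq_mul2l leq_exp2l ?He ?orbT.
rewrite expnD mulnCA leq_mul2l -mulnA leq_mul2l col_graphs_growth ?orbT //.
Qed.

(** * Complete multipartite subgraphs with parts of equal size *)

(** The copy need not be induced: edges inside a part are left free. Disjointness of the parts comes
    from irreflexivity of the graph. *)
Definition blowup (V : finType) (A : {set V}) (g : graph_on V) j s (W : {ffun 'I_j -> {set V}}) :=
  [&& [forall i, #|W i| == s], [forall i, W i \subset A] &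
   [forall i, forall i', (i != i') ==> [forall x in W i, forall y in W i', g (x, y)]]].

Definition has_blowup (V : finType) (A : {set V}) (g : graph_on V) j s :=
  [exists W : {ffun 'I_j -> {set V}}, blowup A g s W].

Definition blowup_cover (V : finType) j (W : {ffun 'I_j -> {set V}}) := \bigcup_i W i.

Lemma blowupP (V : finType) (A : {set V}) (g : graph_on V) j s (W : {ffun 'I_j -> {set V}}) :
  reflect [/\ forall i, #|W i| = s, forall i, W i \subset A &
     forall i i' x y, i != i' -> x \in W i -> y \in W i' -> g (x, y)] (blowup A g s W).
Proof.
apply: (iffP and3P) => [[/forallP H1 /forallP H2 /forallP H3]|[H1 H2 H3]]; split.
- by move=> i; apply/eqP.
- by [].
- move=> i i' x y ii' xi yi'; move: (H3 i) => /forallP/(_ i'); rewrite ii' /=.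
  by move=> /forall_inP/(_ x xi)/forall_inP/(_ y yi').
- by apply/forallP => i; rewrite H1.
- exact/forallP.
- apply/forallP => i; apply/forallP => i'; apply/implyP => ii'.
  by apply/forall_inP => x xi; apply/forall_inP => y yi; apply: (H3 i i').
Qed.

Lemma sub_blowup_cover (V : finType) j (W : {ffun 'I_j -> {set V}}) i : W i \subset blowup_cover W.
Proof. exact: bigcup_sup. Qed.

Lemma blowup_cover_sub (V : finType) (A : {set V}) (g : graph_on V) j s (W : {ffun 'I_j -> {set V}}) :
  blowup A g s W -> blowup_cover W \subset A.
Proof. by move=> /blowupP[_ H _]; apply/bigcupsP. Qed.

Lemma blowup_disjoint (V : finType) (A : {set V}) (g : graph_on V) j s (W : {ffun 'I_j -> {set V}}) i i' :
  sgraph g -> blowup A g s W -> i != i' -> [disjoint W i & W i'].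
Proof.
move=> /sgraphP[irr _] /blowupP[_ _ H] ii'; rewrite -setI_eq0; apply/set0Pn => -[x].
by rewrite inE => /andP[xi xi']; move: (H i i' x x ii' xi xi'); rewrite irr.
Qed.

Lemma card_blowup_cover (V : finType) (A : {set V}) (g : graph_on V) j s (W : {ffun 'I_j -> {set V}}) :
  sgraph g -> blowup A g s W -> #|blowup_cover W| = j * s.
Proof.
move=> sg bW; rewrite -sum1_card partition_disjoint_bigcup => [|i i']; last exact: blowup_disjoint bW.
rewrite (eq_bigr (fun=> s)) ?sum_nat_const ?card_ord // => i _.
by rewrite sum1_card; case/blowupP: bW.
Qed.

(** A crude bound, linear in [#|A|], affordable only because deleting the whole blow-up can save a
    larger multiple of [#|A|]. *)
Lemma card_params (V : finType) (A : {set V}) j :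
  #|[set W : {ffun 'I_j -> {set V}} | W \in ffun_on (mem (powerset A))]| <= 2 ^ (j * #|A|).
Proof.
rewrite cardsE card_ffun_on card_ord.
by rewrite [#|mem _|]card_powerset -expnM mulnC.
Qed.

Lemma blowup_params (V : finType) (A : {set V}) (g : graph_on V) j s (W : {ffun 'I_j -> {set V}}) :
  blowup A g s W -> W \in [set W : {ffun 'I_j -> {set V}} | W \in ffun_on (mem (powerset A))].
Proof. by case/blowupP=> _ H _; rewrite inE; apply/ffun_onP => i; rewrite powersetE. Qed.

(** The factor [2 ^ j] in place of [j] keeps all bounds powers of two. *)
Lemma card_bigcup_le (T : finType) j (F : 'I_j -> {set T}) M :
  (forall i, #|F i| <= M) -> #|\bigcup_i F i| <= 2 ^ j * M.
Proof.
move=> H; apply: (@leq_trans (\sum_(i < j) #|F i|)).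
  elim/big_ind2 : _ => [|x1 m1 x2 m2 H1 H2|//]; first by rewrite cards0.
  by rewrite cardsU; apply: leq_trans (leq_subr _ _) (leq_add H1 H2).
apply: (@leq_trans (\sum_(i < j) M)); first exact: leq_sum.
by rewrite sum_nat_const card_ord leq_mul2r ltnW ?orbT // ltn_expl.
Qed.

Lemma ltn_complement a b c m : a < m - c -> a + b = m -> c < b.
Proof. lia. Qed.

(** With j+1 < r parts of size s, an r-colorable graph offers about js + s/r bits per vertex. The
    class spends js + s/(2r) plus terms in [j]; the remaining s/(2r), at least 2r+3 by the
    hypothesis on [s], pays for these terms, for the parameters and for the profit. *)
Lemma unextendable_exponents r j s c n t :
  0 < r -> j.+1 < r -> 2 * r * (2 * r + 3) <= s -> t = j.+1 * s ->
  t * t + (n + t) + (t * c + (j.+1 + (s %/ (2 * r)).+1 + j * s) * n)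
     + (j.+1 * (n + t) + (n + t))
   <= t * t + t * c + (j.+1 + 2) * t + 2 * (s %/ (2 * r)) * r + t * (n - n %/ r).
Proof.
move=> r0 jr hs tE; have q0 : 0 < 2 * r by lia.
have e2 : 2 * r + 3 <= s %/ (2 * r) by rewrite leq_divRL // mulnC.
have := leq_divM s (2 * r); move: e2; move: (s %/ (2 * r)) => e e2 e1.
have := leq_divM n r; have := ltn_ceil n r0.
move: (n %/ r) => m; rewrite mulSn => d2 d1.
have k1 : j.+2 * m <= n.
  by apply: leq_trans d1; rewrite mulnC leq_mul2l jr orbT.
have k2 : s * (j.+1 * m) <= s * (n - m) by rewrite leq_mul2l; apply/orP; right; lia.
have k2' : j * s * (n - m) + j * s * m = j * s * n by rewrite -mulnDr subnK //; lia.
have k3 : e * (2 * r) * m <= s * m by rewrite leq_mul2r e1 orbT.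
have k3' : 2 * e * n <= 2 * e * (m * r + r) by rewrite leq_mul2l; apply/orP; right; lia.
have k4 : (2 * j + 5) * n <= e * n by rewrite leq_mul2r; apply/orP; right; lia.
have -> : t * (n - m) = j * s * (n - m) + s * (n - m) by rewrite tE mulSn mulnDl addnC.
move: k2 k2' k3 k3' k4; move: (n - m) => z.
clear; lia.
Qed.

(* The members of a K_j(s) can be joined to all but O(1) other vertices only through
   sets that are small on one of the j parts: about 2^((j-1)s) choices per vertex,
   fewer than the 2^(js(1-1/r)) available for r-colorable graphs when j < r. *)
Definition unextendable_blowup r j s s' (V : finType) (A : {set V}) :=
  [set g in free_graphs r A | has_blowup A g j s && ~~ has_blowup A g j.+1 s'].

(** Pigeonhole on the traces on the blow-up: [s'] rich vertices share one trace, they form the new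
    part, and [s'] vertices of that trace in each old part form the others. *)
Lemma many_rich_blowup (V : finType) (A : {set V}) (g : graph_on V) j s s' (W : {ffun 'I_j -> {set V}}) :
  sgraph g -> blowup A g s W ->
  s' * 2 ^ #|blowup_cover W| < #|[set x in A :\: blowup_cover W | [forall i, s' <= #|nb g x :&: W i|]]| ->
  has_blowup A g j.+1 s'.
Proof.
move=> sg bW; set D := blowup_cover W; set X := [set x in _ | _] => big.
have [irr sy] := sgraphP _ sg.
have [cW sW eW] := blowupP _ _ _ _ bW.
have [N NI] : exists N, s' <= #|[set x in X | nb g x :&: D == N]|.
  apply/existsP; apply: contraT; rewrite negb_exists => /forallP Hn.
  move: big; rewrite (@card_fibers _ _ X (powerset D) (fun x => nb g x :&: D)); last first.
    by move=> x _; rewrite powersetE subsetIr.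
  rewrite ltnNge mulnC -card_powerset -sum_nat_const => /negP; case.
  by apply: leq_sum => N _; apply: ltnW; rewrite ltnNge.
have [Y sY cY] := ex_subset_card NI.
have YP x : x \in Y -> x \in X /\ nb g x :&: D = N.
  by move/(subsetP sY); rewrite inE => /andP[-> /eqP].
(* For [s'] equal to 0 the set [Y] is empty and no element of it can witness that [N] meets the
   parts. *)
have [s0|s0] := posnP s'.
  apply/existsP; exists [ffun=> set0]; apply/blowupP; split=> [i|i|i i' x y _].
  - by rewrite ffunE cards0 s0.
  - by rewrite ffunE sub0set.
  - by rewrite ffunE inE.
have /set0Pn[y yY] : Y != set0 by rewrite -card_gt0 cY.
have [yX yN] := YP y yY.
have /fin_all_exists2[U sU cU] : forall i, exists2 U : {set V}, U \subset N :&: W i & #|U| = s'.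
  move=> i; apply: ex_subset_card; move: yX; rewrite inE => /andP[_ /forallP/(_ i)].
  by rewrite -yN -setIA (setIidPr (sub_blowup_cover W i)).
have gYU i x z : x \in Y -> z \in U i -> g (x, z).
  move=> xY zU; move: (subsetP (sU i) z zU); rewrite inE => /andP[zN _].
  by move: zN; case: (YP x xY) => _ <-; rewrite !inE => /andP[].
apply/existsP; exists [ffun i => if unlift ord_max i is Some i0 then U i0 else Y].
apply/blowupP; split=> [i|i|i i' x z].
- by rewrite ffunE; case: unliftP => [i0|] _.
- rewrite ffunE; case: unliftP => [i0|] _.
    by apply: subset_trans (sU i0) _; apply: subset_trans (subsetIr _ _) (sW _).
  apply/subsetP => x /YP[]; rewrite !inE => /andP[/andP[_ xA] _] _; exact: xA.
- rewrite !ffunE; case: unliftP => [i0|] ->; case: unliftP => [i1|] -> //.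
  + rewrite (inj_eq (@lift_inj _ _)) => i01 /(subsetP (sU _)) + /(subsetP (sU _)).
    by rewrite !inE => /andP[_ xW] /andP[_ zW]; apply: (eW i0 i1).
  + by move=> _ xU zY; rewrite sy; apply: gYU zY xU.
  + by move=> _ xY zU; apply: gYU xY zU.
  + by rewrite eqxx.
Qed.

(** All but [s' * 2 ^ t] vertices have a small trace on some part, by [many_rich_blowup]; the
    exceptions are charged all [t] bits. The bound on [s] depends on [s'], so the sizes of
    successive blow-ups have to be chosen from the last one backwards. *)
Lemma small_unextendable_blowup r s' : 0 < r -> exists s0, forall s j, s0 <= s -> 0 < j -> j < r ->
  small r (@unextendable_blowup r j s s').
Proof.
move=> r0; have q0 : 0 < 2 * r by lia.
have [h0 Hh] := card_small_subsets q0.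
(* The first summand serves the exponents; the second makes a trace of fewer than [s'] vertices a
   small subset of its part. *)
exists (2 * r * (2 * r + 3) + h0 * s') => s [//|j] hs _ jr.
pose t := j.+1 * s; pose C0 := s' * 2 ^ t.
pose e := s %/ (2 * r).
apply: (@small_exp r _ 0 0 (t * t + t * C0 + (j.+1 + 2) * t + 2 * e * r)) => V A C _ IH.
pose X (W : {ffun 'I_j.+1 -> {set V}}) :=
  [set g in free_graphs r A | blowup A g s W && ~~ has_blowup A g j.+2 s'].
apply: (card_param_bound (X := X) _ (@card_params V A j.+1)) => [g|W _].
  rewrite inE => /andP[gf /andP[/existsP[W bW] nb']]; exists W; first exact: blowup_params bW.
  by rewrite inE gf bW nb'.
have [->|/set0Pn[g0]] := eqVneq (X W) set0; first by rewrite cards0.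
rewrite inE => /andP[g0f /andP[bW0 _]].
have sg0 : sgraph g0 by move: g0f; rewrite inE => /and3P[].
pose D := blowup_cover W.
have cD : #|D| = t by rewrite /D (card_blowup_cover sg0 bW0).
have sD : D \subset A := blowup_cover_sub bW0.
have cW : forall i, #|W i| = s by case/blowupP: bW0.
have s_gt : 2 * r * (2 * r + 3) <= s by lia.
have D0 : D != set0 by rewrite -card_gt0 cD /t; nia.
pose n' := #|A :\: D|.
have nn' : #|A| = n' + t.
  by rewrite /n' cardsD (setIidPr sD) cD subnK // -cD subset_leq_card.
pose BB := [set N in powerset D | [exists i, #|N :&: W i| < s']].
pose beta := j.+1 + e.+1 + j * s.
have cBB : #|BB| <= 2 ^ beta.
  apply: (@leq_trans #|\bigcup_(i < j.+1) [set N in powerset D | #|N :&: W i| < s']|).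
    apply/subset_leq_card/subsetP => N; rewrite inE => /andP[ND /existsP[i Hi]].
    by apply/bigcupP; exists i => //; rewrite inE ND.
  rewrite /beta -addnA expnD; apply: card_bigcup_le => i.
  pose F := [set N in powerset (W i) | h0 * #|N| <= s].
  apply: (@leq_trans #|[set N in powerset D | (N :&: W i \in F) && (N :&: set0 \in [set set0])]|).
    apply/subset_leq_card/subsetP => N; rewrite !inE setI0 eqxx andbT => /andP[-> lt] /=.
    rewrite subsetIr /=; apply: (@leq_trans (h0 * s')); last by lia.
    by rewrite leq_mul2l ltnW ?orbT.
  have := @card_subset_split V D (W i) set0 F [set set0] (sub_blowup_cover W i) (sub0set _).
  rewrite disjoint_sym disjoints_subset sub0set => /(_ isT) /leq_trans; apply.
  rewrite cards1 muln1 cards0 subn0 cD cW expnD; apply: leq_mul.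
    by apply: (Hh h0) => //; rewrite cW.
  by rewrite leq_exp2l // /t; lia.
have HX := @card_extensions r V A D (X W) (powerset D) BB (n' - C0) (2 ^ t) (2 ^ beta).
apply: (removal_bound (e := t * t + #|A| + (t * C0 + beta * n')) (C := C) r0 sD D0 IH).
  apply: (leq_trans (HX sD _ cBB _ _ _ _)).
  - by rewrite card_powerset cD.
  - rewrite leq_exp2l // /beta /t mulSn.
    have e1 : e * (2 * r) <= s by apply: leq_divM.
    have e2 : e * 2 <= s by apply: leq_trans e1; rewrite leq_mul2l leq_pmulr ?orbT.
    have e3 : 2 * r * 3 <= s by apply: leq_trans s_gt; rewrite leq_mul2l leq_addl orbT.
    by move: e1 e2 e3 jr; clear; move: e; lia.
  - by apply/subsetP => g; rewrite inE => /andP[].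
  - by move=> g _ x _; rewrite powersetE subsetIr.
  - move=> g; rewrite inE => /andP[gf /andP[bW nb']]; rewrite leqNgt; apply/negP => lt.
    have sg : sgraph g by move: gf; rewrite inE => /and3P[].
    move/negP: nb'; apply; apply: (many_rich_blowup sg bW); rewrite -/D cD -/C0.
    have := cardsID [set x | nb g x :&: D \in BB] (A :\: D).
    have -> : (A :\: D) :&: [set x | nb g x :&: D \in BB] =
       [set x in A :\: D | nb g x :&: D \in BB] by apply/setP => x; rewrite !inE.
    have -> : (A :\: D) :\: [set x | nb g x :&: D \in BB] =
       [set x in A :\: D | [forall i, s' <= #|nb g x :&: W i|]].
      apply/setP => x; rewrite !inE andbC; congr (_ && _).
      rewrite subsetIr /= negb_exists; apply: eq_forallb => i.
      by rewrite -leqNgt -setIA (setIidPr (sub_blowup_cover W i)).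
    exact: ltn_complement lt.
  rewrite leq_mul2l; apply/orP; right; rewrite -!expnM -!expnD leq_exp2l // cD leq_add2l.
  apply: leq_add; rewrite leq_mul2l; apply/orP; right; last exact: leq_subr.
  by rewrite leq_subLR addnC -leq_subLR.
rewrite cD -/n' nn' /beta divn1; exact: unextendable_exponents.
Qed.

(* In a K_{r+1}-free graph every vertex misses some part of the blow-up [W]; the
   vertices of [type_class i] miss part [i] and see much of every other part. *)
Definition type_class (V : finType) (A : {set V}) (g : graph_on V) r s' (W : {ffun 'I_r -> {set V}}) i :=
  [set x in A | [forall j, (j != i) ==> (s' <= #|nb g x :&: W j|)]].

Definition many_untyped r s s' d (V : finType) (A : {set V}) :=
  [set g in free_graphs r A | [exists W : {ffun 'I_r -> {set V}},
     blowup A g s W && (#|A| %/ d <= #|A :\: \bigcup_i type_class A g s' W i|)]].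

Definition dense_type r s s' h (V : finType) (A : {set V}) :=
  [set g in free_graphs r A | [exists W : {ffun 'I_r -> {set V}}, blowup A g s W &&
     [exists i, [exists x in type_class A g s' W i,
        #|A| < h * #|nb g x :&: type_class A g s' W i|]]]].

Lemma type_classP (V : finType) (A : {set V}) (g : graph_on V) r s' (W : {ffun 'I_r -> {set V}}) i x :
  reflect (x \in A /\ forall j, j != i -> s' <= #|nb g x :&: W j|) (x \in type_class A g s' W i).
Proof.
rewrite inE; apply: (iffP andP) => [[xA /forallP H]|[xA H]]; split => //.
  by move=> j ji; move: (H j); rewrite ji.
by apply/forallP => j; apply/implyP => /H.
Qed.

(** A neighbour in every part, together with [x], would give K_{r+1}. *)
Lemma blowup_missing (V : finType) (A : {set V}) (g : graph_on V) r s (W : {ffun 'I_r -> {set V}}) x :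
  sgraph g -> kfree r g -> blowup A g s W -> exists i, nb g x :&: W i = set0.
Proof.
move=> sg kg /blowupP[_ _ eW]; apply: contrapT => /forallNP H.
have /fin_all_exists[w Hw] : forall i, exists y, y \in nb g x :&: W i.
  by move=> i; apply/set0Pn/eqP/H.
have Hw1 i : g (x, w i) by move: (Hw i); rewrite !inE => /andP[].
have Hw2 i : w i \in W i by move: (Hw i); rewrite !inE => /andP[].
have [cK cardK] := @clique_imset V 'I_r g setT w sg (fun i j _ _ ij => eW i j _ _ ij (Hw2 i) (Hw2 j)).
have [] := @clique_setU1 V g _ x sg cK; first by move=> _ /imsetP[i _ ->].
move=> /(card_clique_kfree kg) + e; rewrite e cardK cardsT card_ord ltnn //.
Qed.

(** Two adjacent vertices with a common neighbour in each of the [r.-1] parts other than [i] would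
    give K_{r+1}. Thus each neighbour of [x] avoids what [x] sees in one of these parts. *)
Lemma adjacent_common_missing (V : finType) (A : {set V}) (g : graph_on V) r s
    (W : {ffun 'I_r -> {set V}}) x y i :
  sgraph g -> kfree r g -> blowup A g s W -> g (x, y) ->
  exists2 j, j != i & nb g y :&: (nb g x :&: W j) = set0.
Proof.
move=> sg kg /blowupP[_ _ eW] gxy; apply: contrapT => H.
have H' j : exists z, j != i -> z \in nb g y :&: (nb g x :&: W j).
  have [ji|ji] := boolP (j != i); last by exists x.
  have /set0Pn[z Hz] : nb g y :&: (nb g x :&: W j) != set0.
    by apply/eqP => E; apply: H; exists j.
  by exists z.
have [w Hw] := fin_all_exists H'.
have Hx j : j != i -> g (x, w j) by move=> /Hw; rewrite !inE => /and3P[].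
have Hy j : j != i -> g (y, w j) by move=> /Hw; rewrite !inE => /and3P[].
have HW j : j != i -> w j \in W j by move=> /Hw; rewrite !inE => /and3P[].
have [|cK cardK] := @clique_imset V 'I_r g [set~ i] w sg.
  move=> a b; rewrite !inE => ai bi ab.
  by apply: (eW a b _ _ ab); apply: HW.
have [|cK' cardK'] := @clique_setU1 V g _ y sg cK.
  by move=> _ /imsetP[j + ->]; rewrite !inE => /Hy.
have [|cK'' cardK''] := @clique_setU1 V g _ x sg cK'.
  move=> z; rewrite !inE => /orP[/eqP-> //|/imsetP[j + ->]].
  by rewrite !inE => /Hx.
have := card_clique_kfree kg cK''; rewrite cardK'' cardK' cardK cardsC1 card_ord.
by rewrite (ltn_predK (ltn_ord i)) ltnn.
Qed.

Lemma type_class_disjoint (V : finType) (A : {set V}) (g : graph_on V) r s s'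
    (W : {ffun 'I_r -> {set V}}) i j :
  0 < s' -> sgraph g -> kfree r g -> blowup A g s W -> i != j ->
  [disjoint type_class A g s' W i & type_class A g s' W j].
Proof.
move=> s0 sg kg bW ij; rewrite -setI_eq0; apply/set0Pn => -[x].
rewrite inE => /andP[/type_classP[xA Hi] /type_classP[_ Hj]].
have [l] := blowup_missing x sg kg bW; apply/eqP; rewrite -card_gt0; apply: leq_trans s0 _.
by have [li|/Hi//] := eqVneq l i; apply: Hj; rewrite li.
Qed.

Lemma type_class_missing (V : finType) (A : {set V}) (g : graph_on V) r s s'
    (W : {ffun 'I_r -> {set V}}) i x :
  0 < s' -> sgraph g -> kfree r g -> blowup A g s W -> x \in type_class A g s' W i ->
  nb g x :&: W i = set0.
Proof.
move=> s0 sg kg bW /type_classP[xA Hi]; have [l] := blowup_missing x sg kg bW.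
have [->//|/Hi + e] := eqVneq l i; rewrite e cards0 leqNgt s0 //.
Qed.

Lemma blowup_sub_type_class (V : finType) (A : {set V}) (g : graph_on V) r s s'
    (W : {ffun 'I_r -> {set V}}) i :
  s' <= s -> blowup A g s W -> W i \subset type_class A g s' W i.
Proof.
move=> ss /blowupP[cW sW eW]; apply/subsetP => x xW; apply/type_classP; split.
  exact: (subsetP (sW i)).
move=> j ji; apply: (leq_trans ss); rewrite -(cW j); apply: subset_leq_card.
apply/subsetP => y yW; rewrite !inE yW andbT; apply: (eW i j) => //.
by rewrite eq_sym.
Qed.

(** A vertex missing one part costs t - s bits, exactly the r-colorable rate, plus [r] bits for the
    part. The excess to be paid is 2r+3 bits per vertex: these [r], one for the choice of the cheap
    vertices, r+1 for the parameters and one of profit. About n/d cheap vertices, each saving c >=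
    d(2r+3), pay for it. *)
Lemma blowup_removal_exponents r s d n' t c al be q b0 :
  0 < r -> 0 < d -> t = r * s -> al = r + (t - s) -> al = be + c ->
  d * (2 * r + 3) <= c -> q <= n' -> (n' + t) %/ d <= q + t ->
  b0 = t * t + (2 * r + 3) * (d + d * t) ->
  t * t + (n' + t) + (al * (n' - q) + be * q) + (r.+1 * (n' + t) + (n' + t))
  <= b0 + t * (n' - n' %/ r).
Proof.
move=> r0 d0 tE alE beE hc qn qd ->.
have := leq_divM n' r; move: (n' %/ r) => m dm.
have := ltn_ceil (n' + t) d0; move: qd; move: (_ %/ d) => p pq dp.
have k1 : (t - s) * n' <= t * (n' - m).
  have : s * (m * r) <= s * n' by rewrite leq_mul2l dm orbT.
  by rewrite tE mulnBr mulnBl; lia.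
have k2 : al * (n' - q) + be * q + c * q = al * n'.
  by rewrite -addnA -mulnDl -beE -mulnDr subnK.
have k3 : d * (2 * r + 3) * q <= c * q by rewrite leq_mul2r hc orbT.
have k4 : (2 * r + 3) * (n' + t) <= (2 * r + 3) * (d * (q + t) + d).
  rewrite leq_mul2l; apply/orP; right.
  have : d * p <= d * (q + t) by rewrite leq_mul2l pq orbT.
  by move: dp; rewrite mulSn; lia.
have k5 : al * n' = r * n' + (t - s) * n' by rewrite alE mulnDl.
move: k1 k2 k3 k4 k5; move: (t - s) (n' - m) (n' - q) => x y z.
clear; lia.
Qed.

Lemma card_missing_one (V : finType) (A : {set V}) (g : graph_on V) r s (W : {ffun 'I_r -> {set V}}) :
  sgraph g -> blowup A g s W ->
  #|[set N in powerset (blowup_cover W) | [exists i, N :&: W i == set0]]| <= 2 ^ (r + (r * s - s)).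
Proof.
move=> sg bW.
apply: (@leq_trans #|\bigcup_(i < r) [set N in powerset (blowup_cover W) | N :&: W i == set0]|).
  apply/subset_leq_card/subsetP => N; rewrite inE => /andP[ND /existsP[i Hi]].
  by apply/bigcupP; exists i => //; rewrite inE ND.
rewrite expnD; apply: card_bigcup_le => i.
have := @card_subset_split V (blowup_cover W) (W i) set0 [set set0] [set set0]
  (sub_blowup_cover W i) (sub0set _).
rewrite disjoint_sym disjoints_subset sub0set => /(_ isT).
rewrite !cards1 !mul1n cards0 subn0 (card_blowup_cover sg bW).
case/blowupP: bW => -> _ _ H; apply: leq_trans H; apply/subset_leq_card/subsetP => N.
by rewrite !inE setI0 eqxx andbT.
Qed.

(** Missing one part is the normal rate; the family [F j] encodes the extra constraint on a second
    part that makes a trace cheap. An empty [F j] excludes the index [j]. *)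
Lemma card_missing_two (V : finType) (A : {set V}) (g : graph_on V) r s (W : {ffun 'I_r -> {set V}})
   (U : {ffun 'I_r -> {set V}}) (F : 'I_r -> {set {set V}}) c :
  sgraph g -> blowup A g s W -> (forall j, U j \subset W j) ->
  (forall j, F j != set0 -> #|F j| * 2 ^ (r * s - s - #|U j|) <= 2 ^ c) ->
  #|[set N in powerset (blowup_cover W) |
     [exists i, exists j, [&& i != j, N :&: W i == set0 & N :&: U j \in F j]]]|
   <= 2 ^ (r + (r + c)).
Proof.
move=> sg bW sU HF.
apply: (@leq_trans #|\bigcup_(i < r) \bigcup_(j < r) [set N in powerset (blowup_cover W) |
   [&& i != j, N :&: W i == set0 & N :&: U j \in F j]]|).
  apply/subset_leq_card/subsetP => N; rewrite inE => /andP[ND /existsP[i /existsP[j Hi]]].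
  by apply/bigcupP; exists i => //; apply/bigcupP; exists j => //; rewrite inE ND.
rewrite expnD; apply: card_bigcup_le => i; rewrite expnD; apply: card_bigcup_le => j.
have [->|ij] /= := eqVneq i j.
  by rewrite (_ : [set _ in _ | _] = set0) ?cards0 //; apply/setP => N; rewrite !inE andbF.
have [F0|F0] := eqVneq (F j) set0.
  by rewrite (_ : [set _ in _ | _] = set0) ?cards0 //; apply/setP => N; rewrite !inE F0 inE !andbF.
apply: leq_trans (HF j F0).
have := @card_subset_split V (blowup_cover W) (W i) (U j) [set set0] (F j) (sub_blowup_cover W i)
  (subset_trans (sU j) (sub_blowup_cover W j)).
rewrite cards1 mul1n (card_blowup_cover sg bW).
have -> : [disjoint W i & U j].
  by rewrite disjoint_sym; apply: (disjointWl (sU j)); rewrite disjoint_sym; apply: blowup_disjoint sg bW ij.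
move=> /(_ isT); case/blowupP: bW => -> _ _ H; apply: leq_trans H; apply/subset_leq_card/subsetP => N.
by rewrite !inE.
Qed.

(** A vertex in no type class misses some part [i], by [blowup_missing], and has fewer than [s']
    neighbours in another part [j]. Its trace on part [j] is then a small set, which saves nearly
    s/2 bits. *)
Lemma small_many_untyped r s' d : 1 < r -> 0 < d -> 0 < s' -> exists s0, forall s, s0 <= s ->
  small r (@many_untyped r s s' d).
Proof.
move=> r1 d0 s'0; have r0 : 0 < r by lia.
have [h0 Hh] := @card_small_subsets 2 isT.
(* The first summand makes fewer than [s'] vertices a small subset of a part; the second makes the
   saving s/2 exceed [c] and the lower order terms. *)
exists (h0.+1 * s' + 2 * (d * (2 * r + 3) + r + 3)) => s hs.
pose t := r * s; pose al := r + (t - s).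
pose c := d * (2 * r + 3).
have s's : s' <= s by move: hs; rewrite mulSn; lia.
have ts : s + s <= t by rewrite /t addnn -mul2n leq_mul2r r1 orbT.
apply: (@small_exp r _ 0 0 (t * t + (2 * r + 3) * (d + d * t))) => V A C _ IH.
pose X (W : {ffun 'I_r -> {set V}}) :=
  [set g in free_graphs r A | blowup A g s W && (#|A| %/ d <= #|A :\: \bigcup_i type_class A g s' W i|)].
have cP : #|[set W : {ffun 'I_r -> {set V}} | W \in ffun_on (mem (powerset A))]| <= 2 ^ (r.+1 * #|A|).
  by apply: leq_trans (card_params A r) _; rewrite leq_exp2l // leq_mul2r leqnSn orbT.
apply: (card_param_bound (X := X) _ cP) => [g|W _].
  rewrite inE => /andP[gf /existsP[W /andP[bW H]]]; exists W; first exact: blowup_params bW.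
  by rewrite inE gf bW H.
have [->|/set0Pn[g0]] := eqVneq (X W) set0; first by rewrite cards0.
rewrite inE => /andP[g0f /andP[bW0 HW0]].
have sg0 : sgraph g0 by move: g0f; rewrite inE => /and3P[].
pose D := blowup_cover W.
have cD : #|D| = t by rewrite /D (card_blowup_cover sg0 bW0).
have sD : D \subset A := blowup_cover_sub bW0.
have cW : forall i, #|W i| = s by case/blowupP: bW0.
have D0 : D != set0 by rewrite -card_gt0 cD; move: ts s's s'0; clear; lia.
pose n' := #|A :\: D|.
have nn' : #|A| = n' + t.
  by rewrite /n' cardsD (setIidPr sD) cD subnK // -cD subset_leq_card.
pose F j := [set N in powerset (W j) | h0 * #|N| <= s].
have cF j : #|F j| * 2 ^ (t - s - #|W j|) <= 2 ^ (s %/ 2).+1 * 2 ^ (t - s - s).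
  by rewrite cW leq_mul2r (Hh h0 (leqnn _)) ?orbT // cW.
pose BB := [set N in powerset D | [exists i, exists j, [&& i != j, N :&: W i == set0 & N :&: W j \in F j]]].
have cBB : #|BB| <= 2 ^ (r + (r + ((s %/ 2).+1 + (t - s - s)))).
  apply: (card_missing_two sg0 bW0) => // j _.
  by rewrite expnD; apply: cF.
have alc : r + (r + ((s %/ 2).+1 + (t - s - s))) + c <= al.
  have := leq_divM s 2; rewrite /al /c; move: hs ts; rewrite mulSn.
  move: (h0 * s') (s %/ 2) (d * _); clear; move: t; lia.
pose be := al - c.
have cBB' : #|BB| <= 2 ^ be.
  by apply: leq_trans cBB _; rewrite leq_exp2l // /be; move: alc; clear; move: al c; lia.
have mq : n' - (n' - #|A| %/ d) <= #|A| %/ d by rewrite leq_subLR addnC -leq_subLR.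
have Tc g : g \in X W -> #|A| %/ d <= #|[set x in A :\: D | nb g x :&: D \in BB]|.
  rewrite inE => /andP[gf /andP[bW le]]; apply: leq_trans le _.
  have /and3P[sg _ kg] : [&& sgraph g, supp A g & kfree r g] by move: gf; rewrite inE.
  apply/subset_leq_card/subsetP => x; rewrite in_setD => /andP[xT xA].
  have xNT i : x \notin type_class A g s' W i by apply: contra xT => xi; apply/bigcupP; exists i.
  rewrite inE; apply/andP; split.
    rewrite inE xA andbT; apply/bigcupP => -[i _ xi]; move: (xNT i).
    by rewrite (subsetP (blowup_sub_type_class i s's bW) x xi).
  rewrite inE powersetE subsetIr /=.
  have [i xi] := blowup_missing x sg kg bW.
  apply/existsP; exists i; move: (xNT i); rewrite inE xA negb_forall => /existsP[j].
  rewrite negb_imply => /andP[ji]; rewrite -ltnNge => lt.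
  apply/existsP; exists j; rewrite eq_sym ji -!setIA !(setIidPr (sub_blowup_cover W _)) xi eqxx.
  rewrite !inE subsetIr /=; apply: leq_trans (leq_trans (leq_addr _ _) hs).
  by rewrite mulSn; apply: (@leq_trans (h0 * s')); rewrite ?leq_addl // leq_mul2l ltnW ?orbT.
have HX := @card_extensions r V A D (X W)
   [set N in powerset D | [exists i, N :&: W i == set0]] BB (#|A| %/ d) (2 ^ al) (2 ^ be).
have qn : #|A| %/ d <= n'.
  apply: leq_trans (Tc g0 _) _; first by rewrite inE g0f bW0.
  by apply/subset_leq_card/subsetP => x; rewrite inE => /andP[].
apply: (removal_bound (e := t * t + #|A| + (al * (n' - #|A| %/ d) + be * (#|A| %/ d))) (C := C) r0 sD D0 IH).
  apply: (leq_trans (HX sD _ cBB' _ _ _ _)) => //.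
  - exact: card_missing_one bW0.
  - by rewrite leq_exp2l // leq_subr.
  - by apply/subsetP => g; rewrite inE => /andP[].
  - move=> g; rewrite inE => /andP[gf /andP[bW _]] x _; rewrite inE powersetE subsetIr /=.
    have /and3P[sg _ kg] : [&& sgraph g, supp A g & kfree r g] by move: gf; rewrite inE.
    have [i xi] := blowup_missing x sg kg bW; apply/existsP; exists i.
    by rewrite -setIA (setIidPr (sub_blowup_cover W i)) xi.
  rewrite leq_mul2l; apply/orP; right.
  by rewrite -!expnM -!expnD leq_exp2l // cD.
rewrite cD -/n' divn1; move: (qn); rewrite nn' => qn'.
apply: (@blowup_removal_exponents r s d n' t c) => //.
  by rewrite /be subnK // (leq_trans _ alc) ?leq_addl.
by rewrite leq_addr.
Qed.

(** By [adjacent_common_missing], a neighbour of [x] in the class of [x] misses, besides part [i],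
    all of what [x] sees in some other part: at least [s'] vertices, hence [s'] saved bits. More
    than n/h vertices save in this way. *)
Lemma small_dense_type r s s' h : 1 < r -> 0 < h -> h * (2 * r + 3) + r <= s' -> s' <= s ->
  small r (@dense_type r s s' h).
Proof.
move=> r1 h0 hs' s's; have r0 : 0 < r by lia.
pose t := r * s; pose al := r + (t - s).
pose c := h * (2 * r + 3).
have ts : s + s <= t by rewrite /t addnn -mul2n leq_mul2r r1 orbT.
have s'0 : 0 < s' by move: hs' h0 r0; clear; lia.
apply: (@small_exp r _ 0 0 (t * t + (2 * r + 3) * (h + h * t))) => V A C _ IH.
(* The second parameter is the trace of [x] on the blow-up; once it is fixed, the family of cheap
   traces depends on the parameters alone. *)
pose X (p : {ffun 'I_r -> {set V}} * {set V}) :=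
  [set g in free_graphs r A | blowup A g s p.1 && [exists i, [exists x in type_class A g s' p.1 i,
        (p.2 == nb g x :&: blowup_cover p.1) && (#|A| < h * #|nb g x :&: type_class A g s' p.1 i|)]]].
pose P := setX [set W : {ffun 'I_r -> {set V}} | W \in ffun_on (mem (powerset A))] (powerset A).
have cP : #|P| <= 2 ^ (r.+1 * #|A|).
  by rewrite cardsX card_powerset mulSn addnC expnD leq_mul2r card_params orbT.
apply: (card_param_bound (X := X) _ cP) => [g|[W R] _].
  rewrite inE => /andP[gf /existsP[W /andP[bW /existsP[i /exists_inP[x xT H]]]]].
  exists (W, nb g x :&: blowup_cover W).
    rewrite in_setX (blowup_params bW) powersetE /=.
    by apply: subset_trans (subsetIr _ _) (blowup_cover_sub bW).
  rewrite inE gf bW /=; apply/existsP; exists i; apply/exists_inP; exists x => //.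
  by rewrite eqxx H.
have [->|/set0Pn[g0]] := eqVneq (X (W, R)) set0; first by rewrite cards0.
rewrite inE /= => /andP[g0f /andP[bW0 HW0]].
have sg0 : sgraph g0 by move: g0f; rewrite inE => /and3P[].
pose D := blowup_cover W.
have cD : #|D| = t by rewrite /D (card_blowup_cover sg0 bW0).
have sD : D \subset A := blowup_cover_sub bW0.
have cW : forall i, #|W i| = s by case/blowupP: bW0.
have D0 : D != set0 by rewrite -card_gt0 cD; move: ts s's s'0; clear; lia.
pose n' := #|A :\: D|.
have nn' : #|A| = n' + t.
  by rewrite /n' cardsD (setIidPr sD) cD subnK // -cD subset_leq_card.
pose U := [ffun j => R :&: W j].
(* The test on [#|U j|] makes the cardinality bound valid for every value of the parameter. *)
pose F j : {set {set V}} := if s' <= #|U j| then [set set0] else set0.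
pose BB := [set N in powerset D | [exists i, exists j, [&& i != j, N :&: W i == set0 & N :&: U j \in F j]]].
have cBB : #|BB| <= 2 ^ (r + (r + (t - s - s'))).
  apply: (card_missing_two sg0 bW0) => [j|j]; first by rewrite ffunE subsetIr.
  rewrite /F; case: ifP => [le _|]; last by rewrite eqxx.
  by rewrite cards1 mul1n leq_exp2l // leq_sub2l.
have alc : r + (r + (t - s - s')) + c <= al.
  rewrite /al /c; move: hs' ts s's; move: (h * _) => a; clear; move: t; lia.
pose be := al - c.
have cBB' : #|BB| <= 2 ^ be.
  by apply: leq_trans cBB _; rewrite leq_exp2l // /be; move: alc; clear; move: al c; lia.
pose q := #|A| %/ h - t.
have mq : n' - (n' - q) <= q by rewrite leq_subLR addnC -leq_subLR.
have Tc g : g \in X (W, R) -> q <= #|[set x in A :\: D | nb g x :&: D \in BB]|.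
  rewrite inE => /andP[gf /andP[/= bW /existsP[i /exists_inP[x xT /andP[/eqP RE le]]]]].
  have /and3P[sg _ kg] : [&& sgraph g, supp A g & kfree r g] by move: gf; rewrite inE.
  have UE j : U j = nb g x :&: W j.
    by rewrite ffunE RE -setIA (setIidPr (sub_blowup_cover W j)).
  apply: (@leq_trans #|(nb g x :&: type_class A g s' W i) :\: D|).
    apply: (@leq_trans (#|nb g x :&: type_class A g s' W i| - #|D|)).
      by rewrite cD leq_sub2r // -ltnS ltn_divLR // mulnC (leq_trans le) // leq_mul2l leqnSn orbT.
    by rewrite [leqRHS]cardsD leq_sub2l // subset_leq_card // subsetIr.
  apply/subset_leq_card/subsetP => y; rewrite in_setD => /andP[yD].
  rewrite in_setI => /andP[yx yT]; have yA : y \in A by case/type_classP: yT.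
  rewrite in_set; apply/andP; split; first by rewrite in_setD yD.
  rewrite in_set powersetE subsetIr /=; apply/existsP; exists i.
  have gxy : g (x, y) by rewrite -in_nb.
  have [j ji e] := adjacent_common_missing i sg kg bW gxy.
  apply/existsP; exists j; rewrite eq_sym ji /= -setIA (setIidPr (sub_blowup_cover W _)).
  rewrite (type_class_missing s'0 sg kg bW yT) eqxx /= UE -setIA.
  have -> : D :&: (nb g x :&: W j) = nb g x :&: W j.
    by apply/setIidPr; apply: subset_trans (subsetIr _ _) (sub_blowup_cover W _).
  rewrite e /F UE; case/type_classP: xT => _ /(_ j ji) ->.
  by rewrite inE.
have HX := @card_extensions r V A D (X (W, R))
   [set N in powerset D | [exists i, N :&: W i == set0]] BB q (2 ^ al) (2 ^ be).
have qn : q <= n'.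
  apply: leq_trans (Tc g0 _) _; first by rewrite inE g0f bW0.
  by apply/subset_leq_card/subsetP => x; rewrite inE => /andP[].
apply: (removal_bound (e := t * t + #|A| + (al * (n' - q) + be * q)) (C := C) r0 sD D0 IH).
  apply: (leq_trans (HX sD _ cBB' _ _ _ _)) => //.
  - exact: card_missing_one bW0.
  - by rewrite leq_exp2l // leq_subr.
  - by apply/subsetP => g; rewrite inE => /andP[].
  - move=> g; rewrite inE => /andP[gf /andP[bW _]] x _; rewrite inE powersetE subsetIr /=.
    have /and3P[sg _ kg] : [&& sgraph g, supp A g & kfree r g] by move: gf; rewrite inE.
    have [i xi] := blowup_missing x sg kg bW; apply/existsP; exists i.
    by rewrite -setIA (setIidPr (sub_blowup_cover W i)) xi.
  rewrite leq_mul2l; apply/orP; right.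
  by rewrite -!expnM -!expnD leq_exp2l // cD.
rewrite cD -/n' divn1 nn'.
apply: (@blowup_removal_exponents r s h n' t c) => //.
  by rewrite /be subnK // (leq_trans _ alc) ?leq_addl.
by rewrite -nn' /q addnC -leq_subLR.
Qed.

(** * Classes discarded by deleting a single vertex *)

(** Membership in a type class depends only on adjacency to the blow-up, so outside [W] the classes
    can be read off the graph without [v]. This is what lets a constraint on the neighbourhood of
    [v] refer to them. *)
Lemma type_class_del (V : finType) (A : {set V}) (g : graph_on V) r s' (W : {ffun 'I_r -> {set V}}) i v :
  v \notin blowup_cover W -> type_class (A :\ v) (del_vertices g [set v]) s' W i = type_class A g s' W i :\ v.
Proof.
move=> vW; apply/setP => x; rewrite !inE.
have [->//|xv] /= := eqVneq x v; congr (_ && _); apply: eq_forallb => j.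
congr (_ ==> (_ <= _)); apply: eq_card => y; rewrite !inE ffunE /= !inE xv /=.
have [yW|] := boolP (y \in W j); last by rewrite !andbF.
suff -> : y != v by rewrite !andbT.
by apply: contraNneq vW => <-; apply: (subsetP (sub_blowup_cover W j)).
Qed.

(** Deleting one vertex saves only a fraction of n bits, so all parameters, the parts of the blow-up
    included, are chosen among sets of proportion 1/h. *)
Definition smallsets (V : finType) (A : {set V}) h k := [set X in powerset A | h * #|X| <= k].

Lemma card_small_params (V : finType) (A : {set V}) j h p :
  #|smallsets A h #|A| | <= 2 ^ p ->
  #|[set W : {ffun 'I_j -> {set V}} | W \in ffun_on (mem (smallsets A h #|A|))]| <= 2 ^ (p * j).
Proof. by move=> H; rewrite cardsE card_ffun_on card_ord expnM; case: j => // j; rewrite leq_exp2r. Qed.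

Lemma blowup_small_params (V : finType) (A : {set V}) (g : graph_on V) j s (W : {ffun 'I_j -> {set V}}) h :
  h * s <= #|A| -> blowup A g s W ->
  W \in [set W : {ffun 'I_j -> {set V}} | W \in ffun_on (mem (smallsets A h #|A|))].
Proof.
move=> hs /blowupP[c H _]; rewrite inE; apply/ffun_onP => i.
by rewrite inE powersetE H c.
Qed.

(** Through singletons: choosing one vertex is no dearer than choosing a small set. *)
Lemma card_le_smallsets (V : finType) (A : {set V}) h :
  h <= #|A| -> #|A| <= #|smallsets A h #|A| |.
Proof.
move=> hA; rewrite -[leqLHS](card_imset (mem A) (@set1_inj V)).
apply/subset_leq_card/subsetP => _ /imsetP[x xA ->].
by rewrite inE powersetE sub1set xA cards1 muln1.
Qed.

Definition large_type r s s' h c (V : finType) (A : {set V}) :=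
  [set g in free_graphs r A | [exists W : {ffun 'I_r -> {set V}}, [&& blowup A g s W,
     [forall i, [forall x in type_class A g s' W i, h * #|nb g x :&: type_class A g s' W i| <= #|A|]] &
     [exists i, #|A| %/ r + #|A| %/ c <= #|type_class A g s' W i|]]]].

(** A class exceeding n/r by n/c yields n/c spare bits. The r+3 terms n/q, for the sparse trace, the
    vertex, the [r] parts and the profit, use up exactly that with q = c(r+3). *)
Lemma large_type_exponents r c n q p : 1 < r -> 1 < c -> 0 < n -> q = c * (r + 3) -> p = (n %/ q).+1 ->
  p + (n.-1 - (n %/ r + n %/ c - 1)) + ((p + (p * r + r)) + n %/ q)
  <= 2 * r + 5 + (n.-1 - n.-1 %/ r).
Proof.
move=> r1 c1 n0 -> ->; rewrite divnMA.
have e1 := leq_divM (n %/ c) (r + 3); move: e1; move: (_ %/ (r + 3)) => a e1.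
have e2 : n %/ c * 2 <= n by apply: leq_trans (leq_divM n c); rewrite leq_mul2l c1 orbT.
have e3 : n %/ r * 2 <= n by apply: leq_trans (leq_divM n r); rewrite leq_mul2l r1 orbT.
have e4 : n.-1 %/ r <= n %/ r by apply: leq_div2r; rewrite leq_pred.
move: e1 e2 e3 e4; move: (n %/ c) (n %/ r) (n.-1 %/ r) => x y z.
rewrite mulnDr mulSn; move: (a * r) => w; move: n0; clear; lia.
Qed.

(** A vertex [v] of an oversized class spends almost no bits on its own class, which removes more
    than n/r of the n bits of its neighbourhood. *)
Lemma small_large_type r c : 1 < r -> 1 < c -> exists h0, forall h s s', h0 <= h ->
  small r (@large_type r s s' h c).
Proof.
move=> r1 c1; have r0 : 0 < r by lia.
pose q := c * (r + 3); have q0 : 0 < q by rewrite muln_gt0; lia.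
have [h0 Hh] := card_small_subsets q0.
exists h0 => h s s' hh.
(* The threshold makes the parts and the singletons small sets and forces the oversized class to
   contain a vertex outside the blow-up. *)
apply: (@small_exp r _ (h0 * s + h0 + r * s * r + r + 1) q.-1 (2 * r + 5)) => V A C nA IH.
rewrite (prednK q0); set n := #|A|; pose p := (n %/ q).+1.
have cS := Hh h0 (leqnn _) V A n (leqnn _); rewrite -/(smallsets A h0 n) -/p in cS.
pose X (x : V * ({ffun 'I_r -> {set V}} * 'I_r)) := let: (v, (W, i)) := x in
  [set g in free_graphs r A | [&& v \notin blowup_cover W, v \in type_class A g s' W i,
     h * #|nb g v :&: type_class A g s' W i| <= n & n %/ r + n %/ c <= #|type_class A g s' W i|]].
pose P : {set V * ({ffun 'I_r -> {set V}} * 'I_r)} :=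
  setX A (setX [set W : {ffun 'I_r -> {set V}} | W \in ffun_on (mem (smallsets A h0 #|A|))] setT).
have cP : #|P| <= 2 ^ (p + (p * r + r)).
  rewrite !cardsX 2!expnD leq_mul //.
    by apply: leq_trans (card_le_smallsets _) cS; move: nA; rewrite -/n; lia.
  rewrite leq_mul ?card_small_params // cardsT card_ord ltnW // ltn_expl //.
apply: (card_param_bound (X := X) _ cP) => [g|[v [W i]]].
  rewrite inE => /andP[gf /existsP[W /and3P[bW /forallP H /existsP[i Hi]]]].
  have /and3P[sg _ kg] : [&& sgraph g, supp A g & kfree r g] by move: gf; rewrite inE.
  have cT : #|blowup_cover W| < #|type_class A g s' W i|.
    rewrite (card_blowup_cover sg bW); apply: leq_trans Hi; apply: leq_trans (leq_addr _ _).
    by rewrite leq_divRL //; move: nA; rewrite -/n mulSn; lia.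
  have /set0Pn[v] : type_class A g s' W i :\: blowup_cover W != set0.
    by rewrite -card_gt0 cardsD subn_gt0 (leq_ltn_trans _ cT) // subset_leq_card ?subsetIr.
  rewrite in_setD => /andP[vW vT]; exists (v, (W, i)).
    rewrite !in_setX in_setT (blowup_small_params _ bW) ?andbT.
      by case/type_classP: vT.
    by move: nA; rewrite -/n; clear; lia.
  by rewrite inE gf vW vT Hi /=; move: (H i) => /forall_inP/(_ v vT) ->.
rewrite in_setX => /andP[vA _]; rewrite -/p.
pose T g := type_class (A :\ v) g s' W i.
(* The guard makes the bound hold for every graph; the [- 1] accounts for [v], which the deletion
   removes from its class. *)
pose NN g := if n %/ r + n %/ c - 1 <= #|T g| then
   [set N in powerset (A :\ v) | (N :&: T g \in smallsets (T g) h n) && (N :&: set0 \in [set set0])]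
   else set0.
have nn' : n = #|A :\ v|.+1 by rewrite /n (cardsD1 v) vA.
have Tn g : #|T g| <= n.-1.
  rewrite nn' /=; apply/subset_leq_card/subsetP => x /type_classP[]//.
have D0 : [set v] != set0 :> {set V} by apply/set0Pn; exists v; rewrite inE.
have sD : [set v] \subset A by rewrite sub1set.
apply: (removal_bound (e := p + (n.-1 - (n %/ r + n %/ c - 1))) (C := C) r0 sD D0 IH).
  apply: (@card_vertex_extensions r V A v (X (v, (W, i))) NN) => //.
  - by apply/subsetP => g; rewrite inE => /andP[].
  - move=> g; rewrite inE => /andP[gf /and4P[vW vT le1 le2]].
    have /and3P[sg /suppP pg kg] : [&& sgraph g, supp A g & kfree r g] by move: gf; rewrite inE.
    have TE : T (del_vertices g [set v]) = type_class A g s' W i :\ v by apply: type_class_del.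
    rewrite /NN TE; rewrite (cardsD1 v) vT in le2.
    rewrite leq_subLR le2.
    rewrite in_set setI0 set11 andbT powersetE; apply/andP; split.
      apply/subsetP => y; rewrite in_nb => gvy; have [_ yA] := pg _ _ gvy.
      rewrite !inE yA andbT; apply: contraTneq gvy => ->.
      by case/sgraphP: sg => -> _.
    rewrite in_set powersetE subsetIr /=; apply: leq_trans le1.
    by rewrite leq_mul2l subset_leq_card ?orbT // setIS ?subsetDl.
  - move=> g; rewrite /NN; case: ifP => [le|_]; last by rewrite cards0.
    have sT : T g \subset A :\ v by apply/subsetP => x /type_classP[].
    have := @card_subset_split V (A :\ v) (T g) set0 (smallsets (T g) h n) [set set0] sT (sub0set _).
    rewrite disjoint_sym disjoints_subset sub0set => /(_ isT) /leq_trans; apply.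
    rewrite cards1 muln1 cards0 subn0 expnD leq_mul //.
      by apply: Hh => //; rewrite (leq_trans (Tn g)) ?leq_pred.
    by rewrite leq_exp2l // nn' /= leq_sub2l // -nn'.
rewrite cards1 mul1n.
have -> : #|A :\: [set v]| = n.-1 by rewrite nn'.
by apply: (@large_type_exponents r c n q p) => //; rewrite nn'.
Qed.

(* Read in the neighbourhood of [v], a pattern set not involving [v] is determined by
   the rest of the graph, so that prescribing a skewed trace of [v] on it costs a
   linear number of bits. *)
Definition pattern_set (V : finType) (g : graph_on V) (P Q : {set V}) :=
  [set x | (P \subset nb g x) && [disjoint Q & nb g x]].

Definition skewed (V : finType) (N S : {set V}) :=
  (4 * #|N :&: S| < #|S|) || (4 * #|S :\: N| < #|S|).

(** Sparseness of [v] to [T i], of size close to n/r, already brings [v] down to about the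
    r-colorable rate. A skewed trace on a set in another class, with at least n/h' elements, saves a
    further n/(8h'). *)
Definition skewed_vertex r M s s' c h h' (V : finType) (A : {set V}) :=
  [set g in free_graphs r A | [exists W : {ffun 'I_r -> {set V}}, [exists v in A :\: blowup_cover W,
     [exists i, [exists j, [exists P : {set V}, [exists Q : {set V},
       let T := type_class A g s' W in let S := (T j :\ v) :&: pattern_set g P Q in
       [&& blowup A g s W, i != j, #|A| %/ r <= #|T i| + #|A| %/ c,
        [&& P \subset A, Q \subset A, #|P| <= M & #|Q| <= M], v \notin P :|: Q,
        h * #|nb g v :&: T i| <= #|A|, #|A| <= h' * #|S| & skewed (nb g v) S]]]]]]]].

Lemma card_skewed (V : finType) (S : {set V}) :
  #|[set N in powerset S | skewed N S]| <= 2 ^ ((7 * #|S| %/ 8).+2).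
Proof.
rewrite expnS mul2n -addnn.
apply: (@leq_trans (#|[set X in powerset S | 4 * #|X| < #|S|]| +
   #|[set S :\: X | X in [set X in powerset S | 4 * #|X| < #|S|]]|)).
  apply: leq_trans (leq_card_setU _ _); apply/subset_leq_card/subsetP => N.
  rewrite in_set powersetE /skewed => /andP[NS]; rewrite (setIidPl NS) => /orP[lt|lt].
    by rewrite !inE NS lt.
  rewrite in_setU; apply/orP; right; apply/imsetP; exists (S :\: N).
    by rewrite in_set powersetE subsetDl.
  by rewrite setDDr setDv set0U (setIidPr NS).
apply: leq_add; first exact: card_quarter_subsets.
by apply: leq_trans (leq_imset_card _ _) (card_quarter_subsets _).
Qed.

(** Of the saved n/(8h'), one half covers the deficit n/c of the class. The other half is r+5 times
    n/q, for the sparse trace, the vertex, the [r] parts, [P], [Q] and the profit. *)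
Lemma skewed_vertex_exponents r h' c n q p : 1 < r -> 0 < h' -> 16 * h' <= c -> 0 < n ->
  q = 16 * h' * (r + 5) -> p = (n %/ q).+1 ->
  p + 2 + (n.-1 + n %/ c + 1 - (n %/ r + n %/ (8 * h')))
    + ((p + (p * r + (r + (r + (p + p))))) + n %/ q)
  <= 3 * r + 10 + (n.-1 - n.-1 %/ r).
Proof.
move=> r1 h0 hc n0 -> ->; rewrite divnMA.
have e0 : n %/ c <= n %/ (16 * h') by apply: leq_div2l; rewrite ?muln_gt0.
have e1 := leq_divM (n %/ (16 * h')) (r + 5); move: e1; move: (_ %/ (r + 5)) => a e1.
have e2 : n %/ (16 * h') * 2 <= n %/ (8 * h').
  rewrite leq_divRL ?muln_gt0 // -mulnA (_ : 2 * (8 * h') = 16 * h') ?leq_divM //; lia.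
have e3 : n %/ r * 2 <= n by apply: leq_trans (leq_divM n r); rewrite leq_mul2l r1 orbT.
have e4 : n.-1 %/ r <= n %/ r by apply: leq_div2r; rewrite leq_pred.
have e5 : n %/ (8 * h') * 2 <= n.
  by apply: leq_trans (leq_divM n (8 * h')); rewrite leq_mul2l; apply/orP; right; move: h0; clear; lia.
move: e0 e1 e2 e3 e4 e5; move: (n %/ c) (n %/ r) (n.-1 %/ r) (n %/ (16 * h')) (n %/ (8 * h')) => x y z w u.
rewrite mulnDr !mulSn; move: (a * r) => b; move: n0; clear; lia.
Qed.

Lemma pattern_set_del (V : finType) (A : {set V}) (g : graph_on V) P Q v :
  v \notin P :|: Q -> (A :\ v) :&: pattern_set (del_vertices g [set v]) P Q = (A :\ v) :&: pattern_set g P Q.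
Proof.
move=> vPQ; apply/setP => x; rewrite !in_setI; case: (boolP (x \in A :\ v)) => //=.
rewrite in_setD1 => /andP[xv xA].
have vP : v \notin P by apply: contra vPQ => vP; rewrite in_setU vP.
have vQ : v \notin Q by apply: contra vPQ => vQ; rewrite in_setU vQ orbT.
have E y : y != v -> (y \in nb (del_vertices g [set v]) x) = (y \in nb g x).
  by move=> yv; rewrite !in_nb ffunE /= !inE xv yv !andbT.
have nv (B : {set V}) y : v \notin B -> y \in B -> y != v by move=> vB; apply: contraTneq => ->.
rewrite !in_set; congr (_ && _).
  by apply/subsetP/subsetP => H y yP; move: (H y yP); rewrite E // (nv P).
rewrite ![[disjoint Q & _]]disjoint_subset.
by apply/subsetP/subsetP => H y yP; move: (H y yP); rewrite !inE /= -!in_nb E // (nv Q).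
Qed.

(** The order of the quantifiers matters: the sparseness [h] is chosen after the size bound [h'] and
    depends on nothing else, so the lemma can be applied again with an [h'] that depends on the
    first [h]. *)
Lemma small_skewed_vertex r h' : 1 < r -> 0 < h' -> exists h0, forall h M s s' c,
  h0 <= h -> 16 * h' <= c -> 0 < s' -> small r (@skewed_vertex r M s s' c h h').
Proof.
move=> r1 h'0; have r0 : 0 < r by lia.
pose q := 16 * h' * (r + 5); have q0 : 0 < q by rewrite !muln_gt0 h'0; lia.
have [h0 Hh] := card_small_subsets q0.
exists h0 => h M s s' c hh hc s'0.
apply: (@small_exp r _ (h0 * s + h0 + h0 * M + 1) q.-1 (3 * r + 10)) => V A C nA IH.
rewrite (prednK q0); set n := #|A|; have [p pE] : exists p, p = (n %/ q).+1 by exists (n %/ q).+1.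
have cS := Hh h0 (leqnn _) V A n (leqnn _); rewrite -/(smallsets A h0 n) -pE in cS.
pose X (x : V * ({ffun 'I_r -> {set V}} * ('I_r * ('I_r * ({set V} * {set V}))))) :=
  let: (v, (W, (i, (j, (P, Q))))) := x in
  [set g in free_graphs r A | let T := type_class A g s' W in let S := (T j :\ v) :&: pattern_set g P Q in
       [&& v \notin blowup_cover W, [disjoint T i & T j], n %/ r <= #|T i| + n %/ c,
        v \notin P :|: Q,
        h * #|nb g v :&: T i| <= n, n <= h' * #|S| & skewed (nb g v) S]].
pose Sm := smallsets A h0 #|A|.
pose PP : {set V * ({ffun 'I_r -> {set V}} * ('I_r * ('I_r * ({set V} * {set V}))))} :=
  setX A (setX [set W : {ffun 'I_r -> {set V}} | W \in ffun_on (mem Sm)]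
   (setX setT (setX setT (setX Sm Sm)))).
have cr : #|[set: 'I_r]| <= 2 ^ r by rewrite cardsT card_ord ltnW // ltn_expl.
have cP : #|PP| <= 2 ^ (p + (p * r + (r + (r + (p + p))))).
  rewrite !cardsX (expnD 2 p) (expnD 2 (p * r)) !(expnD 2 r) (expnD 2 p); apply: leq_mul.
    by apply: leq_trans (card_le_smallsets _) cS; move: nA; rewrite -/n; clear; lia.
  apply: leq_mul; first exact: (@card_small_params V A r h0 p cS).
  by apply: leq_mul => //; apply: leq_mul => //; apply: leq_mul.
apply: (card_param_bound (X := X) _ cP) => [g|[v [W [i [j [P Q]]]]]].
  rewrite inE => /andP[gf /existsP[W /exists_inP[v]]]; rewrite in_setD => /andP[vW vA].
  move=> /existsP[i /existsP[j /existsP[P /existsP[Q /and5P[bW ij Hc /and4P[PA QA PM QM] H]]]]].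
  have /and3P[sg _ kg] : [&& sgraph g, supp A g & kfree r g] by move: gf; rewrite inE.
  have hM (Z : {set V}) : #|Z| <= M -> h0 * #|Z| <= #|A|.
    move=> ZM; apply: (@leq_trans (h0 * M)); first by rewrite leq_mul2l ZM orbT.
    by move: nA; rewrite -/n; clear; lia.
  exists (v, (W, (i, (j, (P, Q))))).
    rewrite !in_setX !in_setT (blowup_small_params _ bW).
      by rewrite vA /= !in_set PA QA !hM.
    by move: nA; rewrite -/n; clear; lia.
  rewrite in_set gf vW /= (type_class_disjoint s'0 sg kg bW ij) /=.
  by apply/andP; split; [exact: Hc|exact: H].
rewrite in_setX => /andP[vA _].
pose T g := type_class (A :\ v) g s' W.
pose S g := T g j :&: pattern_set g P Q.
(* Again a guard valid for every graph; the successor makes up for the loss of [v] from [T i]. *)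
pose NN g := if [&& [disjoint T g i & S g], n %/ r <= (#|T g i|).+1 + n %/ c & n <= h' * #|S g|] then
   [set N in powerset (A :\ v) | (N :&: T g i \in smallsets (T g i) h n)
       && (N :&: S g \in [set N in powerset (S g) | skewed N (S g)])]
   else set0.
have nn' : n = #|A :\ v|.+1 by rewrite /n (cardsD1 v) vA.
have D0 : [set v] != set0 :> {set V} by apply/set0Pn; exists v; rewrite inE.
have sD : [set v] \subset A by rewrite sub1set.
apply: (removal_bound (e := p + 2 + (n.-1 + n %/ c + 1 - (n %/ r + n %/ (8 * h')))) (C := C) r0 sD D0 IH).
  apply: (@card_vertex_extensions r V A v (X (v, (W, (i, (j, (P, Q)))))) NN) => //.
  - by apply/subsetP => g; rewrite inE => /andP[].
  - move=> g; rewrite in_set => /andP[gf /and5P[vW dT le1 vPQ /and3P[le2 le3 sk]]].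
    have /and3P[sg /suppP pg kg] : [&& sgraph g, supp A g & kfree r g] by move: gf; rewrite inE.
    have TE l : T (del_vertices g [set v]) l = type_class A g s' W l :\ v by apply: type_class_del.
    have SE : S (del_vertices g [set v]) = (type_class A g s' W j :\ v) :&: pattern_set g P Q.
      by rewrite /S TE; apply: pattern_set_del.
    rewrite /NN SE TE.
    have -> : [disjoint type_class A g s' W i :\ v & (type_class A g s' W j :\ v) :&: pattern_set g P Q].
      apply: disjointW dT; first exact: subsetDl.
      by apply: subset_trans (subsetIl _ _) (subsetDl _ _).
    rewrite le3 andbT /=; have -> : n %/ r <= #|type_class A g s' W i :\ v|.+1 + n %/ c.
      apply: leq_trans le1 _; rewrite leq_add2r (cardsD1 v (type_class _ _ _ _ i)) -add1n leq_add2r.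
      exact: leq_b1.
    rewrite in_set powersetE; apply/and3P; split.
    + apply/subsetP => y; rewrite in_nb => gvy; have [_ yA] := pg _ _ gvy.
      rewrite !inE yA andbT; apply: contraTneq gvy => ->.
      by case/sgraphP: sg => -> _.
    + rewrite in_set powersetE subsetIr /=; apply: leq_trans le2.
      by rewrite leq_mul2l subset_leq_card ?orbT // setIS ?subsetDl.
    + rewrite in_set powersetE subsetIr /=; move: sk.
      by rewrite /skewed -setIA setIid setDIr setDv setU0.
  - move=> g; rewrite /NN; case: ifP => [/and3P[dTS le1 le2]|_]; last by rewrite cards0.
    have sT l : T g l \subset A :\ v by apply/subsetP => x /type_classP[].
    have sS : S g \subset A :\ v by apply: subset_trans (subsetIl _ _) (sT j).
    apply: leq_trans (card_subset_split _ _ (sT i) sS dTS) _.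
    have TSn : #|T g i| + #|S g| <= n.-1.
      have := cardsUI (T g i) (S g); rewrite (disjoint_setI0 dTS) cards0 addn0 => <-.
      by rewrite nn' /=; apply: subset_leq_card; rewrite subUset sT sS.
    have S8 : n %/ (8 * h') <= #|S g| %/ 8.
      by rewrite mulnC divnMA leq_div2r // -[leqRHS](mulKn _ h'0) leq_div2r.
    apply: (@leq_trans (2 ^ p * 2 ^ (7 * #|S g| %/ 8).+2 * 2 ^ (#|A :\ v| - #|T g i| - #|S g|))).
      rewrite leq_mul2r; apply/orP; right; apply: leq_mul; last exact: card_skewed.
      rewrite pE; apply: Hh => //; apply: leq_trans (leq_trans (leq_addr _ _) TSn) _; exact: leq_pred.
    rewrite -!expnD leq_exp2l //.
    have := leq_divM (7 * #|S g|) 8; have := leq_divM #|S g| 8.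
    have nE : n.-1 = #|A :\ v| by rewrite nn'.
    move: TSn S8 le1; rewrite nE.
    move: (n %/ r) (n %/ c) (n %/ (8 * h')) #|T g i| #|S g| #|A :\ v| => a1 a2 a3 a4 a5 a6.
    move: (7 * a5 %/ 8) (a5 %/ 8) => b1 b2; clear; move: p; lia.
rewrite cards1 mul1n.
have -> : #|A :\: [set v]| = n.-1 by rewrite nn'.
by apply: (@skewed_vertex_exponents r h' c n q p) => //; rewrite nn'.
Qed.

(** * Graphs outside the discarded classes *)

Definition finite_extension r m (V : finType) (A : {set V}) (g : graph_on V) (f : V -> 'I_r) :=
  forall i (P Q : {set V}), P \subset A -> Q \subset A -> #|P| <= m -> #|Q| <= m ->
    [disjoint P & Q] -> (forall x, x \in P -> f x != i) ->
    exists z, [/\ z \in A, f z = i, z \notin Q, P \subset nb g z & [disjoint Q & nb g z]].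

Definition good r m (V : finType) (A : {set V}) (g : graph_on V) :=
  exists f : {ffun V -> 'I_r}, coloring g f /\ finite_extension m A g f.

Lemma pattern_setP (V : finType) (g : graph_on V) (P Q : {set V}) x :
  reflect ((forall p, p \in P -> g (x, p)) /\ (forall q, q \in Q -> g (x, q) = false))
    (x \in pattern_set g P Q).
Proof.
rewrite in_set; apply: (iffP andP) => [[/subsetP H1 H2]|[H1 H2]]; split.
- by move=> p /H1; rewrite in_nb.
- by move=> q qQ; move: (disjointFr H2 qQ); rewrite in_nb.
- by apply/subsetP => p /H1; rewrite in_nb.
- by rewrite disjoint_subset; apply/subsetP => q qQ; rewrite !inE H2.
Qed.

Lemma pattern_set0 (V : finType) (g : graph_on V) (B : {set V}) : B :&: pattern_set g set0 set0 = B.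
Proof. by apply/setIidPl/subsetP => x _; apply/pattern_setP; split=> y; rewrite inE. Qed.

Lemma pattern_set_posU (V : finType) (g : graph_on V) (B P Q : {set V}) v : sgraph g ->
  B :&: pattern_set g (v |: P) Q = nb g v :&: (B :&: pattern_set g P Q).
Proof.
move=> /sgraphP[_ sy]; apply/setP => x; rewrite !in_setI in_nb.
case: (boolP (x \in B)) => _; rewrite ?andbF //=.
apply/pattern_setP/andP => [[H1 H2]|[gvx /pattern_setP[H1 H2]]].
  by split; [rewrite sy H1 ?setU11|apply/pattern_setP; split=> // p pP; apply: H1; rewrite setU1r].
by split=> // p /setU1P[->|]; [rewrite sy | apply: H1].
Qed.

Lemma pattern_set_negU (V : finType) (g : graph_on V) (B P Q : {set V}) v : sgraph g ->
  B :&: pattern_set g P (v |: Q) = (B :&: pattern_set g P Q) :\: nb g v.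
Proof.
move=> /sgraphP[_ sy]; apply/setP => x; rewrite in_setD !in_setI in_nb.
case: (boolP (x \in B)) => _; rewrite ?andbF //=.
apply/pattern_setP/andP => [[H1 H2]|[gvx /pattern_setP[H1 H2]]].
  by split; [rewrite sy H2 ?setU11|apply/pattern_setP; split=> // p pP; apply: H2; rewrite setU1r].
by split=> // p /setU1P[->|]; [rewrite sy; apply/negbTE | apply: H2].
Qed.

(** * The coloring of a graph outside all discarded classes *)

Section Structure.
Context (r m : nat) (V : finType) (A : {set V}) (g : graph_on V).
Context (s s' d c c4 h1 h2 h1' h2' M : nat) (Wp : {ffun 'I_r -> {set V}}).
Hypotheses (r1 : 1 < r) (gf : g \in free_graphs r A) (bWp : blowup A g s.+1 Wp) (s'0 : 0 < s').
Hypotheses (nB2 : g \notin many_untyped r s s' d A) (nB3 : g \notin dense_type r s s' h2 A)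
  (nB3' : g \notin dense_type r s.+1 s' h2 A) (nB4 : g \notin large_type r s s' h2 c4 A)
  (nB51 : g \notin skewed_vertex r M s s' c h1 h1' A) (nB52 : g \notin skewed_vertex r M s s' c h2 h2' A).
Let n := #|A|.
Let a0 := 4 * r.
Let a1 := a0 * 8 ^ (2 * m + 2).
(** Sizes are measured as fractions of n: 1/a0 for a whole class, a factor 8 lost per prescribed
    adjacency, hence 1/a1 for patterns of up to 2m+2 vertices. The sparseness 1/h1 defines colors,
    and [m] sparse traces must not exhaust a pattern of proportion 1/a1. Cliques inside traces of
    proportion 1/h1 reach sets of proportion 1/(8^r h1), which fixes [h2']. Then [c], [d] and [c4]
    make the errors negligible at that scale. *)
Hypotheses (h1'E : h1' = 2 * a1) (h1E : 2 * a1 * m.+1 < h1)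
  (h2'E : h2' = 2 * (8 ^ r * h1)) (h12 : h1 <= h2)
  (cE : c = 16 * h2' + 4 * r) (dE : d = 2 * c) (c4E : c4 = 2 * c * r)
  (ME : M = m + r + 3) (nE : 16 * d <= n).

Let sg : sgraph g. Proof. by move: gf; rewrite inE => /and3P[]. Qed.
Let kg : kfree r g. Proof. by move: gf; rewrite inE => /and3P[]. Qed.
Let r0 : 0 < r. Proof. exact: ltnW. Qed.
Let pg x y : g (x, y) -> x \in A /\ y \in A.
Proof. by move: gf; rewrite inE => /and3P[_ /suppP H _]; apply: H. Qed.
Let T := type_class A g s' Wp.

Let n0 : 0 < n.
Proof. by move: nE cE dE r0; clear; move: n; lia. Qed.

Lemma T_sub i : T i \subset A.
Proof. by apply/subsetP => x /type_classP[]. Qed.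

Lemma T_disj i j x : x \in T i -> x \in T j -> i = j.
Proof.
move=> xi xj; apply/eqP/negP => /negP ij.
by move: (disjointFr (type_class_disjoint s'0 sg kg bWp ij) xi); rewrite xj.
Qed.

(* The class [skewed_vertex] only controls vertices outside the blow-up, while all
   vertices have to be colored; this is why one spare vertex per part is kept. *)
Lemma ex_avoiding v : exists W : {ffun 'I_r -> {set V}},
  [/\ blowup A g s W, v \notin blowup_cover W & forall i, W i \subset Wp i].
Proof.
have [cW sW eW] := blowupP _ _ _ _ bWp.
have /fin_all_exists2[U sU cU] : forall i, exists2 U : {set V}, U \subset Wp i :\ v & #|U| = s.
  move=> i; apply: ex_subset_card; move: (cardsD1 v (Wp i)); rewrite cW.
  by case: (v \in _); move: #|_| => a; clear; lia.
have sU' i : U i \subset Wp i by apply: subset_trans (sU i) (subsetDl _ _).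
exists [ffun i => U i]; split=> [||i]; last by rewrite ffunE.
  apply/blowupP; split=> [i|i|i j x y ij]; rewrite !ffunE //.
    exact: subset_trans (sU' i) (sW i).
  by move=> /(subsetP (sU' i)) xi /(subsetP (sU' j)); apply: (eW i j).
apply/bigcupP => -[i _]; rewrite ffunE => /(subsetP (sU i)).
by rewrite !inE eqxx.
Qed.

Lemma type_class_mono (W : {ffun 'I_r -> {set V}}) i : (forall i, W i \subset Wp i) ->
  type_class A g s' W i \subset T i.
Proof.
move=> sW; apply/subsetP => x /type_classP[xA H]; apply/type_classP; split=> // j ji.
by apply: leq_trans (H j ji) _; rewrite subset_leq_card // setIS.
Qed.

(** By monotonicity and disjointness, a vertex of [T i] lost for the smaller blow-up lies in no type
    class of it at all, and such vertices are few. *)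
Lemma type_class_loss (W : {ffun 'I_r -> {set V}}) i : blowup A g s W ->
  (forall i, W i \subset Wp i) -> #|T i :\: type_class A g s' W i| <= n %/ d.
Proof.
move=> bW sW; move: nB2; rewrite inE gf /= => /existsPn/(_ W); rewrite bW /= -ltnNge.
move=> /ltnW; apply: leq_trans; apply/subset_leq_card/subsetP => x.
rewrite !in_setD => /andP[xW xT]; rewrite (subsetP (T_sub i)) // andbT.
apply/bigcupP => -[j _ xj]; move: xW; suff -> : i = j by rewrite xj.
by apply: (T_disj xT); apply: (subsetP (type_class_mono j sW)).
Qed.

Lemma T_sparse x i : x \in T i -> h2 * #|nb g x :&: T i| <= n.
Proof.
move=> xT; move: nB3'; rewrite inE gf /= => /existsPn/(_ Wp); rewrite bWp /=.
by move=> /existsPn/(_ i)/exists_inPn/(_ x xT); rewrite -leqNgt.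
Qed.

(** The other r-1 classes cannot exceed n/r by much and few vertices are untyped, so nearly n/r
    vertices are left for this class. *)
Lemma type_class_large (W : {ffun 'I_r -> {set V}}) i : blowup A g s W ->
  n %/ r <= #|type_class A g s' W i| + n %/ c.
Proof.
move=> bW.
have sparse : [forall i, [forall x in type_class A g s' W i,
    h2 * #|nb g x :&: type_class A g s' W i| <= #|A|]].
  move: nB3; rewrite inE gf /= => /existsPn/(_ W); rewrite bW /= => /existsPn H.
  apply/forallP => j; apply/forall_inP => x xT.
  by move: (H j) => /exists_inPn/(_ x xT); rewrite -leqNgt.
have up j : #|type_class A g s' W j| <= n %/ r + n %/ c4.
  move: nB4; rewrite inE gf /= => /existsPn/(_ W); rewrite bW sparse /=.
  by move=> /existsPn/(_ j); rewrite -ltnNge => /ltnW.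
have rest : #|A :\: \bigcup_i type_class A g s' W i| <= n %/ d.
  by move: nB2; rewrite inE gf /= => /existsPn/(_ W); rewrite bW /= -ltnNge => /ltnW.
have tot : n <= #|type_class A g s' W i| + r.-1 * (n %/ r + n %/ c4) + n %/ d.
  rewrite -[leqLHS](cardsID (\bigcup_i type_class A g s' W i) A) leq_add //.
  apply: (@leq_trans (\sum_j #|type_class A g s' W j|)).
    apply: leq_trans (subset_leq_card (subsetIr _ _)) _.
    elim/big_ind2 : _ => [|x1 m1 x2 m2 H1 H2|//]; first by rewrite cards0.
    by rewrite cardsU; apply: leq_trans (leq_subr _ _) (leq_add H1 H2).
  rewrite (bigD1 i) //= leq_add2l.
  apply: (@leq_trans (\sum_(j < r | j != i) (n %/ r + n %/ c4))); first exact: leq_sum.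
  rewrite sum_nat_cond_const (_ : [set j | j != i] = [set~ i]) ?cardsC1 ?card_ord //.
  by apply/setP => j; rewrite !inE.
have e1 := leq_divM n r.
have e2 : r * (n %/ c4) <= n %/ (2 * c) by rewrite c4E divnMA mulnC leq_divM.
have e3 : n %/ (2 * c) * 2 <= n %/ c by rewrite mulnC divnMA mulnC; rewrite divnAC leq_divM.
move: tot e1 e2 e3; rewrite dE.
move: (n %/ r) (n %/ c4) (n %/ (2 * c)) (n %/ c) #|type_class _ _ _ _ _| => x y z w u.
have [k ->] : exists k, r = k.+1 by exists r.-1; rewrite prednK.
by clear; move: n; rewrite /= mulnDr !mulSn mulnS (mulnC x); lia.
Qed.

Lemma T_large j : n <= a0 * #|T j|.
Proof.
have /set0Pn[v _] : A != set0 by rewrite -card_gt0.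
have [W [bW _ sW]] := ex_avoiding v.
have := type_class_large j bW; have := subset_leq_card (type_class_mono j sW).
have := ltn_ceil n r0; rewrite mulSn.
have : 4 * r * (n %/ c) <= n.
  apply: leq_trans (leq_divM n c); rewrite mulnC leq_mul2l; apply/orP; right.
  by rewrite cE leq_addl.
have : 16 * r <= n by move: nE cE dE; clear; lia.
rewrite /a0; move: #|T j| #|type_class _ _ _ _ _| (n %/ c) (n %/ r) => x y z w.
move=> H1 H2 H3 H4 H5.
have : 4 * r * w <= 4 * r * (x + z).
  by rewrite leq_mul2l; apply/orP; right; apply: leq_trans H5 _; rewrite leq_add2r.
by move: H1 H2 H3; clear; move: n; lia.
Qed.

(** Of the factor 8, a factor 2 pays for passing to a blow-up that avoids [v] and for deleting [v],
    and a factor 4 comes from [v] not being skewed. *)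
Lemma T_step h h' a v i j (P Q : {set V}) :
  g \notin skewed_vertex r M s s' c h h' A -> h * #|nb g v :&: T i| <= n -> v \in A -> i != j ->
  P \subset A -> Q \subset A -> #|P| <= M -> #|Q| <= M -> v \notin P :|: Q ->
  2 * a <= h' -> h' <= h2' -> n <= a * #|T j :&: pattern_set g P Q| ->
  n <= 8 * a * #|T j :&: pattern_set g (v |: P) Q| /\ n <= 8 * a * #|T j :&: pattern_set g P (v |: Q)|.
Proof.
move=> nB5 hv vA ij PA QA PM QM vPQ ah' h'h2 na.
have [W [bW vW sW]] := ex_avoiding v.
set S := T j :&: pattern_set g P Q in na *.
pose S' := (type_class A g s' W j :\ v) :&: pattern_set g P Q.
have S'S : S' \subset S.
  by apply: setSI; apply: subset_trans (subsetDl _ _) (type_class_mono j sW).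
have lossS : #|S| <= #|S'| + (n %/ d).+1.
  rewrite -(cardsID S' S) (setIidPr S'S) leq_add2l.
  apply: (@leq_trans #|v |: (T j :\: type_class A g s' W j)|).
    apply/subset_leq_card/subsetP => x; rewrite in_setD /S' /S !in_setI !in_setD1 in_setU1 in_setD.
    by case: (x == v); case: (x \in type_class _ _ _ _ _); case: (x \in T j);
      case: (x \in pattern_set _ _ _).
  rewrite cardsU1; apply: (@leq_trans (1 + n %/ d)); last by rewrite add1n.
  by apply: leq_add; [exact: leq_b1 | exact: type_class_loss].
have half : #|S| <= 2 * #|S'|.
  have d8 : 8 * a <= d by move: ah' h'h2 dE cE; clear; lia.
  have l1 : 4 * (n %/ d) <= #|S|.
    have [a_0|a_pos] := posnP a; first by move: na nE; rewrite a_0 mul0n leqn0 => /eqP->; rewrite div0n.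
    rewrite -(leq_pmul2l a_pos); apply: leq_trans na; apply: leq_trans (leq_divM n d).
    by rewrite mulnA mulnC leq_mul2l; apply/orP; right; move: d8; clear; lia.
  have l2 : 4 <= #|S|.
    rewrite leqNgt; apply/negP => lt.
    have na3 : n <= a * 3 by apply: leq_trans na _; rewrite leq_mul2l -ltnS lt orbT.
    by move: d8 nE n0 na3; clear; move: n; lia.
  by move: lossS l1 l2; clear; lia.
have nsk : ~~ skewed (nb g v) S'.
  move: nB5; rewrite inE gf /= => /existsPn/(_ W)/exists_inPn/(_ v).
  rewrite in_setD vW vA => /(_ isT)/existsPn/(_ i)/existsPn/(_ j)/existsPn/(_ P)/existsPn/(_ Q).
  rewrite bW ij (type_class_large i bW) PA QA PM QM vPQ /= -/S'.
  have -> /= : h * #|nb g v :&: type_class A g s' W i| <= #|A|.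
    apply: leq_trans hv; rewrite leq_mul2l subset_leq_card ?orbT //.
    by apply: setIS; apply: type_class_mono.
  have -> // : #|A| <= h' * #|S'|.
  apply: leq_trans na _; apply: (@leq_trans (a * (2 * #|S'|))).
    by rewrite leq_mul2l half orbT.
  by rewrite mulnA leq_mul2r (mulnC a) ah' orbT.
move: nsk; rewrite /skewed negb_or -!leqNgt => /andP[sk1 sk2].
have le1 (Z : {set V}) (Z' : {set V}) : #|S'| <= 4 * #|Z'| -> Z' \subset Z -> n <= 8 * a * #|Z|.
  move=> H /subset_leq_card sZ; apply: leq_trans na _.
  rewrite mulnAC mulnC leq_mul2r; apply/orP; right.
  by move: H sZ half; clear; lia.
split.
  by apply: (le1 _ _ sk1); rewrite pattern_set_posU // setIS.
by apply: (le1 _ _ sk2); rewrite pattern_set_negU // setSD.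
Qed.

(** Each new vertex is taken inside some [T j], where [T_sparse] holds with no prior knowledge of
    its color; [T_step] at the fine scale then keeps an eighth of every remaining class. *)
Lemma greedy_clique k a (J : {set 'I_r}) (P : {set V}) :
  #|J| = k -> P \subset A -> #|P| + k <= M -> 2 * (8 ^ k * a) <= h2' ->
  (forall j, j \in J -> n <= a * #|T j :&: pattern_set g P set0|) ->
  exists K : {set V}, [/\ clique g K, #|K| = k & forall y p, y \in K -> p \in P -> g (p, y)].
Proof.
elim: k a J P => [|k IH] a J P cJ PA PM ha HJ.
  exists set0; split; [by apply/cliqueP => x y; rewrite inE|by rewrite cards0|by move=> y p; rewrite inE].
have /set0Pn[j jJ] : J != set0 by rewrite -card_gt0 cJ.
have /set0Pn[x] : T j :&: pattern_set g P set0 != set0.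
  by rewrite -card_gt0; case: (#|_|) (HJ j jJ) => //; rewrite muln0 leqNgt n0.
rewrite in_setI => /andP[xT /pattern_setP[xP _]].
have xA := subsetP (T_sub j) x xT.
have xNP : x \notin P by apply/negP => /xP; case/sgraphP: sg => ->.
have [|||||K [cK kK HK]] := IH (8 * a) (J :\ j) (x |: P).
- by move: cJ; rewrite (cardsD1 j) jJ => -[].
- by rewrite subUset sub1set xA PA.
- by rewrite cardsU1 xNP add1n addSnnS.
- by rewrite [8 ^ k * _]mulnA -expnSr.
- move=> l; rewrite in_setD1 => /andP[lj lJ].
  have [] // := @T_step h2 h2' a x j l P set0 nB52 (T_sparse xT) xA _ PA (sub0set _).
  + by rewrite eq_sym.
  + by apply: leq_trans PM; rewrite leq_addr.
  + by rewrite cards0.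
  + by rewrite setU0.
  + apply: leq_trans ha; rewrite leq_mul2l leq_pmull ?orbT // expn_gt0 //.
  + exact: HJ.
have [cK' kK'] := clique_setU1 sg cK (fun y yK => HK y x yK (setU11 _ _)).
exists (x |: K); split=> //; first by rewrite kK' kK.
move=> y p /setU1P[->|yK] pP; first by case/sgraphP: sg => _ ->; apply: xP.
by apply: HK => //; rewrite setU1r.
Qed.

(** The possible colors of [v]. Vertices outside [A] have empty neighbourhood and admit every color,
    so the coloring is total on [V]. *)
Let class v i := h1 * #|nb g v :&: T i| <= n.

Let a1_h1 : 2 * a1 < h1.
Proof. by apply: leq_ltn_trans h1E; rewrite leq_pmulr. Qed.

Let h1_h2' : h1 <= h2'.
Proof. by rewrite h2'E mulnA leq_pmull // muln_gt0 expn_gt0. Qed.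

Let h1'_h2' : h1' <= h2'.
Proof. by rewrite h1'E; apply: leq_trans h1_h2'; apply: ltnW. Qed.

Let h1_n : h1 <= n.
Proof. by apply: leq_trans h1_h2' _; move: nE dE cE; clear; move: n; lia. Qed.

(** Otherwise [v] would see more than n/h1 vertices of each [T i], and [greedy_clique] would build a
    K_r in its neighbourhood. *)
Lemma ex_class v : exists i, class v i.
Proof.
apply: contrapT => /forallNP H.
have H' i : n < h1 * #|nb g v :&: T i| by rewrite ltnNge; apply/negP; apply: H.
have vA : v \in A.
  have : 0 < #|nb g v :&: T (Ordinal r0)|.
    by rewrite lt0n; apply/negP => /eqP e; move: (H' (Ordinal r0)); rewrite e muln0 ltn0.
  by move=> /card_gt0P[x]; rewrite in_setI in_nb => /andP[/pg[]].
have [||||j _|K [cK kK HK]] := @greedy_clique r h1 setT [set v].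
- by rewrite cardsT card_ord.
- by rewrite sub1set.
- by rewrite cards1 ME; clear; lia.
- by rewrite h2'E.
- by rewrite -(setU0 [set v]) pattern_set_posU // pattern_set0; apply: ltnW.
have [cK' kK'] := clique_setU1 sg cK (fun y yK => HK y v yK (set11 v)).
by have := card_clique_kfree kg cK'; rewrite kK' kK ltnn.
Qed.

(** [T_step] at the coarse scale; the bound on [k] is what [h1'], that is 2 a0 8^(2m+2), allows. *)
Lemma class_step k v i j (P Q : {set V}) :
  class v i -> v \in A -> i != j ->
  P \subset A -> Q \subset A -> #|P| <= M -> #|Q| <= M -> v \notin P :|: Q ->
  k < 2 * m + 3 -> n <= a0 * 8 ^ k * #|T j :&: pattern_set g P Q| ->
  n <= a0 * 8 ^ k.+1 * #|T j :&: pattern_set g (v |: P) Q| /\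
  n <= a0 * 8 ^ k.+1 * #|T j :&: pattern_set g P (v |: Q)|.
Proof.
move=> cv vA ij PA QA PM QM vPQ km na.
have -> : a0 * 8 ^ k.+1 = 8 * (a0 * 8 ^ k) by rewrite expnS mulnCA.
apply: (T_step nB51 cv) => //.
rewrite h1'E leq_mul2l /= leq_mul2l leq_exp2l //.
by rewrite -ltnS -addnS km orbT.
Qed.

(** If [u] and [v] were adjacent, two coarse steps would leave a 1/(64 a0) fraction of n in the
    common neighbourhood inside every other [T j], enough for a K_{r-1} and hence for a K_{r+1}. *)
Lemma class_indep u v i : class u i -> class v i -> g (u, v) = false.
Proof.
move=> cu cv; apply/negP => guv; have [uA vA] := pg guv.
have [irr sy] := sgraphP _ sg.
have uv : v != u by apply: contraTneq guv => ->; rewrite irr.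
have [||||j|K [cK kK HK]] := @greedy_clique r.-1 (a0 * 8 ^ 2) [set~ i] (v |: (u |: set0)).
- by rewrite cardsC1 card_ord.
- by rewrite setU0 subUset !sub1set vA uA.
- rewrite setU0; apply: (@leq_trans (2 + r)); last by rewrite ME; clear; lia.
  by rewrite leq_add ?leq_pred // cards2; case: eqP.
- rewrite h2'E leq_mul2l /=; apply: leq_mul.
    by rewrite leq_exp2l // leq_pred.
  apply: leq_trans (ltnW a1_h1); rewrite mul2n -addnn.
  by apply: leq_trans (leq_addr _ _); rewrite leq_mul2l leq_exp2l // leq_addl orbT.
- rewrite in_setC1 eq_sym => ij.
  have [] // := @class_step 1 v i j (u |: set0) set0 cv vA ij.
  + by rewrite setU0 sub1set.
  + exact: sub0set.
  + by rewrite setU0 cards1 ME; clear; lia.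
  + by rewrite cards0.
  + by rewrite !setU0 inE.
  + by clear; lia.
  have [] // := @class_step 0 u i j set0 set0 cu uA ij.
  + exact: sub0set.
  + exact: sub0set.
  + by rewrite cards0.
  + by rewrite cards0.
  + by rewrite !setU0 inE.
  + by clear; lia.
  by rewrite muln1 pattern_set0; apply: T_large.
have [cK1 kK1] := clique_setU1 sg cK (fun y yK => HK y u yK (setU1r _ (setU11 _ _))).
have [|cK2 kK2] := @clique_setU1 _ _ _ v sg cK1.
  by move=> y /setU1P[->|yK]; [rewrite sy | apply: HK => //; apply: setU11].
by have := card_clique_kfree kg cK2; rewrite kK2 kK1 kK prednK // ltnn.
Qed.

(** A vertex of [T i] with another color would look random to [T i], which contradicts [T_sparse].
    Hence a witness found in [T i] has color [i]. *)
Lemma class_T x i j : x \in T i -> class x j -> j = i.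
Proof.
move=> xT cx; apply/eqP/negP => /negP ji.
have xA := subsetP (T_sub i) x xT.
have [] // := @class_step 0 x j i set0 set0 cx xA ji (sub0set _) (sub0set _).
- by rewrite cards0.
- by rewrite cards0.
- by rewrite !setU0 inE.
- by clear; lia.
- by rewrite muln1 pattern_set0; apply: T_large.
rewrite pattern_set_posU // pattern_set0 => le _; have := T_sparse xT.
have : a0 * 8 ^ 1 < h2.
  apply: leq_trans h12; apply: leq_ltn_trans a1_h1.
  rewrite mul2n -addnn; apply: leq_trans (leq_addr _ _).
  by rewrite leq_mul2l leq_exp2l ?addn2 // orbT.
move: le; move: #|_ :&: _| (a0 * 8 ^ 1) => z a na ah hz.
have : h2 * z <= a * z by apply: leq_trans hz na.
rewrite leq_mul2r leqNgt ah orbF => /eqP z0; move: na n0.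
by rewrite z0 muln0 leqn0 => /eqP->.
Qed.

Lemma ext_large (f : V -> 'I_r) i k (P Q : {set V}) :
  (forall v, class v (f v)) -> #|P| + #|Q| = k -> k <= 2 * m ->
  P \subset A -> Q \subset A -> #|P| <= M -> #|Q| <= M -> [disjoint P & Q] ->
  (forall x, x \in P :|: Q -> f x != i) ->
  n <= a0 * 8 ^ k * #|T i :&: pattern_set g P Q|.
Proof.
move=> fP; elim: k P Q => [|k IH] P Q cPQ km PA QA PM QM dPQ fi.
  move/eqP: cPQ; rewrite addn_eq0 !cards_eq0 => /andP[/eqP-> /eqP->].
  by rewrite muln1 pattern_set0; apply: T_large.
have [P0|/set0Pn[v vP]] := eqVneq P set0.
  have /set0Pn[v vQ] : Q != set0 by rewrite -card_gt0; move: cPQ; rewrite P0 cards0 add0n => ->.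
  have vi := fi v (subsetP (subsetUr _ _) v vQ).
  have vA := subsetP QA v vQ.
  have QvQ : Q :\ v \subset Q by apply: subsetDl.
  have [|||||||_ +] := @class_step k v (f v) i P (Q :\ v) (fP v) vA vi.
  - by [].
  - exact: subset_trans QvQ QA.
  - by [].
  - by apply: leq_trans QM; apply: subset_leq_card.
  - by rewrite in_setU P0 in_set0 in_setD1 eqxx.
  - by move: km; clear; lia.
  - apply: IH => //.
    + by move: cPQ; rewrite (cardsD1 v Q) vQ addnCA => -[].
    + exact: ltnW.
    + exact: subset_trans QvQ QA.
    + by apply: leq_trans QM; apply: subset_leq_card.
    + exact: disjointWr dPQ.
    + by move=> x xPQ; apply: fi; apply: (subsetP (setUS _ QvQ)).
  by rewrite setD1K.
have vi := fi v (subsetP (subsetUl _ _) v vP).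
have vA := subsetP PA v vP.
have PvP : P :\ v \subset P by apply: subsetDl.
have [|||||||+ _] := @class_step k v (f v) i (P :\ v) Q (fP v) vA vi.
- exact: subset_trans PvP PA.
- by [].
- by apply: leq_trans PM; apply: subset_leq_card.
- by [].
- by rewrite in_setU in_setD1 eqxx (disjointFr dPQ vP).
- by move: km; clear; lia.
- apply: IH => //.
  + by move: cPQ; rewrite (cardsD1 v P) vP => -[].
  + exact: ltnW.
  + exact: subset_trans PvP PA.
  + by apply: leq_trans PM; apply: subset_leq_card.
  + exact: disjointWl dPQ.
  + by move=> x xPQ; apply: fi; apply: (subsetP (setSU _ PvP)).
by rewrite setD1K.
Qed.

Lemma structure_good : good r m A g.
Proof.
have [f fP] := fin_all_exists ex_class.
exists [ffun v => f v]; split.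
  apply/coloringP => x y gxy; rewrite !ffunE; apply/negP => /eqP e.
  have cy : class y (f x) by rewrite e; apply: fP.
  by move: (class_indep (fP x) cy); rewrite gxy.
move=> i P Q PA QA Pm Qm dPQ fi.
(* Vertices of [Q] of color [i] do not look random to [T i]. They are excluded by sparseness
   instead: at most [m] of them, each seeing at most n/h1 vertices of [T i]. *)
pose Q1 := [set q in Q | f q != i]; pose Q2 := [set q in Q | f q == i].
have Q1Q : Q1 \subset Q by apply/subsetP => q; rewrite inE => /andP[].
have Q1m : #|Q1| <= m by apply: leq_trans Qm; apply: subset_leq_card.
have Q2m : #|Q2| <= m.
  by apply: leq_trans Qm; apply/subset_leq_card/subsetP => q; rewrite inE => /andP[].
have mM : m <= M by rewrite ME; clear; lia.
have large : n <= a0 * 8 ^ (#|P| + #|Q1|) * #|T i :&: pattern_set g P Q1|.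
  apply: (ext_large fP) => //.
  - by move: Pm Q1m; clear; lia.
  - exact: subset_trans Q1Q QA.
  - exact: leq_trans mM.
  - exact: leq_trans mM.
  - exact: disjointWr dPQ.
  - by move=> x /setUP[/fi|]; [rewrite ffunE | rewrite inE => /andP[]].
set R := T i :&: pattern_set g P Q1 in large.
have large' : n <= a1 * #|R|.
  apply: leq_trans large _; rewrite leq_mul2r leq_mul2l leq_exp2l //.
  by apply/orP; right; apply/orP; right; move: Pm Q1m; clear; lia.
pose Bad := (\bigcup_(q in Q2) (nb g q :&: T i)) :|: Q.
have cBad : #|Bad| <= m * (n %/ h1) + m.
  apply: leq_trans (leq_card_setU _ _) _; apply: leq_add => //.
  apply: (@leq_trans (\sum_(q in Q2) #|nb g q :&: T i|)).
    elim/big_ind2 : _ => [|x1 m1 x2 m2 H1 H2|//]; first by rewrite cards0.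
    by rewrite cardsU; apply: leq_trans (leq_subr _ _) (leq_add H1 H2).
  apply: (@leq_trans (\sum_(q in Q2) (n %/ h1))).
    apply: leq_sum => q; rewrite inE => /andP[_ /eqP qi].
    rewrite leq_divRL; last exact: leq_ltn_trans a1_h1.
    by rewrite mulnC -qi; apply: fP.
  by rewrite sum_nat_const leq_mul2r Q2m orbT.
have /set0Pn[z] : R :\: Bad != set0.
  rewrite setD_eq0; apply/negP => /subset_leq_card RB.
  have := leq_trans RB cBad; move: large'.
  have := leq_divM n h1; move: h1E h1_n n0; move: (n %/ h1) => y; move: #|R| => x; move: (a1) (n).
  clear => a N H1 H2 H3 H4 H5 H6.
  have E1 : a * x <= a * (m * y + m) by rewrite leq_mul2l H6 orbT.
  have E2 : 2 * a * m.+1 * y <= h1 * y by rewrite leq_mul2r ltnW ?orbT.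
  by move: E1 E2 H1 H2 H3 H4 H5; rewrite mulnDr !mulnA (mulnC y) mulnS mulnDl; lia.
rewrite in_setD /Bad in_setU negb_or => /andP[/andP[zB zQ]].
rewrite in_setI => /andP[zT /pattern_setP[zP zQ1]]; have [irr sy] := sgraphP _ sg.
exists z; split=> //.
- exact: (subsetP (T_sub i)).
- by rewrite ffunE; apply: class_T zT (fP z).
- by apply/subsetP => p /zP; rewrite in_nb.
- rewrite disjoint_subset; apply/subsetP => q qQ; rewrite !inE /=.
  have [qi|qi] := eqVneq (f q) i; last by rewrite zQ1 // inE qQ qi.
  apply/negP => gzq; move/negP: zB; apply; apply/bigcupP; exists q.
    by rewrite inE qQ qi eqxx.
  by rewrite in_setI in_nb sy gzq.
Qed.
End Structure.

(** * Negligibility of the graphs without the extension property *)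

Definition bad r m (V : finType) (A : {set V}) :=
  [set g in free_graphs r A | `[< ~ good r m A g >]].

Lemma has_blowup1 (V : finType) (A : {set V}) (g : graph_on V) s : s <= #|A| -> has_blowup A g 1 s.
Proof.
move=> /ex_subset_card[B sB cB]; apply/existsP; exists [ffun=> B].
by apply/blowupP; split=> [i|i|i j x y]; rewrite ?ffunE // !ord1 eqxx.
Qed.

(** For [r] equal to 1 the graphs have no edges, and any vertex outside [Q] is a witness; the
    structure theory assumes [1 < r]. *)
Lemma small_bad1 m : small 1 (bad 1 m).
Proof.
move=> L; exists m.+1 => V A C mA _; rewrite (_ : bad 1 m A = set0) ?cards0 //.
apply/eqP; rewrite -subset0; apply/subsetP => g; rewrite inE => /andP[gf /asboolP[]].
have /and3P[sg _ kg] : [&& sgraph g, supp A g & kfree 1 g] by move: gf; rewrite inE.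
have no x y : g (x, y) = false.
  apply/negP => gxy; have [irr sy] := sgraphP _ sg.
  have c1 : clique g [set y] by apply/cliqueP => a b /set1P-> /set1P->; rewrite eqxx.
  have [|cK kK] := clique_setU1 (x := x) sg c1; first by move=> z /set1P->.
  by have := card_clique_kfree kg cK; rewrite kK cards1.
exists [ffun=> ord0]; split; first by apply/coloringP => x y; rewrite no.
move=> i P Q PA QA Pm Qm _ Pi.
have P0 : P = set0.
  apply/setP => x; rewrite inE; apply/negP => /Pi.
  by rewrite ffunE !ord1 eqxx.
have /set0Pn[z] : A :\: Q != set0.
  apply/negP => /eqP e; move: mA; rewrite -(cardsID Q A) e cards0 addn0.
  by rewrite ltnNge (leq_trans _ Qm) // subset_leq_card // subsetIr.
rewrite inE => /andP[zQ zA]; exists z; split=> //; first by rewrite ffunE !ord1.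
  by rewrite P0 sub0set.
by rewrite disjoint_subset; apply/subsetP => q _; rewrite !inE no.
Qed.

(** The constants are fixed in the order h1', h1, h2', c, d, c4, h2, s', s, then the sizes of the
    blow-ups from the last to the first; each depends only on earlier ones. *)
Lemma small_bad r m : 0 < r -> small r (bad r m).
Proof.
rewrite leq_eqVlt => /orP[/eqP <-|r1]; first exact: small_bad1.
have r0 : 0 < r by exact: ltnW.
pose a1 := 4 * r * 8 ^ (2 * m + 2).
have a10 : 0 < a1 by rewrite !muln_gt0 r0 expn_gt0.
pose h1' := 2 * a1.
have [|H1 sB51] := @small_skewed_vertex r h1' r1; first by rewrite muln_gt0.
pose h1 := H1 + (2 * a1 * m.+1).+1; pose h2' := 2 * (8 ^ r * h1).
have h1h2' : h1 <= h2' by rewrite /h2' mulnA leq_pmull // muln_gt0 expn_gt0.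
have [|H2 sB52] := @small_skewed_vertex r h2' r1; first by apply: leq_trans h1h2'; rewrite /h1 addnS.
have [c cE] : exists c, c = 16 * h2' + 4 * r by exists (16 * h2' + 4 * r).
have c1 : 1 < c by rewrite cE; move: r1; clear; lia.
pose d := 2 * c; pose c4 := 2 * c * r.
have [|H4 sB4] := @small_large_type r c4 r1; first by rewrite /c4; move: r1 c1; clear; nia.
pose h2 := H2 + H4 + h1; pose s' := h2 * (2 * r + 3) + r.
have [||S2 sB2] := @small_many_untyped r s' d r1.
- by rewrite /d; move: c1; clear; lia.
- by rewrite /s' addn_gt0 r0 orbT.
pose s := S2 + s'; pose M := m + r + 3.
have s'0 : 0 < s' by rewrite /s' addn_gt0 r0 orbT.
have h20 : 0 < h2 by rewrite /h2 /h1 !addnS.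
have [S0 sB1] := choice (fun t => @small_unextendable_blowup r t r0).
(* The last size is [s.+1], with the spare vertex per part used by [ex_avoiding]; each earlier size
   is what [small_unextendable_blowup] demands for the next. *)
pose sz j := iter (r - j) S0 s.+1.
have szS j : j < r -> sz j = S0 (sz j.+1).
  by move=> jr; rewrite /sz -iterS -subSn // subSS.
pose BB1 (j : 'I_r.-1) := @unextendable_blowup r j.+1 (sz j.+1) (sz j.+2).
apply: (@small_sub r (sz 1 + 16 * d) _ (fun V A => (\bigcup_j BB1 j V A) :|: (many_untyped r s s' d A
   :|: (dense_type r s s' h2 A :|: (dense_type r s.+1 s' h2 A :|: (large_type r s s' h2 c4 A
   :|: (skewed_vertex r M s s' c h1 h1' A :|: skewed_vertex r M s s' c h2 h2' A))))))); last first.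
  apply: smallU.
    apply: small_bigU => j; have jr : j.+1 < r by have := ltn_ord j; rewrite -ltnS prednK.
    by apply: sB1 => //; rewrite (szS _ jr).
  have s's : s' <= s by rewrite /s leq_addl.
  apply: smallU; first by apply: sB2; rewrite leq_addr.
  apply: smallU; first by apply: small_dense_type.
  apply: smallU; first by apply: small_dense_type => //; apply: leqW.
  apply: smallU; first by apply: sB4; rewrite /h2 -addnA addnCA leq_addr.
  have h1c : 16 * h1' <= c.
    rewrite cE; apply: leq_trans (leq_addr _ _); rewrite leq_mul2l /=.
    apply: leq_trans h1h2'; rewrite /h1 /h1'; apply: leq_trans (leq_addl _ _).
    by apply: leqW; rewrite leq_pmulr.
  apply: smallU; first by apply: sB51 => //; rewrite /h1 leq_addr.
  by apply: sB52 => //; [rewrite /h2 -addnA leq_addr | rewrite cE leq_addr].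
move=> V A nA; apply/subsetP => g; rewrite inE => /andP[gf /asboolP ng].
apply: contrapT => /negP; rewrite !in_setU !negb_or => /and5P[nB1 nB2 nB3 nB3' /and3P[nB4 nB51 nB52]].
apply: ng.
(* Outside the first family of classes, a blow-up with few parts always extends by one part, up to
   [r] parts. *)
have chain j : j < r -> has_blowup A g j.+1 (sz j.+1).
  elim: j => [|j IH] jr; first by apply: has_blowup1; apply: leq_trans nA; rewrite leq_addr.
  have jr' : j < r.-1 by rewrite -ltnS prednK.
  apply: contraNT nB1 => nb; apply/bigcupP; exists (Ordinal jr') => //.
  by rewrite inE gf IH ?nb //= ltnW.
have := chain r.-1; rewrite prednK // => /(_ (leqnn _)).
rewrite /sz subnn /= => /existsP[Wp bWp].
apply: (structure_good (h1' := h1') (h2' := h2') (c := c) (M := M)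
  r1 gf bWp s'0 nB2 nB3 nB3' nB4 nB51 nB52) => //.
- exact: leq_addl.
- by rewrite /h2 leq_addl.
- by apply: leq_trans nA; rewrite leq_addl.
Qed.

Lemma col_graphs_gt0 r (V : finType) (A : {set V}) : 0 < r -> 0 < #|col_graphs r A|.
Proof.
move=> r0; apply/card_gt0P; exists [ffun=> false]; rewrite inE; apply/and3P; split.
- by apply/sgraphP; split=> *; rewrite !ffunE.
- by apply/suppP => x y; rewrite ffunE.
- by apply/existsP; exists [ffun=> Ordinal r0]; apply/coloringP => x y; rewrite !ffunE.
Qed.

Lemma card_free_graphs_le r (V : finType) (A : {set V}) : #|free_graphs r A| <= 2 ^ (#|A| * #|A|).
Proof.
rewrite -cardsX -card_powerset.
have inj : injective (fun g : graph_on V => [set p | g p]).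
  by move=> g g' /setP e; apply/ffunP => p; move: (e p); rewrite !inE.
rewrite -(card_imset _ inj); apply/subset_leq_card/subsetP => _ /imsetP[g gf ->].
have /and3P[_ /suppP sg _] : [&& sgraph g, supp A g & kfree r g] by move: gf; rewrite inE.
rewrite powersetE; apply/subsetP => -[x y]; rewrite inE => /sg[xA yA].
by rewrite in_setX xA yA.
Qed.

Lemma free_le_col_bad r m (V : finType) (A : {set V}) :
  #|free_graphs r A| <= #|col_graphs r A| + #|bad r m A|.
Proof.
apply: leq_trans (leq_card_setU _ _); apply/subset_leq_card/subsetP => g gf.
rewrite in_setU; case: (boolP (g \in bad r m A)) => [|nb]; rewrite ?orbT // orbF.
have /and3P[sg pg _] : [&& sgraph g, supp A g & kfree r g] by move: gf; rewrite inE.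
move: nb; rewrite inE gf /= => /asboolPn/contrapT[f [cf _]].
by rewrite inE sg pg; apply/existsP; exists f.
Qed.

(** Smallness is used twice: with [L] equal to 2 it yields the ratio [C] by induction on [#|A|],
    since half of [C] pays for the colorable graphs and half for the bad ones; with [L * C] it then
    yields the claim. *)
Lemma bad_negligible r m : 0 < r -> forall L, exists n0, forall (V : finType) (A : {set V}),
  n0 <= #|A| -> #|bad r m A| * L <= #|col_graphs r A|.
Proof.
move=> r0; have sb := small_bad m r0; have [n0 H0] := sb 2.
(* Below [n0] vertices the trivial count of all graphs has to suffice. *)
pose C := 2 * 2 ^ (n0 * n0).
have C0 : 0 < C by rewrite muln_gt0 expn_gt0.
have frC k (V : finType) (A : {set V}) : #|A| < k -> #|free_graphs r A| <= C * #|col_graphs r A|.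
  elim: k V A => // k IH V A Ak.
  have IH' (A' : {set V}) : A' \proper A -> #|free_graphs r A'| <= C * #|col_graphs r A'|.
    by move=> /proper_card lt; apply: IH; apply: leq_trans lt _.
  case: (leqP n0 #|A|) => n0A; last first.
    apply: leq_trans (card_free_graphs_le r A) _.
    apply: (@leq_trans C); last by rewrite leq_pmulr // col_graphs_gt0.
    apply: leq_trans (leq_pmull _ _) => //.
    by rewrite leq_exp2l // leq_mul // ltnW.
  have := H0 V A C n0A IH'; have := free_le_col_bad r m A.
  have : 2 * #|col_graphs r A| <= C * #|col_graphs r A|.
    by rewrite leq_mul2r; apply/orP; right; rewrite /C leq_pmulr // expn_gt0.
  by move: #|free_graphs r A| #|col_graphs r A| #|bad r m A| (C * _); clear; move=> *; lia.
move=> L; have [n1 H] := sb (L * C); exists n1 => V A nA.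
have := H V A C nA (fun A' _ => frC #|A'|.+1 V A' (ltnSn _)).
by rewrite mulnA mulnC leq_mul2l => /orP[/eqP C00|//]; rewrite C00 in C0.
Qed.

(** * First-order logic and back-and-forth *)

Lemma updE (T : Type) (a : nat -> T) i x : upd a i x i = x.
Proof. by rewrite /upd eqxx. Qed.

Lemma updN (T : Type) (a : nat -> T) i x j : j != i -> upd a i x j = a j.
Proof. by rewrite /upd => /negbTE->. Qed.

Lemma sat_fv (T : Type) (E : T -> T -> Prop) phi (a b : nat -> T) :
  (forall j, j \in fv phi -> a j = b j) -> sat E a phi <-> sat E b phi.
Proof.
elim: phi a b => [||i j|i j|f IH|f IHf g IHg|f IHf g IHg|f IHf g IHg|i f IH|i f IH] a b H //=.
- by rewrite !H ?inE ?eqxx ?orbT.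
- by rewrite !H ?inE ?eqxx ?orbT.
- by rewrite (IH a b).
- by rewrite (IHf a b) ?(IHg a b) // => j jf; apply: H; rewrite mem_cat jf ?orbT.
- by rewrite (IHf a b) ?(IHg a b) // => j jf; apply: H; rewrite mem_cat jf ?orbT.
- by rewrite (IHf a b) ?(IHg a b) // => j jf; apply: H; rewrite mem_cat jf ?orbT.
- have K x : sat E (upd a i x) f <-> sat E (upd b i x) f.
    apply: IH => j jf; rewrite /upd; case: eqP => // /eqP ji.
    by apply: H; rewrite mem_filter ji.
  by split=> -[x Hx]; exists x; apply/K.
- have K x : sat E (upd a i x) f <-> sat E (upd b i x) f.
    apply: IH => j jf; rewrite /upd; case: eqP => // /eqP ji.
    by apply: H; rewrite mem_filter ji.
  by split=> Hx x; apply/K.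
Qed.

Lemma sat_sentence (T : Type) (E : T -> T -> Prop) phi (a b : nat -> T) :
  sentence phi -> sat E a phi <-> sat E b phi.
Proof. by move=> s; apply: sat_fv => j; rewrite s. Qed.

(** Bound variables count too: the game is played with one pebble per variable index, so a single
    [N] serves all subformulas. *)
Fixpoint vbound (f : fo_form) : nat :=
  match f with
  | FTrue | FFalse => 0
  | FEq i j | FEdge i j => (maxn i j).+1
  | FNot g => vbound g
  | FAnd g h | FOr g h | FImp g h => maxn (vbound g) (vbound h)
  | FEx i g | FAll i g => maxn i.+1 (vbound g)
  end.

Definition proper_coloring (T : Type) (E : T -> T -> Prop) r (c : T -> 'I_r) :=
  (forall x y, E x y -> E y x) /\ (forall x y, E x y -> c x <> c y).

(* The sets of prescribed neighbours and non-neighbours are given as the first [N]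
   values of [a], split by [p]. *)
Definition extension (T : Type) (E : T -> T -> Prop) r (c : T -> 'I_r) N :=
  forall (i : 'I_r) (a : nat -> T) (p : nat -> Prop),
    (forall j l, j < N -> l < N -> a j = a l -> p j -> p l) ->
    (forall j, j < N -> p j -> c (a j) <> i) ->
    exists z, c z = i /\ forall j, j < N -> z <> a j /\ (E z (a j) <-> p j).

Definition agree (T T' : Type) (E : T -> T -> Prop) (E' : T' -> T' -> Prop)
    r (c : T -> 'I_r) (c' : T' -> 'I_r) N (a : nat -> T) (b : nat -> T') :=
  (forall j l, j < N -> l < N -> (a j = a l <-> b j = b l) /\ (E (a j) (a l) <-> E' (b j) (b l)))
  /\ (forall j, j < N -> c (a j) = c' (b j)).

Lemma agree_sym (T T' : Type) (E : T -> T -> Prop) (E' : T' -> T' -> Prop)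
    r (c : T -> 'I_r) (c' : T' -> 'I_r) N a b :
  agree E E' c c' N a b -> agree E' E c' c N b a.
Proof.
move=> [H1 H2]; split=> [j l jN lN|j jN]; last by rewrite H2.
by case: (H1 j l jN lN) => -> ->.
Qed.

(** If [x] already carries a pebble the answer is the matching vertex. Otherwise the extension
    property applies with the neighbours of [x] prescribed; properness of [c] keeps the color of [x]
    off that prescription. *)
Lemma forth (T T' : Type) (E : T -> T -> Prop) (E' : T' -> T' -> Prop)
    r (c : T -> 'I_r) (c' : T' -> 'I_r) N a b i x :
  proper_coloring E c -> proper_coloring E' c' -> extension E' c' N -> i < N -> agree E E' c c' N a b ->
  exists y, agree E E' c c' N (upd a i x) (upd b i y).
Proof.
move=> [sE pE] [sE' pE'] ex iN [H1 H2].
have [[j [jN ajx]]|new] := pselect (exists j, j < N /\ a j = x).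
  exists (b j).
  have K k : k < N -> exists2 k', k' < N & upd a i x k = a k' /\ upd b i (b j) k = b k'.
    move=> kN; have [->|ki] := eqVneq k i; first by exists j => //; rewrite !updE ajx.
    by exists k => //; rewrite !updN.
  split=> [k l kN lN|k kN].
    have [k' k'N [-> ->]] := K k kN; have [l' l'N [-> ->]] := K l lN.
    exact: H1.
  by have [k' k'N [-> ->]] := K k kN; apply: H2.
have [j l jN lN|j jN px|z [cz Hz]] := ex (c x) b (fun j => E x (a j)).
- by case: (H1 j l jN lN) => /iffRL H _ /H ->.
- by rewrite -H2 // => e; move: (pE _ _ px); rewrite e.
exists z; split=> [k l kN lN|k kN]; last first.
  have [->|ki] := eqVneq k i; first by rewrite !updE cz.
  by rewrite !updN //; apply: H2.
have xa j : j < N -> x <> a j by move=> jN e; apply: new; exists j.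
have [->|ki] := eqVneq k i; have [->|li] := eqVneq l i; rewrite ?updE ?updN //.
- split=> //; split=> [/pE|/pE'] //.
- have [zb Ez] := Hz l lN; split; first by split=> // /(xa _ lN).
  by rewrite Ez.
- have [zb Ez] := Hz k kN; split.
    by split=> [/esym/(xa _ kN)|/esym] //.
  by split=> [/sE|/sE'] ?; [apply/sE'/Ez | apply/sE/Ez].
- exact: H1.
Qed.

Lemma ef_game (T T' : Type) (E : T -> T -> Prop) (E' : T' -> T' -> Prop)
    r (c : T -> 'I_r) (c' : T' -> 'I_r) N phi a b :
  proper_coloring E c -> proper_coloring E' c' -> extension E c N -> extension E' c' N -> vbound phi <= N ->
  agree E E' c c' N a b -> sat E a phi <-> sat E' b phi.
Proof.
move=> pE pE' eE eE'.
have fo i x a0 b0 := @forth T T' E E' r c c' N a0 b0 i x pE pE' eE'.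
have bk i y a0 b0 : i < N -> agree E E' c c' N a0 b0 ->
    exists x, agree E E' c c' N (upd a0 i x) (upd b0 i y).
  move=> iN /agree_sym H.
  have [x /agree_sym Hx] := @forth T' T E' E r c' c N b0 a0 i y pE' pE eE iN H.
  by exists x.
elim: phi a b => [||i j|i j|f IH|f IHf g IHg|f IHf g IHg|f IHf g IHg|i f IH|i f IH] a b //=.
- by rewrite gtn_max => /andP[iN jN] [H _]; case: (H i j iN jN).
- by rewrite gtn_max => /andP[iN jN] [H _]; case: (H i j iN jN).
- by move=> fN ag; rewrite (IH a b).
- by rewrite geq_max => /andP[fN gN] ag; rewrite (IHf a b) // (IHg a b).
- by rewrite geq_max => /andP[fN gN] ag; rewrite (IHf a b) // (IHg a b).
- by rewrite geq_max => /andP[fN gN] ag; rewrite (IHf a b) // (IHg a b).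
- rewrite geq_max => /andP[iN fN] ag; split=> -[x Hx].
    by have [y Hy] := fo i x a b iN ag; exists y; apply/(IH _ _ fN Hy).
  by have [y Hy] := bk i x a b iN ag; exists y; apply/(IH _ _ fN Hy).
- rewrite geq_max => /andP[iN fN] ag; split=> H x.
    by have [y Hy] := bk i x a b iN ag; apply/(IH _ _ fN Hy).
  by have [y Hy] := fo i x a b iN ag; apply/(IH _ _ fN Hy).
Qed.

Lemma ef_sentence (T T' : Type) (E : T -> T -> Prop) (E' : T' -> T' -> Prop)
    r (c : T -> 'I_r) (c' : T' -> 'I_r) phi (x : T) (y : T') :
  proper_coloring E c -> proper_coloring E' c' ->
  extension E c (vbound phi) -> extension E' c' (vbound phi) ->
  sentence phi -> holds E phi <-> holds E' phi.
Proof.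
(* With no neighbour prescribed, the extension property supplies a vertex of the color of [x]; two
   constant assignments form the initial position. *)
move=> pE pE' eE eE' sphi; have [z [cz _]] := eE' (c x) (fun=> y) (fun=> False)
   (fun _ _ _ _ _ => id) (fun _ _ => False_ind _).
have ag : agree E E' c c' (vbound phi) (fun=> x) (fun=> z).
  split=> [j l _ _|j _]; last by rewrite cz.
  by split=> //; split=> [/pE.2|/pE'.2].
have K := ef_game pE pE' eE eE' (leqnn _) ag.
by split=> H a; [apply/(sat_sentence _ (fun=> z) _ sphi)/K/H|
   apply/(sat_sentence _ (fun=> x) _ sphi)/K/H].
Qed.

(** * Primitive positive sentences and colorings *)

Lemma sat_pp_hom (T T' : Type) (E : T -> T -> Prop) (E' : T' -> T' -> Prop) (h : T -> T') :
  (forall x y, E x y -> E' (h x) (h y)) -> forall phi a, is_pp phi ->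
  sat E a phi -> sat E' (h \o a) phi.
Proof.
move=> hE; elim=> [||i j|i j|f IH|f IHf g IHg|f IHf g IHg|f IHf g IHg|i f IH|i f IH] a //=.
- by move=> _ ->.
- by move=> _ /hE.
- by move=> [pf pg] [/(IHf _ pf) ? /(IHg _ pg) ?].
- move=> pf [x Hx]; exists (h x).
  have -> : upd (h \o a) i (h x) = h \o upd a i x.
    by apply/funext => j; rewrite /upd /=; case: eqP.
  exact: IH.
Qed.

(** A proper coloring is a homomorphism to K_r, and these preserve primitive positive sentences. *)
Lemma proper_models r (T : Type) (E : T -> T -> Prop) (c : T -> 'I_r) (t0 : T) :
  proper_coloring E c -> models_Tk r E.
Proof.
move=> [_ pE] phi sphi pp nK hE; apply: nK => a.
have hc x y : E x y -> K_E (c x) (c y) by move=> /pE/eqP.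
exact/(sat_sentence _ _ (c \o fun=> t0) sphi)/(sat_pp_hom hc pp)/hE.
Qed.

Fixpoint conjn n (F : nat -> fo_form) :=
  if n is n'.+1 then FAnd (conjn n' F) (F n') else FTrue.

Lemma sat_conjn (T : Type) (E : T -> T -> Prop) a n F :
  sat E a (conjn n F) <-> forall j, j < n -> sat E a (F j).
Proof.
elim: n => [|n IH] /=; first by split.
rewrite IH; split=> [[H1 H2] j|H].
  by rewrite ltnS leq_eqVlt => /orP[/eqP->|/H1].
by split=> [j jn|]; apply: H => //; apply: ltnW.
Qed.

Lemma pp_conjn n F : (forall j, is_pp (F j)) -> is_pp (conjn n F).
Proof. by move=> H; elim: n => //=. Qed.

Lemma qf_conjn n F : (forall j, is_qf (F j)) -> is_qf (conjn n F).
Proof. by move=> H; elim: n => //=. Qed.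

Lemma fv_conjn n F N : (forall j l, j < n -> l \in fv (F j) -> l < N) ->
  forall l, l \in fv (conjn n F) -> l < N.
Proof.
elim: n => [|n IH] //= H l; rewrite mem_cat => /orP[|]; last exact: H.
by apply: IH => j k jn; apply: H; apply: ltnW.
Qed.

Fixpoint ex_prefix n (f : fo_form) := if n is n'.+1 then FEx n' (ex_prefix n' f) else f.

Lemma sat_ex_prefix (T : Type) (E : T -> T -> Prop) a n f :
  sat E a (ex_prefix n f) <-> exists b, (forall j, n <= j -> b j = a j) /\ sat E b f.
Proof.
elim: n a => [|n IH] a /=.
  split=> [H|[b [ab H]]]; first by exists a.
  by apply/(@sat_fv _ _ _ a b) => // j _; rewrite ab.
split=> [[x /IH[b [ab H]]]|[b [ab H]]].
  by exists b; split=> // j nj; rewrite ab ?updN // ?gtn_eqF // ltnW.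
exists (b n); apply/IH; exists b; split=> // j.
by rewrite leq_eqVlt => /orP[/eqP<-|nj]; rewrite ?updE // updN ?ab // gtn_eqF.
Qed.

Lemma pp_ex_prefix n f : is_pp f -> is_pp (ex_prefix n f).
Proof. by move=> H; elim: n. Qed.

Lemma existential_ex_prefix n f : is_qf f -> is_existential (ex_prefix n f).
Proof. by move=> H; elim: n => //=; case: f H. Qed.

Lemma fv_ex_prefix n f : (forall l, l \in fv f -> l < n) -> sentence (ex_prefix n f).
Proof.
move=> H.
have K m : forall l, l \in fv (ex_prefix m f) -> m <= l < n.
  elim: m => [|m IH] l /=; first exact: H.
  by rewrite mem_filter => /andP[lm /IH/andP[ml ->]]; rewrite ltn_neqAle eq_sym lm ml.
rewrite /sentence; case e : (fv _) => [|l s] //.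
have : l \in fv (ex_prefix n f) by rewrite e mem_head.
by move=> /K; rewrite ltnNge andbN.
Qed.

(** The edges among the listed vertices form a primitive positive sentence true in [E], hence true
    in K_r; a witness there is a coloring of the list. *)
Lemma models_coloring_list r (T : Type) (E : T -> T -> Prop) (l : list T) : 0 < r ->
  models_Tk r E -> exists c : T -> 'I_r, forall x y, List.In x l -> List.In y l -> E x y -> c x <> c y.
Proof.
move=> r0 mE; case: l => [|t l]; first by exists (fun=> Ordinal r0).
set L := t :: l; pose v := nth t L; pose N := size L.
pose body := conjn N (fun i => conjn N (fun j => if `[< E (v i) (v j) >] then FEdge i j else FTrue)).
have ppb : is_pp (ex_prefix N body).
  by apply/pp_ex_prefix/pp_conjn => i; apply: pp_conjn => j; case: ifP.
have sb : sentence (ex_prefix N body).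
  apply: fv_ex_prefix; apply: fv_conjn => i k iN; apply: fv_conjn => j k' jN.
  by case: ifP => //= _; rewrite !inE => /orP[/eqP->|/eqP->].
have hE : holds E (ex_prefix N body).
  move=> a; apply/sat_ex_prefix; exists (fun j => if j < N then v j else a j); split.
    by move=> j; rewrite leqNgt => /negbTE->.
  apply/sat_conjn => i iN; apply/sat_conjn => j jN; case: asboolP => //= H.
  by rewrite iN jN.
have hK : holds (@K_E r) (ex_prefix N body).
  by apply: contrapT => nK; apply: (mE _ sb ppb nK hE).
have /sat_ex_prefix[b [_ /sat_conjn Hb]] := hK (fun=> Ordinal r0).
have idx x : List.In x L -> exists2 i, i < N & v i = x.
  rewrite /v /N; elim: (L) => [|y s IH] //= [->|/IH[i iN <-]]; first by exists 0.
  by exists i.+1.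
exists (fun x => if pselect (exists2 i, i < N & v i = x) is left h then b (sval (cid2 h)) else Ordinal r0).
move=> x y /idx hx /idx hy Exy.
case: pselect => // hx'; case: pselect => // hy'.
case: (cid2 hx') => i /= iN vi; case: (cid2 hy') => j /= jN vj.
have /sat_conjn/(_ j jN) := Hb i iN; case: asboolP => [_ /=|]; last by rewrite vi vj.
by move=> /eqP.
Qed.

(** The compactness theorem of De Bruijn and Erdos, by an ultrafilter. *)
Lemma models_proper r (T : Type) (E : T -> T -> Prop) : 0 < r -> is_graph E ->
  models_Tk r E -> exists c : T -> 'I_r, proper_coloring E c.
Proof.
move=> r0 sE mE.
have [C HC] := choice (fun l => @models_coloring_list r T E l r0 mE).
(* The filter generated by the sets of lists containing a given finite list; along an ultrafilter
   refining it, the color of each vertex is eventually constant. *)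
pose F : classical_sets.set_system (list T) := fun S =>
  exists l0, forall l, (forall x, List.In x l0 -> List.In x l) -> S l.
have FF : filter.ProperFilter F.
  split; first by move=> [l0 /(_ l0)]; apply.
  split.
  - by exists nil.
  - move=> P Q [l1 H1] [l2 H2]; exists (l1 ++ l2)%list => l Hl.
    by split; [apply: H1|apply: H2] => x xl; apply: Hl; apply/List.in_or_app; [left|right].
  - by move=> P Q sPQ [l1 H1]; exists l1 => l /H1; apply: sPQ.
have [G [UG FG]] := filter.ultraFilterLemma FF.
have PG : filter.ProperFilter G := @filter.ultra_proper _ _ UG.
have FiG : filter.Filter G := @filter.filter_filter _ _ PG.
have col x : exists i, G (fun l => C l x = i).
  apply: contrapT => /forallNP H.
  have K (s : seq 'I_r) : G (fun l => C l x \notin s).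
    elim: s => [|i s IH]; first by apply: filter.filterS (@filter.filterT _ _ FiG).
    have [/H//|Hi] := filter.in_ultra_setVsetC (fun l => C l x = i) UG.
    apply: filter.filterS (filter.filterI Hi IH) => l [/= n1 n2].
    by rewrite inE negb_or n2 andbT; apply/eqP.
  apply: (@filter.filter_not_empty _ _ PG); apply: filter.filterS (K (enum 'I_r)) => l.
  by rewrite mem_enum.
have [c Hc] := choice col.
exists c; split=> // x y Exy cxy.
have Gxy : G (fun l => List.In x l /\ List.In y l).
  apply: FG; exists [:: x; y] => l Hl.
  by split; apply: Hl => /=; [left | right; left].
apply: (@filter.filter_not_empty _ _ PG).
apply: filter.filterS (filter.filterI Gxy (filter.filterI (Hc x) (Hc y))) => l [[xl yl] [cx cy]].
by apply: (HC l x y xl yl Exy); rewrite cx cy cxy.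
Qed.

(** * The generic r-partite graph *)

(** Because [holds] quantifies over assignments, an empty type satisfies every sentence, even the
    existence of a loop, which K_r refutes. *)
Lemma models_inhabited r (T : Type) (E : T -> T -> Prop) : 0 < r -> models_Tk r E ->
  exists t : T, True.
Proof.
move=> r0 mE; apply: contrapT => noT.
apply: (mE (FEx 0 (FEdge 0 0)) erefl I) => [/(_ (fun=> Ordinal r0))[x]|a].
  by rewrite /K_E /= eqxx.
by case: noT; exists (a 0).
Qed.

Section Generic.
Context (r : nat) (r0 : 0 < r) (U : Type) (E : U -> U -> Prop) (c : U -> 'I_r).
Hypotheses (gE : generic_partite r E) (pE : proper_coloring E c).

Let u0 : U.
Proof. by case: gE => _ [_ [mE _]]; have /cid[t _] := models_inhabited r0 mE. Qed.

(** Variables below [r] denote the [r] added vertices, all others keep the value [t]. *)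
Let tord n (t : U + 'I_r) : U + 'I_r := if insub n is Some l then inr l else t.

Let tordE (l : 'I_r) t : tord l t = inr l.
Proof. by rewrite /tord valK. Qed.

(** Adding an r-clique whose adjacency to [U] respects the colors keeps the graph r-colorable, so
    existential closedness pulls the new vertices back into [U], for any quantifier-free condition
    on them. *)
Lemma extend_generic (adj : 'I_r -> U -> Prop) phi (a : nat -> U) :
  (forall l u, adj l u -> c u <> l) ->
  is_qf phi ->
  let E' s t := match s, t with
    | inl u, inl v => E u v
    | inr l, inr l' => l <> l'
    | inl u, inr l | inr l, inl u => adj l u end in
  sat E' (fun n => tord n (inl (a n))) phi ->
  exists b, (forall n, r <= n -> b n = a n) /\ sat E b phi.
Proof.
move=> adjP qf E' H; case: gE => _ [sE [mE ec]].
pose c' s := match s with inl u => c u | inr l => l end.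
have pE' : proper_coloring E' c'.
  split=> [[u|l] [v|l']|[u|l] [v|l']] //=.
  - exact: sE.
  - by move=> ll e; apply: ll.
  - exact: pE.2.
  - exact: adjP.
  - by move=> /adjP H' e; apply: H'.
have mE' : models_Tk r E' := proper_models (inl u0) pE'.
have emb : embedding E E' inl by split=> [x y []|x y].
have := ec _ E' inl pE'.1 mE' emb (ex_prefix r phi) a (existential_ex_prefix _ qf).
rewrite !sat_ex_prefix; apply; exists (fun n => tord n (inl (a n))); split=> // n rn.
by rewrite /tord insubN // -leqNgt.
Qed.

Definition clique_form := conjn r (fun l => conjn r (fun l' => if l != l' then FEdge l l' else FTrue)).

Lemma sat_clique_form (T : Type) (F : T -> T -> Prop) b :
  sat F b clique_form <-> forall l l' : 'I_r, l <> l' -> F (b l) (b l').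
Proof.
rewrite sat_conjn; split=> [H l l' ll|H l lr].
  have /sat_conjn/(_ l' (ltn_ord l')) := H l (ltn_ord l).
  by case: eqP => // /val_inj/ll.
apply/sat_conjn => l' l'r; case: eqP => //= ll.
by apply: (H (Ordinal lr) (Ordinal l'r)) => -[].
Qed.

Lemma qf_clique_form : is_qf clique_form.
Proof. by apply: qf_conjn => l; apply: qf_conjn => l'; case: ifP. Qed.

Lemma inj_bij (d : 'I_r -> 'I_r) : injective d -> forall i, exists j, d j = i.
Proof. by move=> inj i; exists (invF inj i); rewrite f_invF. Qed.

Lemma generic_frame : exists k : 'I_r -> U,
  (forall i, c (k i) = i) /\ forall i j, i <> j -> E (k i) (k j).
Proof.
have [|//|b [_ /sat_clique_form Hb]] :=
  @extend_generic (fun _ _ => False) clique_form (fun=> u0) _ qf_clique_form.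
- by [].
- by apply/sat_clique_form => l l' ll /=; rewrite !tordE.
have inj : injective (fun l : 'I_r => c (b l)).
  by move=> l l' e; apply: contrapT => ll; apply: (pE.2 _ _ (Hb l l' ll)).
have [s Hs] := choice (inj_bij inj).
exists (fun i => b (s i)); split=> // i j ij; apply: Hb => e.
by apply: ij; rewrite -(Hs i) e Hs.
Qed.

(* In the extended graph the new clique has its colors forced by the old one, so the
   witness that existential closedness provides in [U] gets color [i]. *)
Lemma generic_extension N : extension E c N.
Proof.
move=> i a p cons colp; have [k [ck Ek]] := generic_frame.
(* Layout of the variables: indices below [r] for the new clique, the next [N] for the values of
   [a], the last [r] for the old clique [k]. *)
pose al n := if n < r then u0 else if n < r + N then a (n - r) else
   if insub (n - (r + N)) is Some l then k l else u0.
have al1 j : j < N -> al (r + j) = a j.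
  by move=> jN; rewrite /al ltnNge leq_addr /= ltn_add2l jN addKn.
have al2 (l : 'I_r) : al (r + N + l) = k l.
  by rewrite /al ltnNge -addnA leq_addr /= ltn_add2l ltnNge leq_addr /= addnA addKn valK.
pose F2 := conjn r (fun l => conjn r (fun l' =>
  if (l != i) && (l' != l) then FEdge l (r + N + l') else FTrue)).
pose F3 := conjn N (fun j => FAnd (FNot (FEq i (r + j)))
  (if `[< p j >] then FEdge i (r + j) else FNot (FEdge i (r + j)))).
pose adj l u := if l == i then exists j, j < N /\ p j /\ u = a j else exists l', l' <> l /\ u = k l'.
have adjP l u : adj l u -> c u <> l.
  rewrite /adj; case: eqP => [-> [j [jN [pj ->]]]|_ [l' [ll ->]]]; first exact: colp.
  by rewrite ck.
have qf : is_qf (FAnd clique_form (FAnd F2 F3)).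
  split; first exact: qf_clique_form.
  split; first by apply: qf_conjn => l; apply: qf_conjn => l'; case: ifP.
  by apply: qf_conjn => j /=; split=> //; case: ifP.
have t1 n t : r <= n -> tord n t = t by move=> rn; rewrite /tord insubN // -leqNgt.
have [|b [ab [/sat_clique_form b1 [/sat_conjn b2 /sat_conjn b3]]]] :=
  @extend_generic adj _ al adjP qf.
  split; first by apply/sat_clique_form => l l' ll /=; rewrite !tordE.
  split.
    apply/sat_conjn => l lr; apply/sat_conjn => l' l'r; case: ifP => //= /andP[li ll].
    rewrite -[l]/(nat_of_ord (Ordinal lr)) tordE t1; last by rewrite -addnA leq_addr.
    rewrite -[l']/(nat_of_ord (Ordinal l'r)) al2 /adj.
    case: eqP => [e|_]; first by rewrite -e eqxx in li.
    by exists (Ordinal l'r); split=> // -[e]; rewrite e eqxx in ll.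
  apply/sat_conjn => j jN; rewrite /= tordE t1 ?leq_addr // al1 //; split=> //.
  case: asboolP => /= pj; rewrite tordE t1 ?leq_addr // al1 // /adj eqxx.
    by exists j.
  by move=> [j' [j'N [pj' e]]]; apply: pj; apply: (cons j' j).
have b2' (l l' : 'I_r) : l <> i -> l' <> l -> E (b l) (k l').
  move=> li ll; have /sat_conjn/(_ l' (ltn_ord l')) := b2 l (ltn_ord l).
  have -> : (nat_of_ord l != i) by apply/eqP => /val_inj.
  have -> /= : (nat_of_ord l' != l) by apply/eqP => /val_inj.
  by rewrite (ab (r + N + l')) ?al2 // -addnA leq_addr.
have cb (l : 'I_r) : l <> i -> c (b l) = l.
  move=> li; apply: contrapT => cl.
  by have /pE.2 := b2' l (c (b l)) li cl; rewrite ck.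
have ci : c (b i) = i.
  apply: contrapT => cl.
  have /pE.2 := b1 i (c (b i)) (fun e => cl (esym e)).
  by rewrite (cb _ cl).
exists (b i); split=> // j jN; have [/= n1 n2] := b3 j jN.
rewrite (ab (r + j)) ?leq_addr // al1 // in n1; split=> //.
by move: n2; case: asboolP => /= pj; rewrite (ab (r + j)) ?leq_addr // al1.
Qed.
End Generic.

(** * From the extension property to existential closedness *)

Lemma ext_clique r (U : Type) (E : U -> U -> Prop) (c : U -> 'I_r) (u0 : U) (J : seq 'I_r) (P : list U) :
  proper_coloring E c -> (forall N, extension E c N) -> uniq J -> (forall x, List.In x P -> c x \notin J) ->
  exists y : 'I_r -> U, forall l, l \in J ->
    [/\ c (y l) = l, forall x, List.In x P -> E (y l) x &
     forall l', l' \in J -> l <> l' -> E (y l) (y l')].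
Proof.
move=> pE eE; elim: J P => [|i J IH] P /=; first by exists (fun=> u0).
move=> /andP[iJ uJ] HP.
have [|j jN _|z [cz Hz]] := eE (size P) i (nth u0 P) (fun=> True).
- by [].
- have : List.In (nth u0 P j) P.
    by elim: (P) j jN => [|x s IHs] [|j] //= jN; [left | right; apply: IHs].
  by move=> /HP; rewrite inE negb_or => /andP[/eqP].
have HzP x : List.In x P -> E z x.
  move=> xP; have [j jN <-] : exists2 j, j < size P & nth u0 P j = x.
    elim: (P) xP => [|x' s IHs] //= [->|/IHs[j jN e]]; first by exists 0.
    by exists j.+1.
  by apply/(Hz j jN).2.
have [//|x|y Hy] := IH (z :: P)%list.
  move=> [<-|/HP]; first by rewrite cz.
  by rewrite inE negb_or => /andP[].
exists (fun l => if l == i then z else y l) => l; rewrite inE.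
have [->|li] /= := eqVneq l i.
  move=> _; split=> // l'; rewrite inE; case: eqP => [->|_] //= l'J _.
  by apply: pE.1; case: (Hy l' l'J) => _ H _; apply: H; left.
move=> lJ; have [c1 c2 c3] := Hy l lJ; split=> //.
  by move=> x xP; apply: c2; right.
move=> l'; rewrite inE; case: eqP => [->|_] //= l'J ll; last exact: c3.
by apply: c2; left.
Qed.

(* Two vertices of the same color have a common neighbourhood containing K_{r-1},
   which forces them to agree in every other proper coloring. *)
Lemma coloring_rigid r (U : Type) (E : U -> U -> Prop) (c c' : U -> 'I_r) (u0 : U) :
  proper_coloring E c -> (forall N, extension E c N) -> proper_coloring E c' ->
  exists2 s : 'I_r -> 'I_r, injective s & forall x, c' x = s (c x).
Proof.
move=> pE eE pE'.
have [//|k Hk] := @ext_clique r U E c u0 (enum 'I_r) nil pE eE (enum_uniq _).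
have Ek i j : i <> j -> E (k i) (k j).
  by move=> ij; case: (Hk i (mem_enum _ _)) => _ _; apply=> //; rewrite mem_enum.
have ck i : c (k i) = i by case: (Hk i (mem_enum _ _)).
exists (fun i => c' (k i)).
  by move=> i j e; apply: contrapT => /Ek/pE'.2.
move=> x; set i := c x.
have [||y Hy] := @ext_clique r U E c u0 [seq l <- enum 'I_r | l != i] [:: x; k i]%list pE eE.
- by rewrite filter_uniq // enum_uniq.
- by move=> z /= [<-|[<-|//]]; rewrite mem_filter ?ck eqxx.
have yJ l : l <> i -> l \in [seq l <- enum 'I_r | l != i].
  by move=> /eqP li; rewrite mem_filter li mem_enum.
pose d l := if l == i then c' x else c' (y l).
have inj : injective d.
  move=> l l'; rewrite /d; case: eqP => [->|li]; case: eqP => [->|l'i] // e.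
  - have [_ H _] := Hy l' (yJ l' l'i); case: (pE'.2 _ _ (H x (or_introl erefl))).
    by rewrite e.
  - have [_ H _] := Hy l (yJ l li); case: (pE'.2 _ _ (H x (or_introl erefl))).
    by rewrite e.
  - apply: contrapT => ll; have [_ _ H] := Hy l (yJ l li).
    by case: (pE'.2 _ _ (H l' (yJ l' l'i) ll)).
have [l] := inj_bij inj (c' (k i)); rewrite /d; case: eqP => // li e.
have [_ H _] := Hy l (yJ l li).
by case: (pE'.2 _ _ (H (k i) (or_intror (or_introl erefl)))).
Qed.

Lemma sat_qf_agree (T T' : Type) (E : T -> T -> Prop) (E' : T' -> T' -> Prop)
    r (c : T -> 'I_r) (c' : T' -> 'I_r) N phi a b :
  is_qf phi -> vbound phi <= N -> agree E E' c c' N a b -> sat E a phi <-> sat E' b phi.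
Proof.
move=> + + ag.
elim: phi => [||i j|i j|f IH|f IHf g IHg|f IHf g IHg|f IHf g IHg|i f IH|i f IH] //=.
- by rewrite gtn_max => _ /andP[iN jN]; case: (ag.1 i j iN jN).
- by rewrite gtn_max => _ /andP[iN jN]; case: (ag.1 i j iN jN).
- by move=> qf fN; rewrite IH.
- by rewrite geq_max => -[qf qg] /andP[fN gN]; rewrite IHf // IHg.
- by rewrite geq_max => -[qf qg] /andP[fN gN]; rewrite IHf // IHg.
- by rewrite geq_max => -[qf qg] /andP[fN gN]; rewrite IHf // IHg.
Qed.

(** For existential formulas only the forth direction is played, so only the target needs the
    extension property. *)
Lemma sat_existential_agree (T T' : Type) (E : T -> T -> Prop) (E' : T' -> T' -> Prop)
    r (c : T -> 'I_r) (c' : T' -> 'I_r) N phi a b :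
  proper_coloring E c -> proper_coloring E' c' -> extension E' c' N ->
  is_existential phi -> vbound phi <= N -> agree E E' c c' N a b -> sat E a phi -> sat E' b phi.
Proof.
move=> pE pE' eE'.
elim: phi a b => [||i j|i j|f IH|f IHf g IHg|f IHf g IHg|f IHf g IHg|i f IH|i f IH] a b ef fN ag;
  try by move=> /(sat_qf_agree ef fN ag).
move: fN; rewrite /= geq_max => /andP[iN fN] [x Hx].
have [y Hy] := forth x pE pE' eE' iN ag.
by exists y; apply: IH Hx.
Qed.

(** The larger model has some proper coloring. By [coloring_rigid] its restriction is the given one
    up to a permutation of the colors; undoing the permutation makes the embedding an initial
    position of the game. *)
Lemma extension_ec r (U : Type) (E : U -> U -> Prop) (c : U -> 'I_r) (u0 : U) : 0 < r ->
  proper_coloring E c -> (forall N, extension E c N) -> ec_Tk r E.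
Proof.
move=> r0 pE eE V E' f sE' mE' [injf Ef] phi a ex.
have [d pd] := models_proper r0 sE' mE'.
have pdf : proper_coloring E (d \o f).
  split; first exact: pE.1.
  by move=> x y /Ef/pd.2.
have [s injs Hs] := coloring_rigid u0 pE eE pdf.
have [t Ht] := choice (inj_bij injs).
have pt : proper_coloring E' (t \o d).
  split=> // x y /pd.2 dxy /= e; apply: dxy.
  by rewrite -(Ht (d x)) e Ht.
apply: (sat_existential_agree pt pE (eE (vbound phi)) ex (leqnn _)).
split=> [j l _ _|j _] /=.
  by split; [split=> [/injf|->] | rewrite Ef].
by apply: injs; rewrite Ht -Hs.
Qed.

(** * An explicit model *)

Section Example.
Context (r : nat) (r0 : 0 < r).
Let col (x : nat) : 'I_r := Ordinal (ltn_pmod x r0).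
(** The r-partite form of the Ackermann coding of the random graph: the residue modulo [r] is the
    color, and the bits of the quotient list the smaller candidates for neighbours. *)
Let edge (x y : nat) : Prop := col x <> col y /\
  ((x < y /\ PeanoNat.Nat.testbit (y %/ r) x) \/ (y < x /\ PeanoNat.Nat.testbit (x %/ r) y)).

Let bits (s : seq nat) := foldr (fun n t => PeanoNat.Nat.setbit t n) 0 s.

Let testbit_bits s n : PeanoNat.Nat.testbit (bits s) n = (n \in s).
Proof.
elim: s => [|m s IH] /=; first by rewrite PeanoNat.Nat.bits_0.
rewrite PeanoNat.Nat.setbit_eqb IH inE; congr (_ || _).
by apply/PeanoNat.Nat.eqb_spec/eqP.
Qed.

Let testbit_lt t n : PeanoNat.Nat.testbit t n -> n < t.
Proof.
move=> H; rewrite ltnNge; apply/negP => tn; move: H.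
case: t tn => [|t] tn; first by rewrite PeanoNat.Nat.bits_0.
rewrite PeanoNat.Nat.bits_above_log2 //.
have := PeanoNat.Nat.log2_lt_lin t.+1; lia.
Qed.

Lemma example_proper : proper_coloring edge col.
Proof.
split=> x y; last by case.
by move=> [cxy H]; split; [move=> e; apply: cxy; rewrite e | case: H; [right|left]].
Qed.

Lemma example_extension N : extension edge col N.
Proof.
move=> i a p cons colp.
pose M := \sum_(j < N) (a j).+1.
(* The extra bit [M] lies above all [a j]: it makes [z] larger than each of them without affecting
   their adjacency. *)
pose s := M :: [seq a j | j <- iota 0 N & `[< p j >]].
pose z := bits s * r + i.
have aM j : j < N -> a j < M.
  by move=> jN; rewrite /M (bigD1 (Ordinal jN)) //= leq_addr.
have Mz : M < z.
  apply: (@leq_trans (bits s)); last by rewrite /z; apply: leq_trans (leq_addr _ _); rewrite leq_pmulr.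
  by apply: testbit_lt; rewrite testbit_bits mem_head.
have zr : z %/ r = bits s by rewrite /z divnMDl // divn_small // addn0.
have cz : col z = i by apply: val_inj; rewrite /= /z modnMDl modn_small.
exists z; split=> // j jN; have az : a j < z := ltn_trans (aM j jN) Mz.
have bit : PeanoNat.Nat.testbit (z %/ r) (a j) <-> p j.
  rewrite zr testbit_bits inE; split.
    case/orP=> [/eqP e|]; first by move: (aM j jN); rewrite e ltnn.
    move=> /mapP[l]; rewrite mem_filter mem_iota => /andP[/asboolP pl lN] e.
    by apply: (cons l j) => //; rewrite e.
  move=> pj; apply/orP; right; apply/mapP; exists j => //.
  by rewrite mem_filter mem_iota /= add0n jN andbT; apply/asboolP.
split; first by move=> e; rewrite -e ltnn in az.
split=> [[_ [[zj _]|[_ /bit//]]]|pj]; first by have := ltn_trans zj az; rewrite ltnn.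
split; first by rewrite cz => /esym; apply: colp.
by right; split=> //; apply/bit.
Qed.

Lemma generic_exists : exists (U : Type) (E : U -> U -> Prop), generic_partite r E.
Proof.
exists nat, edge; split; first by exists id.
split; first exact: example_proper.1.
split; first exact: (proper_models 0 example_proper).
exact: (extension_ec 0 r0 example_proper example_extension).
Qed.
End Example.

(** * The almost-sure theory *)

Lemma good_extension r n (g : lgraph n) N : sgraph g -> good r N setT g ->
  exists c : 'I_n -> 'I_r, proper_coloring (@ladj n g) c /\ extension (@ladj n g) c N.
Proof.
move=> sg [f [/coloringP cf ef]]; have [irr sy] := sgraphP _ sg.
exists f; split.
  by split=> x y; rewrite /ladj; [rewrite sy | move=> /cf/eqP].
move=> i a p cons colp.
pose P := [set a j | j : 'I_N & `[< p j >]]; pose Q := [set a j | j : 'I_N & ~~ `[< p j >]].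
have cim (D : pred 'I_N) : #|[set a j | j : 'I_N & D j]| <= N.
  by apply: leq_trans (leq_imset_card _ _) _; apply: leq_trans (max_card _) _; rewrite card_ord.
have [||||||z [_ fz zQ Pz Qz]] := ef i P Q.
- exact: subsetT.
- exact: subsetT.
- exact: cim.
- exact: cim.
- rewrite -setI_eq0; apply/set0Pn => -[x]; rewrite inE => /andP[/imsetP[j + ->] /imsetP[l + e]].
  rewrite !inE => /asboolP pj /asboolP; apply.
  exact: (cons j l).
- by move=> x /imsetP[j + ->]; rewrite inE => /asboolP pj; apply/eqP/colp.
exists z; split=> // j jN.
have [pj|pj] := pselect (p j).
  have zj : g (z, a j).
    rewrite -in_nb; apply: (subsetP Pz); apply/imsetP; exists (Ordinal jN) => //.
    by rewrite inE; apply/asboolP.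
  by split=> // e; move: zj; rewrite e irr.
have jQ : a j \in Q.
  by apply/imsetP; exists (Ordinal jN) => //; rewrite inE; apply/asboolP.
split; first by move=> e; move: zQ; rewrite e jQ.
by split=> // zj; move: (disjointFr Qz jQ); rewrite in_nb zj.
Qed.

Section Forb.
Context (F : finite_graph -> Prop) (k : nat) (hk : is_kF F k) (k1 : 1 < k).

Lemma col_sub_Forb n : col_graphs k.-1 [set: 'I_n] \subset [set g : lgraph n | `[< in_Forb F g >]].
Proof.
apply/subsetP => g; rewrite inE => /and3P[/sgraphP[irr sy] _ /existsP[f /coloringP cf]].
rewrite inE; apply/asboolP; split=> // H FH [h hh].
have := hk.2 H FH; rewrite /chi; case: ex_minnP => m _ mmin.
rewrite leqNgt => /negP; apply; rewrite -(ltn_predK k1) ltnS.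
apply: mmin; apply/asboolP; exists (fun x => f (h x)) => x y xy.
exact/cf/hh.
Qed.

Lemma Forb_sub_free_graphs n : [set g : lgraph n | `[< in_Forb F g >]] \subset free_graphs k.-1 [set: 'I_n].
Proof.
apply/subsetP => g; rewrite inE => /asboolP[[irr sy] noH]; rewrite inE; apply/and3P; split.
- exact/sgraphP.
- by apply/suppP => x y _; rewrite !inE.
apply/forallP => K; rewrite (ltn_predK k1); apply/implyP => /eqP cK; apply/negP => /cliqueP clK.
have [[H0 [FH0 chiH]] _] := hk; apply: (noH H0 FH0).
move: chiH; rewrite /chi; case: ex_minnP => m /asboolP[f hf] _ mk.
pose e (i : 'I_m) : 'I_#|K| := cast_ord (etrans mk (esym cK)) i.
exists (fun x => enum_val (e (f x))) => x y /hf fxy.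
apply: clK; rewrite ?enum_valP //.
by rewrite (inj_eq enum_val_inj) (inj_eq (@cast_ord_inj _ _ _)).
Qed.

(** A sandwich: the exceptions are K_k-free and hence among the bad graphs, while the class contains
    all (k-1)-colorable graphs, against which the bad ones are negligible. *)
Lemma Forb_almost_all N L : exists n0, forall n, n0 <= n ->
  forall X : {set lgraph n},
  (forall g, g \in X -> in_Forb F g) ->
  (forall g c, g \in X -> proper_coloring (@ladj n g) c -> extension (@ladj n g) (r := k.-1) c N -> False) ->
  #|X| * L <= count_Forb F n.
Proof.
have r0 : 0 < k.-1 by rewrite -ltnS (ltn_predK k1).
have [n0 H0] := bad_negligible N r0 L; exists n0 => n nn X XF HX.
apply: leq_trans (subset_leq_card (col_sub_Forb n)).
apply: (@leq_trans (#|bad k.-1 N [set: 'I_n]| * L)); last by apply: H0; rewrite cardsT card_ord.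
rewrite leq_mul2r; apply/orP; right; apply/subset_leq_card/subsetP => g gX.
have gfr : g \in free_graphs k.-1 [set: 'I_n].
  by apply: (subsetP (Forb_sub_free_graphs n)); rewrite inE; apply/asboolP/XF.
rewrite inE gfr; apply/asboolP => gg.
have sg : sgraph g by move: gfr; rewrite inE => /and3P[].
by have [c [pc ec]] := good_extension sg gg; apply: (HX g c).
Qed.

Lemma count_Forb_gt0 n : 0 < count_Forb F n.
Proof.
apply: leq_trans (subset_leq_card (col_sub_Forb n)); apply: col_graphs_gt0.
by rewrite -ltnS (ltn_predK k1).
Qed.

Import Order.TTheory GRing.Theory Num.Theory.
Local Open Scope ring_scope.

Lemma ex_invr_lt (eps : rat) : 0 < eps -> exists L : nat, eps^-1 < L%:R.
Proof. by move=> e0; exists (Num.Def.archi_bound eps^-1); apply: archi_boundP; rewrite invr_ge0 ltW. Qed.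

Lemma prob_Forb_lower phi n L (eps : rat) : 0 < eps -> eps^-1 < L%:R ->
  (#|[set g : lgraph n | `[< in_Forb F g /\ ~ holds (@ladj n g) phi >]]| * L <= count_Forb F n)%N ->
  1 - eps < prob_Forb F phi n.
Proof.
move=> e0 eL le; have c0 := count_Forb_gt0 n.
have c0' : 0 < (count_Forb F n)%:R :> rat by rewrite ltr0n.
rewrite /prob_Forb ltr_pdivlMr // mulrBl mul1r ltrBlDl.
have tot : (count_Forb F n <= #|[set g : lgraph n | `[< in_Forb F g /\ ~ holds (@ladj n g) phi >]]|
   + count_Forb_sat F phi n)%N.
  apply: leq_trans (leq_card_setU _ _); apply/subset_leq_card/subsetP => g.
  rewrite !inE => /asboolP gF; have [h|h] := pselect (holds (@ladj n g) phi).
    by apply/orP; right; apply/asboolP.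
  by apply/orP; left; apply/asboolP.
move: le tot; set b := #|_| => le tot.
apply: (@le_lt_trans _ _ (b%:R + (count_Forb_sat F phi n)%:R)).
  by rewrite -natrD ler_nat.
rewrite ltrD2r; have L0 : 0 < L%:R :> rat by apply: lt_trans eL; rewrite invr_gt0.
have bL : b%:R * L%:R <= (count_Forb F n)%:R :> rat by rewrite -natrM ler_nat.
rewrite -(ltr_pM2r L0); apply: (le_lt_trans bL).
rewrite mulrAC -[X in X < _]mul1r ltr_pM2r //.
by rewrite -[X in X < _](mulfV (lt0r_neq0 e0)) ltr_pM2l.
Qed.

Lemma prob_Forb_half phi n :
  (count_Forb_sat F phi n * 2 <= count_Forb F n)%N -> ~ (1 - 2^-1 < prob_Forb F phi n).
Proof.
move=> le; apply/negP; rewrite -leNgt (_ : 1 - 2^-1 = 2^-1) //.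
have c0' : 0 < (count_Forb F n)%:R :> rat by rewrite ltr0n count_Forb_gt0.
rewrite /prob_Forb ler_pdivrMr // mulrC ler_pdivlMr ?ltr0n //.
by rewrite -natrM ler_nat.
Qed.
End Forb.

Theorem theorem3p1 (F : finite_graph -> Prop) (hF : exists G, F G)
  (k : nat) (hk : is_kF F k) (hk2 : (1 < k)%N) :
  (exists (U : Type) (E : U -> U -> Prop), generic_partite k.-1 E) /\
  (forall (U : Type) (E : U -> U -> Prop), generic_partite k.-1 E ->
     forall phi : fo_form, sentence phi ->
       (almost_sure F phi <-> holds E phi)).
Proof.
have r0 : 0 < k.-1 by rewrite -ltnS (ltn_predK hk2).
split; first exact: (generic_exists r0).
move=> U E gE phi sphi; have [_ [sE [mE _]]] := gE.
have [c pE] := models_proper r0 sE mE.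
have eE := generic_extension r0 gE pE.
have [u0 _] := models_inhabited r0 mE.
(* A nonempty vertex set is required, because the game starts from a vertex on each side. *)
have transfer n (g : lgraph n) cg : 0 < n -> proper_coloring (@ladj n g) cg ->
    extension (@ladj n g) (r := k.-1) cg (vbound phi) -> holds (@ladj n g) phi <-> holds E phi.
  by case: n g cg => // n g cg _ pg eg; exact: (ef_sentence ord0 u0 pg pE eg (eE _) sphi).
split=> [as_phi|Ephi].
  apply: contrapT => nE.
  (* If [phi] fails in [U], the members satisfying it are all exceptional, hence at most half of the
     class; this refutes the limit at [eps] equal to 1/2. *)
  have [n0 H0] := Forb_almost_all hk hk2 (vbound phi) 2.
  have [N HN] := as_phi (2^-1)%R isT.
  pose n := maxn N (maxn n0 1).
apply: (prob_Forb_half hk hk2 _ (HN n (leq_maxl _ _))); apply: H0.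
  - by rewrite /n !leq_max leqnn orbT.
  - by move=> g; rewrite inE => /asboolP[].
  - move=> g cg; rewrite inE => /asboolP[_ hg] pg eg; apply: nE.
    by apply/(transfer n g cg _ pg eg) => //; rewrite /n !leq_max !orbT.
move=> eps e0; have [L eL] := ex_invr_lt e0.
have [n0 H0] := Forb_almost_all hk hk2 (vbound phi) L.
exists (maxn n0 1) => n; rewrite geq_max => /andP[n0n n1].
apply: (prob_Forb_lower hk hk2 e0 eL); apply: H0 => //.
- by move=> g; rewrite inE => /asboolP[].
- move=> g cg; rewrite inE => /asboolP[_ hg] pg eg; apply: hg.
  by apply/(transfer n g cg n1 pg eg).
Qed.
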